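(* Let $(\mathcal W^E,g^E,\boldsymbol{\mathcal F},\Sigma)$ define a simply connected, asymptotically flat, stationary and axially symmetric electrovacuum spacetime with a connected boundary $\Sigma$ preserving the symmetries. Consider a family of Dirichlet boundary data on $\Sigma$ for the Ernst and electromagnetic potentials depending on three real parameters, encoded in $\omega\in\mathbb R$ and $\lambda\in\mathbb C$, i.e. $\{\mathcal E|_\Sigma,\Lambda|_\Sigma\}(\omega,\lambda)$, so that it is determined up to transformations of the form $$\Lambda|_\Sigma\to\Lambda'|_\Sigma=\Lambda|_\Sigma+\lambda,\qquad \mathcal E|_\Sigma\to\mathcal E'|_\Sigma=\mathcal E|_\Sigma-\lambda\bar\lambda+i\omega-2\bar\lambda\,\Lambda|_\Sigma .$$ Consider its completion to Cauchy boundary data by adding the data $\{d\mathcal E|_\Sigma,d\Lambda|_\Sigma\}(\omega,\lambda)$, determined up to transformations of the form $$d\Lambda'|_\Sigma=d\Lambda|_\Sigma,\qquad d\mathcal E'|_\Sigma=d\mathcal E|_\Sigma-2\bar\lambda\,d\Lambda|_\Sigma .$$ If within the $(\omega,\lambda)$-family of Cauchy data sets there is a Cauchy data set for which a solution with $M>0$ exists, then there is no solution with $M>0$ for any other Cauchy data set within the family.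
   Context: Units $G=c=1$. An electromagnetic 2-form $\boldsymbol F$ is encoded in $\boldsymbol{\mathcal F}=\boldsymbol F+i*\boldsymbol F$ ($*$ is the Hodge dual), with energy-momentum $T_{\mu\nu}=\frac1{8\pi}\mathcal F_{\mu\alpha}\bar{\mathcal F}_\nu{}^\alpha$. Setting. $(\mathcal W^E,g^E)$ is a strictly stationary (there is an everywhere timelike Killing vector field with complete orbits) and axisymmetric, causal, simply connected, asymptotically flat $C^3$ spacetime with connected boundary $\Sigma$ and nonempty symmetry axis. It contains a field $\boldsymbol{\mathcal F}$ invariant under the same isometry group, and $(g^E,\boldsymbol{\mathcal F})$ solves the Einstein-Maxwell equations without sources (''electrovacuum''). $\vec\eta$ is the axial Killing vector and $\vec\xi$ the timelike Killing vector, unit at infinity. $\Sigma$ preserves the symmetries: $\vec\xi,\vec\eta$ are tangent to it, so it is timelike, and its constant-$t$ slices are homeomorphic to two-spheres. It is a standing fact that Weyl coordinates $\{t,\phi,\rho,z\}$ exist globally off the axis, with $\rho>0$, $\vec\xi=\partial_t$, $\vec\eta=\partial_\phi$, the axis at $\rho\to0$, and $$ds^2=-e^{2U}(dt+A\,d\phi)^2+e^{-2U}\left[e^{2k}(d\rho^2+dz^2)+\rho^2d\phi^2\right],$$ where $U,A,k$ are functions of $(\rho,z)$. The boundary is $\Sigma:\{t=\tau,\phi=\varphi,\rho=\rho(\mu),z=z(\mu)\}$. Its projection to the $(\rho,z)$ half-plane is a connected curve with both ends on the axis, and the exterior domain is the region of the half-plane outside this curve. The curve is the same for all members of the family. Potentials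 (relative to $\vec\xi$). Put $N=\vec\xi\cdot\vec\xi=-e^{2U}$. The potential $\Lambda(\rho,z)$ is complex with $d\Lambda=\boldsymbol{\mathcal F}(\cdot,\vec\xi)$. The twist potential $\Omega$ is real with $d\Omega=*(\boldsymbol\xi\wedge d\boldsymbol\xi)-i(\Lambda d\bar\Lambda-\bar\Lambda d\Lambda)$. The Ernst potential is $\mathcal E=-N-\Lambda\bar\Lambda+i\Omega$. A solution $(\mathcal E,\Lambda)$ satisfies the Ernst equations (indices over $\{\rho,z\}$) $$N\delta^{ij}\partial_i(\rho\,\partial_j\mathcal E)+\rho\,\delta^{ij}\partial_i\mathcal E(\partial_j\mathcal E+2\bar\Lambda\partial_j\Lambda)=0,$$ $$N\delta^{ij}\partial_i(\rho\,\partial_j\Lambda)+\rho\,\delta^{ij}\partial_i\Lambda(\partial_j\mathcal E+2\bar\Lambda\partial_j\Lambda)=0,$$ with $N=-(\mathcal E+\bar{\mathcal E}+2\Lambda\bar\Lambda)/2$. Asymptotic flatness is meant in the sense of admitting an asymptotically flat four-end. It enters through the decay conditions, with $r=\sqrt{\rho^2+z^2}\to\infty$: $U=-Mr^{-1}+O(r^{-2})$, $\Omega=-2zJr^{-3}+O(r^{-3})$, $\Lambda=-Qr^{-1}+O(r^{-2})$ for some constants $M,J,Q$, which depend on the solution. $M$ is the mass. A solution for a Cauchy data set is one satisfying these decay conditions and attaining all four data $\{\mathcal E|_\Sigma,\Lambda|_\Sigma,d\mathcal E|_\Sigma,d\Lambda|_\Sigma\}$ on $\Sigma$. *)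

(* Defs.v *)
From Stdlib Require Import Reals ZArith.
From Coquelicot Require Import Coquelicot.
Open Scope R_scope.

(** * The (rho, z) half-plane, the boundary curve and the exterior domain *)

Definition radius (p : R * R) : R := sqrt (fst p ^ 2 + snd p ^ 2).

(** The projection of the boundary is the arc [0 <= mu <= 1]; the conditions on
    the whole line cost nothing, since a C^1 arc on [0, 1] extends to a C^1 arc.
    Both ends are on the axis and the rest of the arc is off it, so rotating
    the arc about the axis gives a two-sphere. *)
Record boundary_curve := {
  curve_rho : R -> R;
  curve_z : R -> R;
  curve_ex_derive : forall mu, ex_derive curve_rho mu /\ ex_derive curve_z mu;
  curve_C1 : forall mu, continuous (Derive curve_rho) mu /\ continuous (Derive curve_z) mu;
  curve_regular : forall mu, 0 <= mu <= 1 ->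
    Derive curve_rho mu <> 0 \/ Derive curve_z mu <> 0;
  curve_simple : forall mu nu, 0 <= mu <= 1 -> 0 <= nu <= 1 ->
    curve_rho mu = curve_rho nu -> curve_z mu = curve_z nu -> mu = nu;
  curve_ends : curve_rho 0 = 0 /\ curve_rho 1 = 0;
  curve_off_axis : forall mu, 0 < mu < 1 -> 0 < curve_rho mu
}.

Definition on_curve (B : boundary_curve) (p : R * R) : Prop :=
  exists mu, 0 <= mu <= 1 /\ p = (curve_rho B mu, curve_z B mu).

(** The unbounded path component of the complement of the arc in the closed
    half-plane [0 <= rho]; it contains the outer part of the axis. *)
Definition exterior (B : boundary_curve) (p : R * R) : Prop :=
  0 <= fst p /\
  forall M : R, exists c : R -> R * R,
    (forall s, 0 <= s <= 1 -> continuous c s /\ 0 <= fst (c s) /\ ~ on_curve B (c s)) /\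
    c 0 = p /\ M < radius (c 1).

Definition exterior_off_axis (B : boundary_curve) (p : R * R) : Prop :=
  exterior B p /\ 0 < fst p.

Definition closed_exterior (B : boundary_curve) (p : R * R) : Prop :=
  exterior B p \/ on_curve B p.

(** * Coordinates on the spacetime

    The Weyl coordinates are used in the form [t, x = rho cos phi,
    y = rho sin phi, z], which also covers the axis. *)

Inductive idx := c0 | c1 | c2 | c3.

Definition idx_eq_dec (i j : idx) : {i = j} + {i <> j}.
Proof. decide equality. Defined.

Definition pt := idx -> R.

Definition upd (x : pt) (i : idx) (s : R) : pt :=
  fun j => if idx_eq_dec i j then s else x j.

Definition half_plane (x : pt) : R * R := (sqrt (x c1 ^ 2 + x c2 ^ 2), x c3).

Definition lift {V : Type} (f : R * R -> V) : pt -> V := fun x => f (half_plane x).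

Definition pd (i : idx) (f : pt -> R) : pt -> R :=
  fun x => Derive (fun s => f (upd x i s)) (x i).

Definition pdC (i : idx) (f : pt -> C) : pt -> C :=
  fun x => (pd i (fun y => Re (f y)) x, pd i (fun y => Im (f y)) x).

(** Class C^n on an open set [D]. *)
Fixpoint Cn (n : nat) (D : pt -> Prop) (f : pt -> R) : Prop :=
  (forall x, D x -> continuous f x) /\
  match n with
  | 0%nat => True
  | S m => forall i, (forall x, D x -> ex_derive (fun s => f (upd x i s)) (x i)) /\
                     Cn m D (pd i f)
  end.

Definition CnC (n : nat) (D : pt -> Prop) (f : pt -> C) : Prop :=
  Cn n D (fun x => Re (f x)) /\ Cn n D (fun x => Im (f x)).

(** * Tensor calculus *)

Definition sum4 (f : idx -> R) : R := f c0 + f c1 + f c2 + f c3.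
Definition sum4C (f : idx -> C) : C := (f c0 + f c1 + f c2 + f c3)%C.

Definition tensor2 := pt -> idx -> idx -> R.
Definition vector_field := pt -> idx -> R.

Definition delta (i j : idx) : R := if idx_eq_dec i j then 1 else 0.

Definition minkowski (i j : idx) : R :=
  if idx_eq_dec i j then (if idx_eq_dec i c0 then -1 else 1) else 0.

Definition idxZ (i : idx) : Z :=
  match i with c0 => 0 | c1 => 1 | c2 => 2 | c3 => 3 end%Z.

(** The Levi-Civita symbol, as the sign of a Vandermonde product. *)
Definition levi (a b c d : idx) : R :=
  IZR (Z.sgn ((idxZ b - idxZ a) * (idxZ c - idxZ a) * (idxZ d - idxZ a) *
              (idxZ c - idxZ b) * (idxZ d - idxZ b) * (idxZ d - idxZ c))%Z).

Definition det4 (m : idx -> idx -> R) : R :=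
  sum4 (fun a => sum4 (fun b => sum4 (fun c => sum4 (fun d =>
    levi a b c d * (m c0 a * m c1 b * m c2 c * m c3 d))))).

Definition is_inverse (m mi : idx -> idx -> R) : Prop :=
  forall i j, sum4 (fun k => m i k * mi k j) = delta i j.

Definition volume_form (g : tensor2) (x : pt) (a b c d : idx) : R :=
  sqrt (- det4 (g x)) * levi a b c d.

(** In the definitions below [gi] is the inverse of the metric [g]. *)

Definition christoffel (g gi : tensor2) (a b c : idx) (x : pt) : R :=
  / 2 * sum4 (fun d => gi x a d *
    (pd b (fun y => g y d c) x + pd c (fun y => g y d b) x - pd d (fun y => g y b c) x)).

Definition ricci (g gi : tensor2) : tensor2 := fun x b c =>
  sum4 (fun a =>
    pd a (christoffel g gi a b c) x - pd c (christoffel g gi a b a) x +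
    sum4 (fun d => christoffel g gi a a d x * christoffel g gi d b c x -
                   christoffel g gi a c d x * christoffel g gi d b a x)).

Definition scalar_curvature (g gi : tensor2) (x : pt) : R :=
  sum4 (fun a => sum4 (fun b => gi x a b * ricci g gi x a b)).

Definition einstein (g gi : tensor2) : tensor2 := fun x a b =>
  ricci g gi x a b - / 2 * scalar_curvature g gi x * g x a b.

Definition hodge2 (g gi F : tensor2) : tensor2 := fun x a b =>
  / 2 * sum4 (fun c => sum4 (fun d => volume_form g x a b c d *
    sum4 (fun e => sum4 (fun f => gi x c e * gi x d f * F x e f)))).

(** The free index of the dual of a 3-form is the last one of the volume form.
    Together with the convention of [hodge2] this is the sign for which the
    1-form in [twist_potential] is closed; the choice of orientation is
    immaterial (reversing it conjugates both potentials). *)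
Definition hodge3 (g gi : tensor2) (W : pt -> idx -> idx -> idx -> R) : vector_field :=
  fun x d => / 6 *
    sum4 (fun a => sum4 (fun b => sum4 (fun c => volume_form g x a b c d *
      sum4 (fun e => sum4 (fun f => sum4 (fun h =>
        gi x a e * gi x b f * gi x c h * W x e f h)))))).

Definition closed2 (D : pt -> Prop) (F : tensor2) : Prop :=
  forall x, D x -> forall a b c,
    pd a (fun y => F y b c) x + pd b (fun y => F y c a) x + pd c (fun y => F y a b) x = 0.

Definition lie (v : vector_field) (W : tensor2) : tensor2 := fun x i j =>
  sum4 (fun k => v x k * pd k (fun y => W y i j) x +
                 W x k j * pd i (fun y => v y k) x +
                 W x i k * pd j (fun y => v y k) x).

Definition xi : vector_field := fun _ i => delta c0 i.

Definition eta : vector_field := fun x i =>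
  match i with c1 => - x c2 | c2 => x c1 | _ => 0 end.

Definition lower (g : tensor2) (v : vector_field) : vector_field := fun x i =>
  sum4 (fun j => g x i j * v x j).

Definition wedge_d (w : vector_field) (x : pt) (a b c : idx) : R :=
  let d i j := pd i (fun y => w y j) x - pd j (fun y => w y i) x in
  w x a * d b c + w x b * d c a + w x c * d a b.

(** * Electromagnetic field *)

Definition self_dual (g gi F : tensor2) (x : pt) (a b : idx) : C :=
  (F x a b, hodge2 g gi F x a b).

Definition energy_momentum (g gi F : tensor2) (x : pt) (m n : idx) : C :=
  (/ (8 * RtoC PI) *
   sum4C (fun a => sum4C (fun b =>
     RtoC (gi x a b) * (self_dual g gi F x m a * Cconj (self_dual g gi F x n b)))))%C.

Definition einstein_maxwell (D : pt -> Prop) (g gi F : tensor2) : Prop :=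
  (forall x, D x -> forall m n,
     RtoC (einstein g gi x m n) = (8 * RtoC PI * energy_momentum g gi F x m n)%C) /\
  closed2 D F /\ closed2 D (hodge2 g gi F).

Definition em_potential (D : pt -> Prop) (g gi F : tensor2) (L : R * R -> C) : Prop :=
  CnC 1 D (lift L) /\
  forall x, D x -> forall i,
    pdC i (lift L) x = sum4C (fun j => (self_dual g gi F x i j * RtoC (xi x j))%C).

Definition twist_potential (D : pt -> Prop) (g gi : tensor2)
    (L : R * R -> C) (Om : R * R -> R) : Prop :=
  Cn 1 D (lift Om) /\
  forall x, D x -> forall i,
    RtoC (pd i (lift Om) x) =
    (RtoC (hodge3 g gi (wedge_d (lower g xi)) x i) -
     Ci * (lift L x * Cconj (pdC i (lift L) x) - Cconj (lift L x) * pdC i (lift L) x))%C.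

(** * Decay *)

(** [f = O(r^-n)] as [r] tends to infinity in the exterior domain. *)
Definition bigO (B : boundary_curve) (n : nat) (f : R * R -> R) : Prop :=
  exists K R0, 0 < R0 /\
    forall p, exterior B p -> R0 < radius p -> Rabs (f p) <= K / radius p ^ n.

Definition potentials_decay (B : boundary_curve) (U Om : R * R -> R) (L : R * R -> C)
    (M J : R) (Q : C) : Prop :=
  bigO B 2 (fun p => U p - (- M / radius p)) /\
  bigO B 3 (fun p => Om p - (- (2 * snd p * J) / radius p ^ 3)) /\
  bigO B 2 (fun p => Cmod (L p - (- Q / RtoC (radius p)))).

(** * The spacetime *)

Definition spacetime_interior (B : boundary_curve) (x : pt) : Prop :=
  exterior B (half_plane x).

Definition spacetime_points (B : boundary_curve) (x : pt) : Prop :=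
  closed_exterior B (half_plane x).

(** The Weyl line element evaluated on a vector [v] at a point off the axis. *)
Definition weyl_form (U A k : R * R -> R) (x : pt) (v : idx -> R) : R :=
  let p := half_plane x in
  let rho := fst p in
  let vrho := (x c1 * v c1 + x c2 * v c2) / rho in
  let vphi := (x c1 * v c2 - x c2 * v c1) / rho ^ 2 in
  - exp (2 * U p) * (v c0 + A p * vphi) ^ 2 +
  exp (- 2 * U p) * (exp (2 * k p) * (vrho ^ 2 + v c3 ^ 2) + rho ^ 2 * vphi ^ 2).

Definition quad (g : tensor2) (x : pt) (v : idx -> R) : R :=
  sum4 (fun i => sum4 (fun j => g x i j * v i * v j)).

(** No closed causal curve. *)
Definition causal (W : pt -> Prop) (g : tensor2) : Prop :=
  ~ exists c : R -> pt,
      (forall i s, ex_derive (fun u => c u i) s /\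
                   continuous (Derive (fun u => c u i)) s) /\
      (forall s, 0 <= s <= 1 -> W (c s)) /\
      (forall s, 0 <= s <= 1 ->
         (exists i, Derive (fun u => c u i) s <> 0) /\
         quad g (c s) (fun i => Derive (fun u => c u i) s) <= 0) /\
      (forall i, c 0 i = c 1 i).

Definition asymptotically_flat (B : boundary_curve) (g gi F : tensor2)
    (U : R * R -> R) : Prop :=
  (exists K R0, 0 < R0 /\ forall x, spacetime_interior B x ->
     R0 < radius (half_plane x) -> forall i j,
       Rabs (g x i j - minkowski i j) <= K / radius (half_plane x) /\
       forall k, Rabs (pd k (fun y => g y i j) x) <= K / radius (half_plane x) ^ 2) /\
  exists (L : R * R -> C) (Om : R * R -> R) (M J : R) (Q : C),
    em_potential (spacetime_interior B) g gi F L /\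
    twist_potential (spacetime_interior B) g gi L Om /\
    potentials_decay B U Om L M J Q.

(** The underlying manifold with boundary is [spacetime_points B]: time
    translations and rotations act on it, preserve its boundary (the points
    over the arc) and fix the axis, and it is simply connected because the arc
    has both ends on the axis.  Differentiability up to the boundary
    is differentiability on a neighbourhood.  [st_stationary] makes [xi]
    timelike on the axis too, where [weyl_form] does not apply. *)
Record electrovac_spacetime (B : boundary_curve) := {
  st_g : tensor2;
  st_gi : tensor2;
  st_F : tensor2;
  st_U : R * R -> R;
  st_A : R * R -> R;
  st_k : R * R -> R;
  st_C3 : exists D : pt -> Prop,
    open D /\ (forall x, spacetime_points B x -> D x) /\
    (forall i j, Cn 3 D (fun x => st_g x i j)) /\
    (forall i j, Cn 1 D (fun x => st_F x i j));
  st_sym : forall x i j, st_g x i j = st_g x j i;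
  st_antisym : forall x i j, st_F x i j = - st_F x j i;
  st_inverse : forall x, spacetime_points B x -> is_inverse (st_g x) (st_gi x);
  st_stationary : forall x, spacetime_points B x ->
    quad st_g x (xi x) = - exp (2 * st_U (half_plane x));
  st_weyl : forall x, spacetime_points B x -> 0 < fst (half_plane x) ->
    forall v, quad st_g x v = weyl_form st_U st_A st_k x v;
  st_killing : forall x, spacetime_interior B x -> forall i j,
    lie xi st_g x i j = 0 /\ lie eta st_g x i j = 0;
  st_field_invariant : forall x, spacetime_interior B x -> forall i j,
    lie xi st_F x i j = 0 /\ lie eta st_F x i j = 0;
  st_electrovac : einstein_maxwell (spacetime_interior B) st_g st_gi st_F;
  st_causal : causal (spacetime_points B) st_g;
  st_flat : asymptotically_flat B st_g st_gi st_F st_U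
}.

(** * The Ernst equations *)

Definition d_rho (f : R * R -> C) (p : R * R) : C :=
  (Derive (fun s => Re (f (s, snd p))) (fst p),
   Derive (fun s => Im (f (s, snd p))) (fst p)).

Definition d_z (f : R * R -> C) (p : R * R) : C :=
  (Derive (fun s => Re (f (fst p, s))) (snd p),
   Derive (fun s => Im (f (fst p, s))) (snd p)).

(** The norm [N = -(E + conj E + 2 L conj L) / 2] of the Killing vector. *)
Definition ernst_N (e l : C) : R := - (Re e + Cmod l ^ 2).

(** [U], where [N = - exp (2 U)]; meaningful when [N < 0]. *)
Definition ernst_U (E L : R * R -> C) (p : R * R) : R :=
  / 2 * ln (- ernst_N (E p) (L p)).

Definition ernst_operator (E L f : R * R -> C) (p : R * R) : C :=
  (RtoC (ernst_N (E p) (L p)) *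
     (d_rho (fun q => RtoC (fst q) * d_rho f q) p +
      d_z (fun q => RtoC (fst q) * d_z f q) p) +
   RtoC (fst p) *
     (d_rho f p * (d_rho E p + 2 * Cconj (L p) * d_rho L p) +
      d_z f p * (d_z E p + 2 * Cconj (L p) * d_z L p)))%C.

(** The potentials are C^2 functions on the spacetime, axis included. *)
Definition ernst_solution (B : boundary_curve) (E L : R * R -> C) : Prop :=
  CnC 2 (spacetime_interior B) (lift E) /\
  CnC 2 (spacetime_interior B) (lift L) /\
  (forall p, exterior B p -> ernst_N (E p) (L p) < 0) /\
  (forall p, exterior_off_axis B p ->
     ernst_operator E L E p = RtoC 0 /\ ernst_operator E L L p = RtoC 0).

(** * Boundary data *)

Definition boundary_point (B : boundary_curve) : Type := {p : R * R | on_curve B p}.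

Record dirichlet_data (B : boundary_curve) := {
  data_E : boundary_point B -> C;
  data_L : boundary_point B -> C
}.

(** The full differentials at the boundary, by their components along
    [d rho] and [d z]. *)
Record differential_data (B : boundary_curve) := {
  data_dE : boundary_point B -> C * C;
  data_dL : boundary_point B -> C * C
}.

Definition cauchy_data (B : boundary_curve) : Type :=
  (dirichlet_data B * differential_data B)%type.

Arguments data_E {B} _ _.
Arguments data_L {B} _ _.
Arguments data_dE {B} _ _.
Arguments data_dL {B} _ _.

Definition dirichlet_family {B : boundary_curve} (d : dirichlet_data B)
    (omega : R) (lambda : C) : dirichlet_data B :=
  {| data_E := fun b => (data_E d b - lambda * Cconj lambda + Ci * RtoC omega
                         - 2 * Cconj lambda * data_L d b)%C;
     data_L := fun b => (data_L d b + lambda)%C |}.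

Definition differential_family {B : boundary_curve} (d : differential_data B)
    (lambda : C) : differential_data B :=
  {| data_dE := fun b =>
       ((fst (data_dE d b) - 2 * Cconj lambda * fst (data_dL d b))%C,
        (snd (data_dE d b) - 2 * Cconj lambda * snd (data_dL d b))%C);
     data_dL := data_dL d |}.

(** The family of all Cauchy data obtained from a member [d]; the
    transformations form a group, so any member generates the same family. *)
Definition cauchy_family {B : boundary_curve} (d : cauchy_data B)
    (omega : R) (lambda : C) : cauchy_data B :=
  (dirichlet_family (fst d) omega lambda, differential_family (snd d) lambda).

Definition boundary_value (B : boundary_curve) (f : R * R -> C)
    (b : boundary_point B) (v : C) : Prop :=
  filterlim f (within (exterior_off_axis B) (locally (proj1_sig b))) (locally v).

Definition attains {B : boundary_curve} (d : cauchy_data B) (E L : R * R -> C) : Prop :=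
  forall b : boundary_point B,
    boundary_value B E b (data_E (fst d) b) /\
    boundary_value B L b (data_L (fst d) b) /\
    boundary_value B (d_rho E) b (fst (data_dE (snd d) b)) /\
    boundary_value B (d_z E) b (snd (data_dE (snd d) b)) /\
    boundary_value B (d_rho L) b (fst (data_dL (snd d) b)) /\
    boundary_value B (d_z L) b (snd (data_dL (snd d) b)).

(** The condition on [ernst_N] of the data says that the Killing vector is
    timelike at the boundary, which belongs to the spacetime. *)
Definition solution_for {B : boundary_curve} (d : cauchy_data B)
    (E L : R * R -> C) (M J : R) (Q : C) : Prop :=
  ernst_solution B E L /\
  potentials_decay B (ernst_U E L) (fun p => Im (E p)) L M J Q /\
  attains d E L /\
  (forall b, ernst_N (data_E (fst d) b) (data_L (fst d) b) < 0).

Definition has_positive_mass_solution {B : boundary_curve} (d : cauchy_data B) : Prop :=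
  exists (E L : R * R -> C) (M J : R) (Q : C), solution_for d E L M J Q /\ 0 < M.

(* Main.v *)
Require Import Defs.
From Stdlib Require Import Reals Lra Lia List ClassicalEpsilon FunctionalExtensionality.
From Coquelicot Require Import Coquelicot.
Open Scope R_scope.

(** For complex functions [f], [g] among [1], [E], [L] the Ernst equations imply that the current
    [rho (conj f grad g - g grad conj f - i conj f g tau / X) / X], with [X = Re E + |L|^2] and
    [tau = Im (grad E + 2 conj L grad L)], is divergence free.  Undoing the gauge transformations,
    two solutions of the family acquire the same Cauchy data, so the difference of their currents,
    extended by zero across the boundary arc, is continuous and its flux through every large half
    circle vanishes: in a fine grid only [O(n)] cells meet the arc or the axis.  The fluxes at
    infinity are determined by the asymptotic values and by the coefficients of [1 / r] of the
    potentials, although the decay conditions say nothing about derivatives, because an energy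
    estimate makes the nonlinear part of the current negligible in the mean.  With
    [e = 1 - |lambda|^2 - i omega] and [m = M + conj lambda Q] the equality of the fluxes says that
    [m], [Q], [Im (conj e m)] and [conj e Q + 2 lambda conj m] are the same for both solutions; if
    the gauges differ, then [M1 + M2 = 0]. *)

(** * Flux through rectangles and Goursat's argument *)

(** The currents are those of the symmetry group [SU(2,1)] of the Ernst equations. The target metric
    is indefinite, so the natural energy of the map gives no estimate at infinity; the Euclidean
    energy of the potentials is used instead. It works because the squared distance of the
    potentials from their limits is subharmonic up to terms that are small far out, and its mean
    over half circles is [O(r^-2)]. At the boundary no classical divergence theorem is at hand: the
    potentials have only continuous limits of order zero and one there, and the exterior is a path
    component whose boundary is not described further. A difference of two currents vanishes on the
    arc, and then all that matters about the arc is how few small squares cover it. Polar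
    coordinates are centred on the axis one unit above a bound for the height of the arc. They turn
    the half disc into a rectangle, three of whose sides carry no flux, and stay nondegenerate along
    the arc. Positive mass enters only in the closing algebra: for nonzero charge
    [lambda1 - lambda2 = k Q] with [k] real, and [k (M1 + M2) = 0]. *)

Notation cont2 := continuity_2d_pt.

Definition open2 (D : R -> R -> Prop) : Prop :=
  forall x y, D x y -> locally_2d D x y.

Lemma cont2_continuous_l (f : R -> R -> R) x y :
  cont2 f x y -> continuous (fun s => f s y) x.
Proof.
  intros H. apply continuity_pt_filterlim. apply continuity_pt_locally.
  intros eps. destruct (H eps) as [d Hd]. exists d. intros u Hu. apply Hd; [exact Hu|].
  rewrite Rminus_eq_0, Rabs_R0. apply cond_pos.
Qed.

Lemma cont2_continuous_r (f : R -> R -> R) x y :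
  cont2 f x y -> continuous (fun s => f x s) y.
Proof.
  intros H. apply continuity_pt_filterlim. apply continuity_pt_locally.
  intros eps. destruct (H eps) as [d Hd]. exists d. intros u Hu. apply Hd; [|exact Hu].
  rewrite Rminus_eq_0, Rabs_R0. apply cond_pos.
Qed.

Lemma ex_RInt_l (f : R -> R -> R) y a b :
  (forall x y, cont2 f x y) -> ex_RInt (fun x => f x y) a b.
Proof. intros H. apply (@ex_RInt_continuous R_CompleteNormedModule). intros z _.
  apply cont2_continuous_l, H. Qed.

Lemma ex_RInt_r (f : R -> R -> R) x a b :
  (forall x y, cont2 f x y) -> ex_RInt (fun y => f x y) a b.
Proof. intros H. apply (@ex_RInt_continuous R_CompleteNormedModule). intros z _.
  apply cont2_continuous_r, H. Qed.

Lemma Chasles (f : R -> R) a b c : ex_RInt f a b -> ex_RInt f b c ->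
  RInt f a b + RInt f b c = RInt f a c.
Proof. exact (@RInt_Chasles R_CompleteNormedModule f a b c). Qed.

Lemma RInt_param_continuous (f : R -> R -> R) a b x :
  a <= b -> (forall x y, cont2 f x y) ->
  continuity_pt (fun x => RInt (fun y => f x y) a b) x.
Proof.
  intros Hab H. apply continuity_pt_locally. intros eps.
  (* The [+ 1] keeps the denominator positive when [a = b]. *)
  assert (Hp : 0 < eps / (2 * (b - a + 1))).
  { apply Rdiv_lt_0_compat. apply cond_pos. lra. }
  destruct (uniform_continuity_2d_1d' f a b x (fun y _ => H x y) (mkposreal _ Hp)) as [d Hd].
  exists d. intros u Hu. change (Rabs (u - x) < d) in Hu.
  change (Rabs (RInt (fun y => f u y) a b - RInt (fun y => f x y) a b) < eps).
  assert (Heq : RInt (fun y => f u y - f x y) a b =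
    RInt (fun y => f u y) a b - RInt (fun y => f x y) a b).
  { apply (@RInt_minus R_CompleteNormedModule); apply ex_RInt_r; auto. }
  rewrite <- Heq.
  apply Rle_lt_trans with ((b - a) * (eps / (2 * (b - a + 1)))).
  - apply abs_RInt_le_const; [exact Hab| |].
    + apply (@ex_RInt_minus R_CompleteNormedModule); apply ex_RInt_r; auto.
    + intros t Ht. left. apply Rabs_lt_between in Hu. pose proof (cond_pos d).
      refine (Hd t x t u Ht _ Ht _ _); [lra|lra|].
      rewrite Rminus_eq_0, Rabs_R0. apply cond_pos.
  - apply Rlt_le_trans with ((b - a + 1) * (eps / (2 * (b - a + 1)))).
    + apply Rmult_lt_compat_r; lra.
    + replace ((b - a + 1) * (eps / (2 * (b - a + 1)))) with (eps / 2) by (field; lra).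
      pose proof (cond_pos eps). lra.
Qed.

(** Outward flux of the vector field [(F, G)] across the boundary of a rectangle. *)
Definition flux (F G : R -> R -> R) (x1 x2 y1 y2 : R) : R :=
  RInt (fun y => F x2 y) y1 y2 - RInt (fun y => F x1 y) y1 y2 +
  (RInt (fun x => G x y2) x1 x2 - RInt (fun x => G x y1) x1 x2).

Section Flux.
Context {F G : R -> R -> R} (HF : forall x y, cont2 F x y) (HG : forall x y, cont2 G x y).

Lemma flux_split_x x1 x2 x3 y1 y2 :
  flux F G x1 x3 y1 y2 = flux F G x1 x2 y1 y2 + flux F G x2 x3 y1 y2.
Proof.
  unfold flux.
  rewrite <- (Chasles (fun x => G x y1) x1 x2 x3) by (apply ex_RInt_l; auto).
  rewrite <- (Chasles (fun x => G x y2) x1 x2 x3) by (apply ex_RInt_l; auto).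
  ring.
Qed.

Lemma flux_split_y x1 x2 y1 y2 y3 :
  flux F G x1 x2 y1 y3 = flux F G x1 x2 y1 y2 + flux F G x1 x2 y2 y3.
Proof.
  unfold flux.
  rewrite <- (Chasles (fun y => F x1 y) y1 y2 y3) by (apply ex_RInt_r; auto).
  rewrite <- (Chasles (fun y => F x2 y) y1 y2 y3) by (apply ex_RInt_r; auto).
  ring.
Qed.

Lemma flux_point_x x y1 y2 : flux F G x x y1 y2 = 0.
Proof. unfold flux. rewrite !RInt_point. unfold zero; simpl. ring. Qed.

Lemma flux_grid a c hx hy N :
  flux F G a (a + INR (S N) * hx) c (c + INR (S N) * hy) =
  sum_n (fun i => sum_n (fun j =>
    flux F G (a + INR i * hx) (a + INR (S i) * hx) (c + INR j * hy) (c + INR (S j) * hy)) N) N.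
Proof.
  assert (Hy : forall x1 x2 M, flux F G x1 x2 c (c + INR (S M) * hy) =
    sum_n (fun j => flux F G x1 x2 (c + INR j * hy) (c + INR (S j) * hy)) M).
  { intros x1 x2 M. induction M as [|M IH].
    - rewrite sum_O. simpl INR. replace (c + 0 * hy) with c by ring. reflexivity.
    - rewrite sum_Sn, <- IH. rewrite (flux_split_y _ _ _ (c + INR (S M) * hy)). reflexivity. }
  assert (Hx : forall y1 y2 M, flux F G a (a + INR (S M) * hx) y1 y2 =
    sum_n (fun i => flux F G (a + INR i * hx) (a + INR (S i) * hx) y1 y2) M).
  { intros y1 y2 M. induction M as [|M IH].
    - rewrite sum_O. simpl INR. replace (a + 0 * hx) with a by ring. reflexivity.
    - rewrite sum_Sn, <- IH. rewrite (flux_split_x _ (a + INR (S M) * hx)). reflexivity. }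
  rewrite Hx. apply sum_n_ext. intros i. apply Hy.
Qed.

Lemma flux_bound x1 x2 y1 y2 M :
  x1 <= x2 -> y1 <= y2 ->
  (forall x y, x1 <= x <= x2 -> y1 <= y <= y2 -> Rabs (F x y) <= M /\ Rabs (G x y) <= M) ->
  Rabs (flux F G x1 x2 y1 y2) <= 2 * M * ((x2 - x1) + (y2 - y1)).
Proof.
  intros Hx Hy H. unfold flux.
  assert (A1 : Rabs (RInt (fun y => F x2 y) y1 y2) <= (y2 - y1) * M).
  { apply abs_RInt_le_const; [lra|apply ex_RInt_r; auto|intros; apply H; lra]. }
  assert (A2 : Rabs (RInt (fun y => F x1 y) y1 y2) <= (y2 - y1) * M).
  { apply abs_RInt_le_const; [lra|apply ex_RInt_r; auto|intros; apply H; lra]. }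
  assert (A3 : Rabs (RInt (fun x => G x y2) x1 x2) <= (x2 - x1) * M).
  { apply abs_RInt_le_const; [lra|apply ex_RInt_l; auto|intros; apply H; lra]. }
  assert (A4 : Rabs (RInt (fun x => G x y1) x1 x2) <= (x2 - x1) * M).
  { apply abs_RInt_le_const; [lra|apply ex_RInt_l; auto|intros; apply H; lra]. }
  apply Rabs_le_between in A1, A2, A3, A4. apply Rabs_le_between. lra.
Qed.

(** Moving the right side of the rectangle changes the flux at the rate given by the integral of the
    divergence over that side, which is zero. The mean value theorem then compares with the
    degenerate rectangle, whose flux is zero. *)
Lemma flux_div_free (D : R -> R -> Prop) (Fx Gy : R -> R -> R) x1 x2 y1 y2 :
  open2 D -> x1 <= x2 -> y1 <= y2 ->
  (forall x y, x1 <= x <= x2 -> y1 <= y <= y2 -> D x y) ->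
  (forall x y, D x y -> is_derive (fun s => F s y) x (Fx x y) /\ cont2 Fx x y /\
    is_derive (fun s => G x s) y (Gy x y) /\ cont2 Gy x y /\ Fx x y + Gy x y = 0) ->
  flux F G x1 x2 y1 y2 = 0.
Proof.
  intros HD Hx Hy Hcell H.
  destruct (MVT_gen (fun x => flux F G x1 x y1 y2) x1 x2 (fun _ => 0)) as [c [_ Hc]].
  - intros x. rewrite Rmin_left, Rmax_right by lra. intros Hx'.
    assert (E0 : RInt (fun y => Fx x y) y1 y2 + (G x y2 - G x y1) = 0).
    { assert (E1 : RInt (fun y => Gy x y) y1 y2 = G x y2 - G x y1).
      { apply is_RInt_unique. apply (is_RInt_derive (fun y => G x y)).
        - intros y Hy'. rewrite Rmin_left, Rmax_right in Hy' by lra. apply H, Hcell; lra.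
        - intros y Hy'. rewrite Rmin_left, Rmax_right in Hy' by lra.
          apply cont2_continuous_r, H, Hcell; lra. }
      assert (E2 : RInt (fun y => Fx x y) y1 y2 = RInt (fun y => - Gy x y) y1 y2).
      { apply RInt_ext. intros y Hy'. rewrite Rmin_left, Rmax_right in Hy' by lra.
        destruct (H x y) as (_ & _ & _ & _ & E); [apply Hcell; lra|]. lra. }
      rewrite E2.
      assert (E3 : RInt (fun y => - Gy x y) y1 y2 = - RInt (fun y => Gy x y) y1 y2).
      { apply (@RInt_opp R_CompleteNormedModule).
        apply (@ex_RInt_continuous R_CompleteNormedModule).
        intros y Hy'. rewrite Rmin_left, Rmax_right in Hy' by lra.
        apply cont2_continuous_r, H, Hcell; lra. }
      rewrite E3, E1. ring. }
    rewrite <- E0. unfold flux.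
    assert (DF : is_derive (fun x => RInt (fun y => F x y) y1 y2) x (RInt (fun y => Fx x y) y1 y2)).
    { replace (RInt (fun y => Fx x y) y1 y2) with
        (RInt (fun y => Derive (fun u => F u y) x) y1 y2).
      2:{ apply RInt_ext. intros y Hy'. rewrite Rmin_left, Rmax_right in Hy' by lra.
          apply is_derive_unique. destruct (H x y) as (E & _); [apply Hcell; lra|exact E]. }
      apply is_derive_RInt_param.
      - assert (Hm : 0 < Rmin (x - x1) (x2 - x)) by (apply Rmin_pos; lra).
        exists (mkposreal _ Hm). intros u Hu t Ht. change (Rabs (u - x) < Rmin (x - x1) (x2 - x)) in Hu.
        rewrite Rmin_left, Rmax_right in Ht by lra.
        pose proof (Rmin_l (x - x1) (x2 - x)). pose proof (Rmin_r (x - x1) (x2 - x)).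
        apply Rabs_lt_between in Hu. exists (Fx u t). apply H, Hcell; lra.
      - intros t Ht. rewrite Rmin_left, Rmax_right in Ht by lra.
        assert (Dxt : D x t) by (apply Hcell; lra).
        apply continuity_2d_pt_ext_loc with Fx; [|apply H; exact Dxt].
        destruct (HD _ _ Dxt) as [d Hd]. exists d. intros u v Hu Hv. symmetry.
        apply is_derive_unique. apply H, Hd; assumption.
      - apply filter_forall. intros u. apply ex_RInt_r; auto. }
    assert (DG : forall y, is_derive (fun x => RInt (fun s => G s y) x1 x) x (G x y)).
    { intros y. apply (@is_derive_RInt R_NormedModule (fun s => G s y) _ x1 x).
      - apply filter_forall. intros u. apply (RInt_correct (fun s => G s y)). apply ex_RInt_l; auto.
      - apply cont2_continuous_l. apply HG. }
    apply (@is_derive_plus R_AbsRing R_NormedModule).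
    + replace (RInt (fun y => Fx x y) y1 y2) with (RInt (fun y => Fx x y) y1 y2 - 0) by ring.
      apply (@is_derive_minus R_AbsRing R_NormedModule); [exact DF|].
      apply (@is_derive_const R_AbsRing R_NormedModule).
    + apply (@is_derive_minus R_AbsRing R_NormedModule); apply DG.
  - intros x _. unfold flux.
    assert (CG : forall y, continuity_pt (fun x => RInt (fun s => G s y) x1 x) x).
    { intros y. apply continuity_pt_filterlim. apply (@ex_derive_continuous R_AbsRing R_NormedModule).
      exists (G x y). apply (@is_derive_RInt R_NormedModule (fun s => G s y) _ x1 x).
      - apply filter_forall. intros u. apply (RInt_correct (fun s => G s y)). apply ex_RInt_l; auto.
      - apply cont2_continuous_l. apply HG. }
    refine (continuity_pt_plus
      (fun x => RInt (fun y => F x y) y1 y2 - RInt (fun y => F x1 y) y1 y2)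
      (fun x => RInt (fun s => G s y2) x1 x - RInt (fun s => G s y1) x1 x) x
      (continuity_pt_minus _ (fun _ => RInt (fun y => F x1 y) y1 y2) x _ _)
      (continuity_pt_minus _ _ x (CG y2) (CG y1))).
    + apply RInt_param_continuous; auto.
    + apply continuity_pt_const. intros ? ?; reflexivity.
  - rewrite flux_point_x in Hc. lra.
Qed.

End Flux.

(** * Thin sets and the count of grid cells that meet them *)

Definition near_pt (e : R) (p q : R * R) : Prop :=
  Rabs (fst p - fst q) <= e /\ Rabs (snd p - snd q) <= e.

(** Finite upper Minkowski content of dimension one: [O(n)] squares of size [O(1/n)] cover the set.
    A single constant bounds both the number and the size, so that the constants of a union simply
    add. *)
Definition thin (K : R -> R -> Prop) : Prop :=
  exists C : R, 0 < C /\ forall n : nat, exists l : list (R * R),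
    INR (length l) <= C * INR (S n) /\
    forall x y, K x y -> exists q, In q l /\ near_pt (C / INR (S n)) (x, y) q.

Lemma thin_union K1 K2 : thin K1 -> thin K2 -> thin (fun x y => K1 x y \/ K2 x y).
Proof.
  intros (C1 & H1 & T1) (C2 & H2 & T2). exists (C1 + C2). split; [lra|]. intros n.
  destruct (T1 n) as (l1 & L1 & N1). destruct (T2 n) as (l2 & L2 & N2).
  exists (l1 ++ l2). split.
  - rewrite length_app, plus_INR. lra.
  - assert (P : 0 < INR (S n)) by (apply lt_0_INR; lia).
    assert (A1 : C1 / INR (S n) <= (C1 + C2) / INR (S n)).
    { apply Rmult_le_compat_r; [left; apply Rinv_0_lt_compat, P|lra]. }
    assert (A2 : C2 / INR (S n) <= (C1 + C2) / INR (S n)).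
    { apply Rmult_le_compat_r; [left; apply Rinv_0_lt_compat, P|lra]. }
    intros x y [Hk|Hk].
    + destruct (N1 x y Hk) as (q & I & [X Y]). exists q. split; [apply in_or_app; auto|].
      split; lra.
    + destruct (N2 x y Hk) as (q & I & [X Y]). exists q. split; [apply in_or_app; auto|].
      split; lra.
Qed.

Definition indic (P : Prop) : R := if excluded_middle_informative P then 1 else 0.

Lemma indic_range P : 0 <= indic P <= 1.
Proof. unfold indic. destruct (excluded_middle_informative P); lra. Qed.

Lemma indic_true (P : Prop) : P -> indic P = 1.
Proof. unfold indic. destruct (excluded_middle_informative P); tauto. Qed.

Lemma count_near (y c : R) (N : nat) : 0 <= c ->
  sum_n (fun i => indic (Rabs (INR i - y) <= c)) N <= 2 * c + 1.
Proof.
  intros Hc.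
  (* The induction needs a bound that sees the end [N] of the range: the length of the part of
     [[y - c, y + c]] below [N], plus one. *)
  assert (H : sum_n (fun i => indic (Rabs (INR i - y) <= c)) N
    <= Rmax 0 (Rmin (2 * c) (INR N - y + c) + 1)).
  { induction N as [|N IH].
    - rewrite sum_O. unfold indic. destruct (excluded_middle_informative _) as [h|h].
      + simpl INR in *. apply Rabs_le_between in h.
        apply Rle_trans with (2 := Rmax_r _ _). unfold Rmin. destruct (Rle_dec _ _); lra.
      + apply Rmax_l.
    - rewrite sum_Sn.
      change (sum_n (fun i => indic (Rabs (INR i - y) <= c)) N + indic (Rabs (INR (S N) - y) <= c)
        <= Rmax 0 (Rmin (2 * c) (INR (S N) - y + c) + 1)).
      rewrite S_INR in *. unfold indic at 2.
      revert IH. generalize (sum_n (fun i => indic (Rabs (INR i - y) <= c)) N). intros s IH.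
      destruct (excluded_middle_informative _) as [h|h].
      + apply Rabs_le_between in h. revert IH. unfold Rmax, Rmin.
        repeat destruct (Rle_dec _ _); lra.
      + revert IH. unfold Rmax, Rmin. repeat destruct (Rle_dec _ _); lra. }
  apply Rle_trans with (1 := H). unfold Rmax, Rmin. repeat destruct (Rle_dec _ _); lra.
Qed.

Lemma Rabs_sum_n_le (u v : nat -> R) N :
  (forall i, (i <= N)%nat -> Rabs (u i) <= v i) -> Rabs (sum_n u N) <= sum_n v N.
Proof.
  induction N as [|N IH]; intros H.
  - rewrite !sum_O. apply H. lia.
  - rewrite !sum_Sn.
    apply Rle_trans with (Rabs (sum_n u N) + Rabs (u (S N))); [apply Rabs_triang|].
    apply Rplus_le_compat; [apply IH; intros; apply H; lia|apply H; lia].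
Qed.

Definition list_sum (w : R * R -> R) (l : list (R * R)) : R :=
  fold_right (fun q s => w q + s) 0 l.

Lemma list_sum_ge (w : R * R -> R) l q : (forall q, 0 <= w q) -> In q l -> w q <= list_sum w l.
Proof.
  intros Hw. induction l as [|p l IH]; simpl; [tauto|].
  assert (0 <= list_sum w l).
  { clear IH. induction l as [|p' l IH]; simpl; [lra|]. specialize (Hw p'). lra. }
  intros [->|Hi]; [lra|]. specialize (IH Hi). specialize (Hw p). lra.
Qed.

Lemma sum_list_sum (w : nat -> nat -> R * R -> R) N B l :
  (forall q, sum_n (fun i => sum_n (fun j => w i j q) N) N <= B) ->
  sum_n (fun i => sum_n (fun j => list_sum (w i j) l) N) N <= INR (length l) * B.
Proof.
  intros H. induction l as [|q l IH].
  - cbn [length INR list_sum fold_right]. rewrite Rmult_0_l.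
    apply Req_le. transitivity (sum_n (fun _ => 0) N).
    + apply sum_n_ext. intros i. rewrite sum_n_const. apply Rmult_0_r.
    + rewrite sum_n_const. apply Rmult_0_r.
  - rewrite (sum_n_ext _ (fun i => plus (sum_n (fun j => w i j q) N)
      (sum_n (fun j => list_sum (w i j) l) N))).
    2:{ intros i. rewrite <- sum_n_plus. apply sum_n_ext. reflexivity. }
    rewrite sum_n_plus. change (length (q :: l)) with (S (length l)). rewrite S_INR.
    specialize (H q). unfold plus; simpl. simpl in IH, H. lra.
Qed.

Lemma small_step (L d : R) : 0 < L -> 0 < d -> exists n0, forall n, (n0 <= n)%nat -> L / INR (S n) < d.
Proof.
  intros HL Hd. destruct (archimed_cor1 (d / L)) as (m & Hm & Pm).
  { apply Rdiv_lt_0_compat; assumption. }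
  exists m. intros n Hn. assert (Pm' : 0 < INR m) by (apply lt_0_INR; lia).
  assert (INR m <= INR (S n)) by (apply le_INR; lia).
  apply Rle_lt_trans with (L / INR m).
  - apply Rmult_le_compat_l; [lra|]. apply Rinv_le_contravar; assumption.
  - apply (Rmult_lt_compat_l L) in Hm; [|assumption].
    replace (L * (d / L)) with d in Hm by (field; lra). exact Hm.
Qed.

(** Goursat's argument: in a grid of mesh [1/n] the cells that meet [K] number
    [O(n)], and each has flux [o(1/n)] because [F] and [G] vanish on [K]. *)
Lemma thin_goursat (F G : R -> R -> R) (K : R -> R -> Prop) a b c d :
  (forall x y, cont2 F x y) -> (forall x y, cont2 G x y) -> a < b -> c < d ->
  (forall x y, K x y -> F x y = 0 /\ G x y = 0) ->
  (forall x1 x2 y1 y2, a <= x1 <= x2 -> x2 <= b -> c <= y1 <= y2 -> y2 <= d ->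
    (forall x y, x1 <= x <= x2 -> y1 <= y <= y2 -> ~ K x y) -> flux F G x1 x2 y1 y2 = 0) ->
  thin (fun x y => a <= x <= b /\ c <= y <= d /\ K x y) ->
  flux F G a b c d = 0.
Proof.
  intros HF HG Hab Hcd HK Hcell (C & HC & Hthin).
  (* Reach in units of the mesh: a covering square has half-side [C / INR (S n)], which is
     [C / (b - a)] mesh widths, and one more width accounts for the extent of the cell itself. *)
  set (cx := 1 + C / (b - a)). set (cy := 1 + C / (d - c)).
  assert (Pcx : 0 < C / (b - a)) by (apply Rdiv_lt_0_compat; lra).
  assert (Pcy : 0 < C / (d - c)) by (apply Rdiv_lt_0_compat; lra).
  (* The number of bad cells times the flux through each: the factor [INR (S n)] from the count
     cancels the one in the mesh width, so the bound [eps * T] does not depend on the grid. *)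
  set (T := 2 * ((b - a) + (d - c)) * C * ((2 * cx + 1) * (2 * cy + 1))).
  assert (PT : 0 < T).
  { unfold T, cx, cy. repeat apply Rmult_lt_0_compat; lra. }
  assert (Main : forall eps, 0 < eps -> Rabs (flux F G a b c d) <= eps * T).
  { intros eps Heps.
    destruct (uniform_continuity_2d F a b c d (fun x y _ _ => HF x y) (mkposreal eps Heps)) as [d1 U1].
    destruct (uniform_continuity_2d G a b c d (fun x y _ _ => HG x y) (mkposreal eps Heps)) as [d2 U2].
    destruct (small_step ((b - a) + (d - c)) (Rmin d1 d2)) as (n & Hn).
    { lra. } { apply Rmin_pos; apply cond_pos. }
    specialize (Hn n (Nat.le_refl n)).
    pose proof (Rmin_l d1 d2) as M1. pose proof (Rmin_r d1 d2) as M2.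
    assert (P : 0 < INR (S n)) by (apply lt_0_INR; lia).
    assert (Pi : 0 < / INR (S n)) by (apply Rinv_0_lt_compat, P).
    set (hx := (b - a) / INR (S n)). set (hy := (d - c) / INR (S n)).
    assert (Phx : 0 < hx) by (apply Rdiv_lt_0_compat; lra).
    assert (Phy : 0 < hy) by (apply Rdiv_lt_0_compat; lra).
    assert (Hs : hx + hy < Rmin d1 d2).
    { unfold hx, hy. replace ((b - a) / INR (S n) + (d - c) / INR (S n)) with
        (((b - a) + (d - c)) / INR (S n)) by (field; lra). exact Hn. }
    destruct (Hthin n) as (l & Hl & Hcov).
    replace b with (a + INR (S n) * hx) at 1 by (unfold hx; field; lra).
    replace d with (c + INR (S n) * hy) at 1 by (unfold hy; field; lra).
    rewrite flux_grid by assumption.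
    (* Marks the cells within reach of the covering point [q]. Summed over all [q] it is at least 1
       on each cell that meets [K], and for a fixed [q] at most [(2 * cx + 1) * (2 * cy + 1)] cells
       are marked. *)
    set (w := fun (i j : nat) (q : R * R) =>
      indic (Rabs (INR i - (fst q - a) / hx) <= cx) * indic (Rabs (INR j - (snd q - c) / hy) <= cy)).
    assert (Hw : forall i j q, 0 <= w i j q).
    { intros. unfold w. apply Rmult_le_pos; apply indic_range. }
    set (m := 2 * eps * (hx + hy)).
    assert (Pm : 0 <= m) by (unfold m; apply Rmult_le_pos; lra).
    assert (Hin : forall i, (i <= n)%nat -> 0 <= INR i /\ INR (S i) = INR i + 1 /\ INR i + 1 <= INR (S n)).
    { intros i Hi. split; [apply pos_INR|]. rewrite <- S_INR. split; [reflexivity|apply le_INR; lia]. }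
    assert (Hbx : forall i, (i <= n)%nat -> a <= a + INR i * hx <= a + INR (S i) * hx /\ a + INR (S i) * hx <= b).
    { intros i Hi. destruct (Hin i Hi) as (I1 & I2 & I3). rewrite I2.
      assert (0 <= INR i * hx) by (apply Rmult_le_pos; lra).
      assert ((INR i + 1) * hx <= INR (S n) * hx) by (apply Rmult_le_compat_r; lra).
      assert (INR (S n) * hx = b - a) by (unfold hx; field; lra). lra. }
    assert (Hby : forall i, (i <= n)%nat -> c <= c + INR i * hy <= c + INR (S i) * hy /\ c + INR (S i) * hy <= d).
    { intros i Hi. destruct (Hin i Hi) as (I1 & I2 & I3). rewrite I2.
      assert (0 <= INR i * hy) by (apply Rmult_le_pos; lra).
      assert ((INR i + 1) * hy <= INR (S n) * hy) by (apply Rmult_le_compat_r; lra).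
      assert (INR (S n) * hy = d - c) by (unfold hy; field; lra). lra. }
    assert (HC' : forall h L q t s (k : nat), 0 < L -> h = L / INR (S n) ->
      s + INR k * h <= t <= s + INR (S k) * h -> Rabs (t - q) <= C / INR (S n) ->
      Rabs (INR k - (q - s) / h) <= 1 + C / L).
    { intros h L q t s k PL Eh Ht Hq. rewrite S_INR in Ht.
      assert (Ph : 0 < h) by (rewrite Eh; apply Rdiv_lt_0_compat; lra).
      replace (INR k - (q - s) / h) with ((s + INR k * h - q) / h) by (field; lra).
      unfold Rdiv at 1. rewrite Rabs_mult, (Rabs_pos_eq (/ h)) by (left; apply Rinv_0_lt_compat, Ph).
      apply (Rmult_le_reg_r h); [exact Ph|].
      rewrite Rmult_assoc, Rinv_l, Rmult_1_r by lra.
      replace ((1 + C / L) * h) with (h + C / INR (S n)) by (rewrite Eh; field; lra).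
      apply Rabs_le_between in Hq. apply Rabs_le_between. lra. }
    assert (Hij : forall i j, (i <= n)%nat -> (j <= n)%nat ->
      Rabs (flux F G (a + INR i * hx) (a + INR (S i) * hx) (c + INR j * hy) (c + INR (S j) * hy))
      <= m * list_sum (w i j) l).
    { intros i j Hi Hj. destruct (Hbx i Hi) as [X1 X2]. destruct (Hby j Hj) as [Y1 Y2].
      destruct (Hin i Hi) as (_ & I2 & _). destruct (Hin j Hj) as (_ & J2 & _).
      destruct (excluded_middle_informative (exists x y,
        a + INR i * hx <= x <= a + INR (S i) * hx /\ c + INR j * hy <= y <= c + INR (S j) * hy /\ K x y))
        as [(x & y & Hx & Hy & Kxy)|No].
      - destruct (Hcov x y) as (q & Iq & [Nx Ny]). { repeat split; lra || assumption. }
        simpl in Nx, Ny.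
        assert (W1 : w i j q = 1).
        { unfold w. rewrite !indic_true; [ring| |].
          - apply (HC' hy (d - c) (snd q) y c j); [lra|reflexivity|lra|exact Ny].
          - apply (HC' hx (b - a) (fst q) x a i); [lra|reflexivity|lra|exact Nx]. }
        apply Rle_trans with m.
        (* The cell is smaller than the modulus of uniform continuity for [eps], and [F] and [G]
           vanish at one of its points, so both are below [eps] on the whole cell. *)
        + unfold m. replace (hx + hy) with
            ((a + INR (S i) * hx - (a + INR i * hx)) + (c + INR (S j) * hy - (c + INR j * hy))).
          2:{ rewrite I2, J2. ring. }
          apply flux_bound; try assumption; [lra|lra|].
          intros u v Hu Hv. rewrite I2 in *. rewrite J2 in *. destruct (HK x y Kxy) as [Fz Gz].
          split; left.
          * replace (F u v) with (F u v - F x y) by (rewrite Fz; ring).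
            apply U1; try lra; apply Rabs_lt_between; lra.
          * replace (G u v) with (G u v - G x y) by (rewrite Gz; ring).
            apply U2; try lra; apply Rabs_lt_between; lra.
        + rewrite <- (Rmult_1_r m) at 1. apply Rmult_le_compat_l; [exact Pm|].
          rewrite <- W1. apply list_sum_ge; auto.
      - rewrite Hcell; [|lra|lra|lra|lra|].
        + rewrite Rabs_R0. apply Rmult_le_pos; [exact Pm|].
          clear - Hw. induction l as [|q l IH]; simpl; [lra|]. specialize (Hw i j q). lra.
        + intros x y Hx Hy Kxy. apply No. exists x, y. auto. }
    apply Rle_trans with (sum_n (fun i => sum_n (fun j => m * list_sum (w i j) l) n) n).
    { apply Rabs_sum_n_le. intros i Hi. apply Rabs_sum_n_le. intros j Hj. apply Hij; assumption. }
    rewrite (sum_n_ext _ (fun i => mult m (sum_n (fun j => list_sum (w i j) l) n))).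
    2:{ intros i. refine (sum_n_mult_l (K := R_Ring) _ _ n). }
    rewrite sum_n_mult_l.
    apply Rle_trans with (m * (INR (length l) * ((2 * cx + 1) * (2 * cy + 1)))).
    { apply Rmult_le_compat_l; [exact Pm|]. apply sum_list_sum. intros q. unfold w.
      rewrite (sum_n_ext _ (fun i => mult
        (indic (Rabs (INR i - (fst q - a) / hx) <= cx))
        (sum_n (fun j => indic (Rabs (INR j - (snd q - c) / hy) <= cy)) n))).
      2:{ intros i. refine (sum_n_mult_l (K := R_Ring) _ _ n). }
      rewrite sum_n_mult_r.
      apply Rmult_le_compat.
      - apply Rle_trans with (Rabs (sum_n (fun i : nat => 0) n)); [apply Rabs_pos|].
        apply Rabs_sum_n_le. intros. rewrite Rabs_R0. apply indic_range.
      - apply Rle_trans with (Rabs (sum_n (fun i : nat => 0) n)); [apply Rabs_pos|].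
        apply Rabs_sum_n_le. intros. rewrite Rabs_R0. apply indic_range.
      - apply count_near. unfold cx; lra.
      - apply count_near. unfold cy; lra. }
    apply Rle_trans with (m * (C * INR (S n) * ((2 * cx + 1) * (2 * cy + 1)))).
    { apply Rmult_le_compat_l; [exact Pm|]. apply Rmult_le_compat_r; [|exact Hl].
      apply Rmult_le_pos; unfold cx, cy; lra. }
    apply Req_le. unfold m, T, hx, hy. field. lra. }
  apply Rabs_eq_0. apply Rle_antisym; [|apply Rabs_pos].
  apply le_epsilon. intros e He. rewrite Rplus_0_l.
  apply Rle_trans with (1 := Main (e / T) (Rdiv_lt_0_compat _ _ He PT)).
  apply Req_le. field. lra.
Qed.

(** * The exterior domain and polar coordinates *)

(** The sample points are [q] at the multiples of [/ INR (S n)] in [[0, 1]]. The constant [L + 2]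
    covers both the distance to the nearest sample and the number of samples, [n + 2]. The
    hypothesis compares points of [K] with values of [q], which allows [q] to come from a choice
    operator. *)
Lemma thin_curve (q : R -> R * R) (L : R) (K : R -> R -> Prop) : 0 < L ->
  (forall x y, K x y -> exists mu, 0 <= mu <= 1 /\
     forall nu, 0 <= nu <= 1 -> near_pt (L * Rabs (mu - nu)) (x, y) (q nu)) ->
  thin K.
Proof.
  intros HL H. exists (L + 2). split; [lra|]. intros n.
  exists (map (fun k => q (INR k / INR (S n))) (seq 0 (S (S n)))).
  assert (P : 0 < INR (S n)) by (apply lt_0_INR; lia).
  assert (P1 : 1 <= INR (S n)) by (rewrite S_INR; pose proof (pos_INR n); lra).
  split.
  - rewrite length_map, length_seq, (S_INR (S n)).
    apply Rle_trans with (2 * INR (S n)); [lra|]. apply Rmult_le_compat_r; lra.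
  - intros x y Hk. destruct (H x y Hk) as (mu & Hmu & Hn).
    destruct (nfloor_ex (mu * INR (S n))) as (k & Hk1 & Hk2). { apply Rmult_le_pos; lra. }
    assert (Hk3 : mu * INR (S n) <= 1 * INR (S n)) by (apply Rmult_le_compat_r; lra).
    assert (Hk4 : (k <= S n)%nat) by (apply INR_le; lra).
    exists (q (INR k / INR (S n))). split.
    + apply (in_map (fun k => q (INR k / INR (S n)))). apply in_seq. lia.
    + assert (Hd : Rabs (mu - INR k / INR (S n)) <= 1 / INR (S n)).
      { replace mu with (mu * INR (S n) / INR (S n)) by (field; lra).
        unfold Rdiv. rewrite <- Rmult_minus_distr_r, Rabs_mult.
        rewrite (Rabs_pos_eq (/ _)) by (left; apply Rinv_0_lt_compat, P).
        apply Rmult_le_compat_r; [left; apply Rinv_0_lt_compat, P|].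
        apply Rabs_le_between. lra. }
      assert (Hc : L * Rabs (mu - INR k / INR (S n)) <= (L + 2) / INR (S n)).
      { apply Rle_trans with (L * (1 / INR (S n))); [apply Rmult_le_compat_l; lra|].
        unfold Rdiv. rewrite Rmult_1_l. apply Rmult_le_compat_r; [left; apply Rinv_0_lt_compat, P|lra]. }
      destruct (Hn (INR k / INR (S n))) as [A B].
      { split.
        - apply Rmult_le_pos; [apply pos_INR|left; apply Rinv_0_lt_compat, P].
        - apply (Rmult_le_reg_r (INR (S n))); [exact P|]. unfold Rdiv.
          rewrite Rmult_assoc, Rinv_l by lra. lra. }
      split; lra.
Qed.

Lemma thin_sub (K K' : R -> R -> Prop) : (forall x y, K x y -> K' x y) -> thin K' -> thin K.
Proof.
  intros H (C & HC & T). exists C. split; [exact HC|]. intros n.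
  destruct (T n) as (l & Hl & Hn). exists l. split; [exact Hl|]. intros x y Hk. apply Hn, H, Hk.
Qed.

Lemma thin_vertical x0 a b : a < b -> thin (fun x y => x = x0 /\ a <= y <= b).
Proof.
  intros Hab. apply (thin_curve (fun mu => (x0, a + mu * (b - a))) (b - a)); [lra|].
  intros x y [-> Hy]. exists ((y - a) / (b - a)). split.
  - split; [apply Rdiv_le_0_compat; lra|]. apply (Rmult_le_reg_r (b - a)); [lra|].
    unfold Rdiv. rewrite Rmult_assoc, Rinv_l by lra. lra.
  - intros nu Hnu. unfold near_pt; simpl.
    replace (y - (a + nu * (b - a))) with ((b - a) * ((y - a) / (b - a) - nu)) by (field; lra).
    rewrite Rminus_eq_0, Rabs_R0, Rabs_mult, (Rabs_pos_eq (b - a)) by lra. split; [|lra].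
    apply Rmult_le_pos; [lra|apply Rabs_pos].
Qed.

Lemma thin_horizontal y0 a b : a < b -> thin (fun x y => a <= x <= b /\ y = y0).
Proof.
  intros Hab. apply (thin_curve (fun mu => (a + mu * (b - a), y0)) (b - a)); [lra|].
  intros x y [Hx ->]. exists ((x - a) / (b - a)). split.
  - split; [apply Rdiv_le_0_compat; lra|]. apply (Rmult_le_reg_r (b - a)); [lra|].
    unfold Rdiv. rewrite Rmult_assoc, Rinv_l by lra. lra.
  - intros nu Hnu. unfold near_pt; simpl.
    replace (x - (a + nu * (b - a))) with ((b - a) * ((x - a) / (b - a) - nu)) by (field; lra).
    rewrite Rminus_eq_0, Rabs_R0, Rabs_mult, (Rabs_pos_eq (b - a)) by lra. split; [lra|].
    apply Rmult_le_pos; [lra|apply Rabs_pos].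
Qed.

Lemma C1_lipschitz (f : R -> R) a b : a <= b ->
  (forall x, ex_derive f x) -> (forall x, continuous (Derive f) x) ->
  exists L, 0 < L /\ forall x y, a <= x <= b -> a <= y <= b -> Rabs (f x - f y) <= L * Rabs (x - y).
Proof.
  intros Hab Hd Hc.
  destruct (continuity_ab_maj (fun x => Rabs (Derive f x)) a b Hab) as (m & Hm & _).
  { intros c _. apply continuity_pt_filterlim.
    apply (continuous_comp (Derive f) Rabs); [apply Hc|apply continuous_Rabs]. }
  exists (Rabs (Derive f m) + 1). split; [pose proof (Rabs_pos (Derive f m)); lra|].
  intros x y Hx Hy.
  destruct (MVT_gen f y x (Derive f)) as (c & Hc1 & Hc2).
  - intros; apply Derive_correct, Hd.
  - intros; apply continuity_pt_filterlim, (@ex_derive_continuous R_AbsRing R_NormedModule), Hd.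
  - rewrite Hc2, Rabs_mult. apply Rmult_le_compat_r; [apply Rabs_pos|].
    assert (Hcab : a <= c <= b).
    { revert Hc1. unfold Rmin, Rmax. destruct (Rle_dec y x); lra. }
    specialize (Hm c Hcab). lra.
Qed.

Section Topology.
Context (B : boundary_curve).

Lemma curve_lipschitz : exists L, 0 < L /\ forall mu nu, 0 <= mu <= 1 -> 0 <= nu <= 1 ->
  Rabs (curve_rho B mu - curve_rho B nu) <= L * Rabs (mu - nu) /\
  Rabs (curve_z B mu - curve_z B nu) <= L * Rabs (mu - nu).
Proof.
  destruct (C1_lipschitz (curve_rho B) 0 1 Rle_0_1 (fun mu => proj1 (curve_ex_derive B mu))
    (fun mu => proj1 (curve_C1 B mu))) as (L1 & P1 & H1).
  destruct (C1_lipschitz (curve_z B) 0 1 Rle_0_1 (fun mu => proj2 (curve_ex_derive B mu))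
    (fun mu => proj2 (curve_C1 B mu))) as (L2 & P2 & H2).
  exists (L1 + L2). split; [lra|]. intros mu nu Hm Hn.
  specialize (H1 mu nu Hm Hn). specialize (H2 mu nu Hm Hn).
  pose proof (Rabs_pos (mu - nu)).
  assert (0 <= L1 * Rabs (mu - nu)) by (apply Rmult_le_pos; lra).
  assert (0 <= L2 * Rabs (mu - nu)) by (apply Rmult_le_pos; lra).
  lra.
Qed.

Lemma on_curve_rho p : on_curve B p -> 0 <= fst p.
Proof.
  intros (mu & Hmu & ->). simpl. destruct (curve_ends B) as [E0 E1].
  destruct (Req_dec mu 0) as [->|]; [lra|]. destruct (Req_dec mu 1) as [->|]; [lra|].
  left. apply curve_off_axis. lra.
Qed.

Lemma curve_bounded : exists Z, 0 < Z /\ forall p, on_curve B p -> Rabs (fst p) <= Z /\ Rabs (snd p) <= Z.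
Proof.
  destruct curve_lipschitz as (L & PL & HL).
  exists (Rabs (curve_rho B 0) + Rabs (curve_z B 0) + L).
  pose proof (Rabs_pos (curve_rho B 0)). pose proof (Rabs_pos (curve_z B 0)).
  split; [lra|]. intros p (mu & Hmu & ->). simpl.
  destruct (HL mu 0) as [H1 H2]; [lra|lra|].
  assert (Hm : L * Rabs (mu - 0) <= L).
  { rewrite Rminus_0_r, Rabs_pos_eq by lra. rewrite <- (Rmult_1_r L) at 2.
    apply Rmult_le_compat_l; lra. }
  pose proof (Rabs_triang_inv (curve_rho B mu) (curve_rho B 0)).
  pose proof (Rabs_triang_inv (curve_z B mu) (curve_z B 0)). lra.
Qed.

(** The parameter interval is compact, so the distance from [p] to the arc, taken as the sum of the
    coordinate distances, attains a positive minimum; half of it serves as [e]. *)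
Lemma off_curve_open p : ~ on_curve B p -> exists e, 0 < e /\ forall q,
  Rabs (fst q - fst p) < e -> Rabs (snd q - snd p) < e -> ~ on_curve B q.
Proof.
  intros Hp.
  set (f := fun mu => Rabs (curve_rho B mu - fst p) + Rabs (curve_z B mu - snd p)).
  destruct (continuity_ab_min f 0 1) as (m & Hm & Im); [lra| |].
  { intros c _. apply continuity_pt_filterlim.
    assert (CR : forall (g : R -> R) a, ex_derive g c -> continuous (fun x => Rabs (g x - a)) c).
    { intros g a Hg. apply (continuous_comp (fun x => g x - a) Rabs); [|apply continuous_Rabs].
      apply (@ex_derive_continuous R_AbsRing R_NormedModule). auto_derive. exact Hg. }
    exact (@continuous_plus R_UniformSpace R_AbsRing R_NormedModule _ _ c
      (CR _ (fst p) (proj1 (curve_ex_derive B c))) (CR _ (snd p) (proj2 (curve_ex_derive B c)))). }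
  pose proof (Rabs_pos (curve_rho B m - fst p)) as A1. pose proof (Rabs_pos (curve_z B m - snd p)) as A2.
  assert (Pm : 0 < f m).
  { destruct (Rle_lt_or_eq_dec 0 (f m)) as [h|h]; [unfold f; lra|exact h|].
    exfalso. apply Hp. exists m. split; [exact Im|]. unfold f in h.
    destruct p as [p1 p2]; simpl in *. f_equal.
    - apply Rminus_diag_uniq_sym. apply Rabs_eq_0. lra.
    - apply Rminus_diag_uniq_sym. apply Rabs_eq_0. lra. }
  exists (f m / 2). split; [lra|]. intros q H1 H2 (mu & Hmu & ->). simpl in H1, H2.
  specialize (Hm mu Hmu). unfold f at 2 in Hm. lra.
Qed.

Lemma continuous_pair_R (f g : R -> R) x :
  continuous f x -> continuous g x -> continuous (fun s => (f s, g s)) x.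
Proof.
  intros Hf Hg. apply filterlim_locally. intros e.
  apply (filter_imp _ _ (fun u (H : _ /\ _) => H) (filter_and _ _
    (proj1 (filterlim_locally f (f x)) Hf e) (proj1 (filterlim_locally g (g x)) Hg e))).
Qed.

Lemma continuous_glue (f g : R -> R * R) x0 : f x0 = g x0 ->
  continuous f x0 -> continuous g x0 ->
  continuous (fun s => if Rle_dec s x0 then f s else g s) x0.
Proof.
  intros E Hf Hg. apply filterlim_locally. intros e.
  refine (filter_imp _ _ _ (filter_and _ _
    (proj1 (filterlim_locally f (f x0)) Hf e) (proj1 (filterlim_locally g (g x0)) Hg e))).
  intros u [A C]. destruct (Rle_dec x0 x0); [|lra].
  destruct (Rle_dec u x0); [exact A|rewrite E; exact C].
Qed.

(** The escaping path of [c 1] is appended to [c], both run at double speed. Continuity in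
    [exterior] is two-sided even at the ends of the parameter interval, and this is what permits the
    gluing at [1/2]. *)
Lemma exterior_path (c : R -> R * R) :
  (forall s, continuous c s) ->
  (forall s, 0 <= s <= 1 -> 0 <= fst (c s) /\ ~ on_curve B (c s)) ->
  exterior B (c 1) -> exterior B (c 0).
Proof.
  intros Hc Hin [H1 He]. split; [apply Hin; lra|]. intros M.
  destruct (He M) as (c' & Hc' & E0 & EM).
  exists (fun s => if Rle_dec s (1/2) then c (2 * s) else c' (2 * s - 1)).
  assert (C2 : forall s, continuous (fun s => c (2 * s)) s).
  { intros s. apply (continuous_comp (fun s => 2 * s) c); [|apply Hc].
    apply (@ex_derive_continuous R_AbsRing R_NormedModule). auto_derive. auto. }
  assert (C2' : forall s, 1/2 <= s <= 1 -> continuous (fun s => c' (2 * s - 1)) s).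
  { intros s Hs. apply (continuous_comp (fun s => 2 * s - 1) c').
    - apply (@ex_derive_continuous R_AbsRing R_NormedModule). auto_derive. auto.
    - apply Hc'. lra. }
  repeat split.
  - destruct (total_order_T s (1/2)) as [[Hs|Hs]|Hs].
    + apply continuous_ext_loc with (fun s => c (2 * s)); [|apply C2].
      assert (P : 0 < 1/2 - s) by lra. exists (mkposreal _ P). intros u Hu.
      apply Rabs_lt_between in Hu. simpl in Hu. unfold minus, plus, opp in Hu; simpl in Hu.
      destruct (Rle_dec u (1/2)); [reflexivity|lra].
    + subst s. apply continuous_glue; [|apply C2|apply C2'; lra].
      replace (2 * (1/2) - 1) with 0 by lra. replace (2 * (1/2)) with 1 by lra. auto.
    + apply continuous_ext_loc with (fun s => c' (2 * s - 1)); [|apply C2'; lra].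
      assert (P : 0 < s - 1/2) by lra. exists (mkposreal _ P). intros u Hu.
      apply Rabs_lt_between in Hu. simpl in Hu. unfold minus, plus, opp in Hu; simpl in Hu.
      destruct (Rle_dec u (1/2)); [lra|reflexivity].
  - destruct (Rle_dec s (1/2)); [apply Hin; lra|apply Hc'; lra].
  - destruct (Rle_dec s (1/2)); [apply Hin; lra|apply Hc'; lra].
  - destruct (Rle_dec 0 (1/2)); [|lra]. f_equal; ring.
  - destruct (Rle_dec 1 (1/2)); [lra|]. replace (2 * 1 - 1) with 1 by ring. exact EM.
Qed.

Lemma exterior_off_curve p : exterior B p -> ~ on_curve B p.
Proof.
  intros [_ H]. destruct (H 0) as (c & Hc & E0 & _). rewrite <- E0. apply Hc. lra.
Qed.

Lemma exterior_segment p q :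
  (forall s, 0 <= s <= 1 ->
    0 <= fst q + s * (fst p - fst q) /\
    ~ on_curve B (fst q + s * (fst p - fst q), snd q + s * (snd p - snd q))) ->
  exterior B p -> exterior B q.
Proof.
  intros H Hp. set (c := fun s => (fst q + s * (fst p - fst q), snd q + s * (snd p - snd q))).
  replace q with (c 0) by (unfold c; destruct q; simpl; f_equal; ring).
  apply exterior_path.
  - intros s. apply continuous_pair_R; apply (@ex_derive_continuous R_AbsRing R_NormedModule);
      auto_derive; auto.
  - exact H.
  - replace (c 1) with p; [exact Hp|]. unfold c; destruct p; simpl; f_equal; ring.
Qed.

(** A small square around [p] misses the arc and its intersection with the half-plane is convex, so
    segments join its points. Hence the exterior is both open and closed in the half-plane without
    the arc. *)
Lemma exterior_local p : 0 <= fst p -> ~ on_curve B p -> exists e, 0 < e /\ forall q,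
  0 <= fst q -> Rabs (fst q - fst p) < e -> Rabs (snd q - snd p) < e ->
  (exterior B p <-> exterior B q).
Proof.
  intros Hp0 Hp. destruct (off_curve_open p Hp) as (e & He & H). exists e. split; [exact He|].
  intros q Hq0 H1 H2.
  assert (S : forall a b s, 0 <= s <= 1 -> Rabs a < e -> Rabs b < e -> Rabs (a + s * (b - a)) < e).
  { intros a b s Hs Ha Hb. apply Rabs_lt_between in Ha, Hb. apply Rabs_lt_between.
    destruct (Rle_dec a b); split; nra. }
  assert (P : forall a b s, 0 <= s <= 1 -> 0 <= a -> 0 <= b -> 0 <= a + s * (b - a)).
  { intros. nra. }
  assert (Z : Rabs 0 < e) by (rewrite Rabs_R0; exact He).
  split; apply exterior_segment; intros s Hs; (split; [apply P; assumption|]); apply H; simpl.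
  - replace (fst q + s * (fst p - fst q) - fst p) with
      ((fst q - fst p) + s * (0 - (fst q - fst p))) by ring. apply S; assumption.
  - replace (snd q + s * (snd p - snd q) - snd p) with
      ((snd q - snd p) + s * (0 - (snd q - snd p))) by ring. apply S; assumption.
  - replace (fst p + s * (fst q - fst p) - fst p) with
      (0 + s * ((fst q - fst p) - 0)) by ring. apply S; assumption.
  - replace (snd p + s * (snd q - snd p) - snd p) with
      (0 + s * ((snd q - snd p) - 0)) by ring. apply S; assumption.
Qed.

(** If [Z] bounds the coordinates of the arc, a point of radius above [2 * Z] has a coordinate
    larger than [Z], and moving radially outwards keeps it so. *)
Lemma exterior_far : exists R0, 0 < R0 /\ forall p, 0 <= fst p -> R0 < radius p -> exterior B p.
Proof.
  destruct curve_bounded as (Z & PZ & HZ). exists (2 * Z). split; [lra|].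
  intros p Hp Hr.
  assert (Hr2 : (2 * Z) ^ 2 < fst p ^ 2 + snd p ^ 2).
  { unfold radius in Hr. apply Rnot_le_lt. intros Hle. apply sqrt_le_1_alt in Hle.
    rewrite sqrt_pow2 in Hle by lra. lra. }
  split; [exact Hp|]. intros M.
  (* Scaling by [1 + k / Z] brings the radius above [2 * Z + 2 * k], hence above [M]. *)
  set (k := Rmax 0 M). assert (Hk0 : 0 <= k) by apply Rmax_l. assert (HkM : M <= k) by apply Rmax_r.
  exists (fun s => ((1 + s * (k / Z)) * fst p, (1 + s * (k / Z)) * snd p)).
  assert (Hkz : 0 <= k / Z) by (apply Rdiv_le_0_compat; lra).
  assert (Hs0 : forall s, 0 <= s -> 1 <= 1 + s * (k / Z)).
  { intros s Hs. assert (0 <= s * (k / Z)) by (apply Rmult_le_pos; lra). lra. }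
  repeat split.
  - apply continuous_pair_R; apply (@ex_derive_continuous R_AbsRing R_NormedModule); auto_derive; auto.
  - simpl. specialize (Hs0 s). apply Rmult_le_pos; lra.
  - intros Hc. apply HZ in Hc. simpl in Hc. destruct Hc as [H1 H2].
    specialize (Hs0 s (proj1 H)). rewrite Rabs_mult, (Rabs_pos_eq (1 + _)) in H1, H2 by lra.
    pose proof (Rabs_pos (fst p)). pose proof (Rabs_pos (snd p)).
    rewrite <- (pow2_abs (fst p)), <- (pow2_abs (snd p)) in Hr2.
    assert (Rabs (fst p) <= Z) by nra. assert (Rabs (snd p) <= Z) by nra. nra.
  - destruct p; simpl; f_equal; ring.
  - unfold radius. simpl fst; simpl snd.
    replace (((1 + 1 * (k / Z)) * fst p) ^ 2 + ((1 + 1 * (k / Z)) * snd p) ^ 2) with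
      ((1 + k / Z) ^ 2 * (fst p ^ 2 + snd p ^ 2)) by ring.
    apply Rle_lt_trans with k; [exact HkM|].
    rewrite <- (sqrt_pow2 k) at 1 by assumption. apply sqrt_lt_1_alt. split; [apply pow2_ge_0|].
    apply Rlt_le_trans with ((1 + k / Z) ^ 2 * (2 * Z) ^ 2).
    + rewrite <- Rpow_mult_distr.
      replace ((1 + k / Z) * (2 * Z)) with (2 * Z + 2 * k) by (field; lra). nra.
    + apply Rmult_le_compat_l; [apply pow2_ge_0|lra].
Qed.

End Topology.

(** * Polar coordinates about a point of the axis *)

Lemma sin_ge_quarter x : 0 <= x <= PI / 2 -> x / 4 <= sin x.
Proof.
  intros Hx. pose proof PI_RGT_0.
  (* Up to [PI / 3] the derivative is at least [1/2]; beyond, monotonicity gives [sin x >= PI / 6],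
     which exceeds [x / 4]. *)
  assert (H3 : forall y, 0 <= y <= PI / 3 -> y / 2 <= sin y).
  { intros y Hy. destruct (MVT_gen sin 0 y cos) as (c & Hc & E).
    - intros. apply is_derive_Reals, derivable_pt_lim_sin.
    - intros. apply continuity_sin.
    - rewrite Rmin_left, Rmax_right in Hc by lra. rewrite sin_0, !Rminus_0_r in E. rewrite E.
      assert (1 / 2 <= cos c). { rewrite <- cos_PI3. apply cos_decr_1; lra. }
      nra. }
  destruct (Rle_dec x (PI / 3)) as [h|h].
  - specialize (H3 x). lra.
  - assert (sin (PI / 3) <= sin x) by (apply sin_incr_1; lra).
    specialize (H3 (PI / 3)). lra.
Qed.

(** The centre [(0, z0)] is on the axis and [t] is measured from the upward axis, so the axis is the
    set [t = 0], [t = PI] or [r = 0] of the strip [0 <= t <= PI], [0 <= r]. *)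
Definition polar (z0 r t : R) : R * R := (r * sin t, z0 + r * cos t).

Lemma polar_surj z0 p : 0 <= fst p -> snd p < z0 -> exists q,
  z0 - snd p <= fst q /\ 0 <= snd q <= PI /\ polar z0 (fst q) (snd q) = p.
Proof.
  destruct p as [x z]. simpl. intros Hx Hz.
  set (r := sqrt (x ^ 2 + (z - z0) ^ 2)).
  assert (Hr2 : r ^ 2 = x ^ 2 + (z - z0) ^ 2) by (apply pow2_sqrt; nra).
  assert (Hr : z0 - z <= r).
  { unfold r. rewrite <- (sqrt_pow2 (z0 - z)) by lra. apply sqrt_le_1_alt. nra. }
  exists (r, acos ((z - z0) / r)). simpl.
  assert (Hc : -1 <= (z - z0) / r <= 1).
  { split; apply (Rmult_le_reg_r r); try lra; unfold Rdiv; rewrite Rmult_assoc, Rinv_l by lra; nra. }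
  split; [exact Hr|]. split; [apply acos_bound|]. unfold polar.
  rewrite cos_acos, sin_acos by exact Hc. f_equal; [|field; lra].
  replace (1 - ((z - z0) / r)²) with ((x / r) ^ 2).
  2:{ unfold Rsqr. transitivity (x ^ 2 / r ^ 2); [field; lra|].
      replace (x ^ 2) with (r ^ 2 - (z - z0) ^ 2) by lra. field; lra. }
  rewrite sqrt_pow2 by (apply Rdiv_le_0_compat; lra). field. lra.
Qed.

(** By the law of cosines the squared distance is [(r - r')^2 + 4 r r' sin^2 x] with
    [x = |t - t'| / 2], and it is at most [2 e^2]. With [r r' >= 1] and [sin x >= x / 4] this gives
    [x^2 <= 8 e^2], so [|t - t'| <= 4 sqrt 2 e], which 6 rounds up. *)
Lemma polar_inverse_lipschitz z0 r t r' t' e :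
  1 <= r -> 1 <= r' -> 0 <= t <= PI -> 0 <= t' <= PI ->
  near_pt e (polar z0 r t) (polar z0 r' t') -> near_pt (6 * e) (r, t) (r', t').
Proof.
  intros Hr Hr' Ht Ht' [H1 H2]. simpl in H1, H2.
  replace (z0 + r * cos t - (z0 + r' * cos t')) with (r * cos t - r' * cos t') in H2 by ring.
  assert (He : 0 <= e) by (apply Rle_trans with (2 := H1), Rabs_pos).
  assert (Q1 : (r * sin t - r' * sin t') ^ 2 <= e ^ 2).
  { rewrite <- pow2_abs. apply pow_incr. split; [apply Rabs_pos|assumption]. }
  assert (Q2 : (r * cos t - r' * cos t') ^ 2 <= e ^ 2).
  { rewrite <- pow2_abs. apply pow_incr. split; [apply Rabs_pos|assumption]. }
  set (x := Rabs (t - t') / 2).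
  assert (Hx : 0 <= x <= PI / 2).
  { unfold x. pose proof (Rabs_pos (t - t')). assert (Rabs (t - t') <= PI) by (apply Rabs_le_between; lra). lra. }
  assert (Hc : cos (t - t') = 1 - 2 * sin x ^ 2).
  { transitivity (cos (2 * x)).
    - unfold x. replace (2 * (Rabs (t - t') / 2)) with (Rabs (t - t')) by field.
      unfold Rabs. destruct (Rcase_abs (t - t')); [symmetry; apply cos_neg|reflexivity].
    - rewrite cos_2a_sin. ring. }
  rewrite cos_minus in Hc.
  pose proof (sin2_cos2 t) as S1. pose proof (sin2_cos2 t') as S2. unfold Rsqr in S1, S2.
  assert (Q : (r - r') ^ 2 + 4 * (r * r') * sin x ^ 2 <= 2 * e ^ 2).
  { replace ((r - r') ^ 2 + 4 * (r * r') * sin x ^ 2) with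
      ((r * sin t - r' * sin t') ^ 2 + (r * cos t - r' * cos t') ^ 2); [lra|].
    replace (4 * (r * r') * sin x ^ 2) with (2 * (r * r') * (1 - (1 - 2 * sin x ^ 2))) by ring.
    rewrite <- Hc.
    replace ((r - r') ^ 2) with (r^2 * 1 + r'^2 * 1 - 2 * (r * r')) by ring.
    rewrite <- S1 at 1. rewrite <- S2 at 1. ring. }
  pose proof (sin_ge_quarter x Hx) as Sx.
  assert (Hrr : 1 <= r * r') by nra.
  assert (Sq : (x / 4) ^ 2 <= sin x ^ 2) by (apply pow_incr; lra).
  assert (Q3 : sin x ^ 2 <= r * r' * sin x ^ 2) by (pose proof (pow2_ge_0 (sin x)); nra).
  pose proof (pow2_ge_0 (r - r')).
  split; simpl.
  - apply Rabs_le_between. split; nra.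
  - replace (Rabs (t - t')) with (2 * x) by (unfold x; field). nra.
Qed.

Section PolarCurve.
Context (B : boundary_curve).

(** The arc is Lipschitz in its parameter and the inverse of polar coordinates is Lipschitz at
    distance at least 1 from the centre; the centre is placed high enough for the latter. *)
Lemma curve_thin z0 Z : Z + 1 <= z0 -> (forall p, on_curve B p -> snd p <= Z) ->
  thin (fun r t => 0 <= r /\ 0 <= t <= PI /\ on_curve B (polar z0 r t)).
Proof.
  intros Hz HZ.
  destruct (curve_lipschitz B) as (L & PL & HL).
  set (g := fun mu => (curve_rho B mu, curve_z B mu)).
  assert (Hg : forall mu, 0 <= mu <= 1 -> on_curve B (g mu)) by (intros mu Hm; exists mu; auto).
  assert (Hq : forall mu, exists q, 0 <= mu <= 1 ->
    1 <= fst q /\ 0 <= snd q <= PI /\ polar z0 (fst q) (snd q) = g mu).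
  { intros mu. destruct (excluded_middle_informative (0 <= mu <= 1)) as [h|h].
    - specialize (HZ _ (Hg mu h)).
      destruct (polar_surj z0 (g mu)) as (q & Q1 & Q2 & Q3).
      + apply (on_curve_rho B), Hg, h. + lra.
      + exists q. intros _. repeat split; try tauto; try lra.
    - exists (0, 0). tauto. }
  (* Polar coordinates of the points of the arc are chosen one by one; their Lipschitz dependence on
     [mu] comes from [polar_inverse_lipschitz]. *)
  set (q := fun mu => proj1_sig (constructive_indefinite_description _ (Hq mu))).
  assert (Hqs : forall mu, 0 <= mu <= 1 ->
    1 <= fst (q mu) /\ 0 <= snd (q mu) <= PI /\ polar z0 (fst (q mu)) (snd (q mu)) = g mu).
  { intros mu. unfold q. destruct (constructive_indefinite_description _ (Hq mu)) as [q' Hq']. exact Hq'. }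
  apply (thin_curve q (6 * L)); [lra|]. intros r t (Hr & Ht & Hc).
  assert (Hr1 : 1 <= r).
  { apply HZ in Hc. simpl in Hc. pose proof (COS_bound t). nra. }
  destruct Hc as (mu & Hmu & E). exists mu. split; [exact Hmu|]. intros nu Hnu.
  destruct (Hqs nu Hnu) as (Q1 & Q2 & Q3).
  rewrite Rmult_assoc. rewrite (surjective_pairing (q nu)).
  apply (polar_inverse_lipschitz z0); try assumption.
  rewrite E, Q3. unfold near_pt, g; simpl. apply HL; assumption.
Qed.

End PolarCurve.

(** * The Noether currents of the Ernst equations *)

Ltac cont2_step :=
  match goal with
  | |- cont2 (fun _ _ => ?c) _ _ => apply continuity_2d_pt_const
  | |- cont2 (fun u v => @?A u v + @?B u v) _ _ => apply (continuity_2d_pt_plus A B)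
  | |- cont2 (fun u v => @?A u v - @?B u v) _ _ => apply (continuity_2d_pt_minus A B)
  | |- cont2 (fun u v => @?A u v * @?B u v) _ _ => apply (continuity_2d_pt_mult A B)
  | |- cont2 (fun u v => @?A u v / @?B u v) _ _ =>
      apply (continuity_2d_pt_mult A (fun u v => / B u v))
  | |- cont2 (fun u v => / @?B u v) _ _ => apply (continuity_2d_pt_inv B)
  | |- cont2 (fun u v => - @?B u v) _ _ => apply (continuity_2d_pt_opp B)
  | |- cont2 (fun u v => sin (@?A u v)) _ _ =>
      apply (continuity_1d_2d_pt_comp sin A); [apply continuity_sin|]
  | |- cont2 (fun u v => cos (@?A u v)) _ _ =>
      apply (continuity_1d_2d_pt_comp cos A); [apply continuity_cos|]
  | |- cont2 (fun u _ => u) _ _ => apply continuity_2d_pt_id1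
  | |- cont2 (fun _ v => v) _ _ => apply continuity_2d_pt_id2
  end.
Ltac cont2_auto := repeat (cbv beta; first [assumption | cont2_step]).

Definition grad_on (D : R -> R -> Prop) (f fx fy : R -> R -> R) : Prop :=
  forall x y, D x y -> is_derive (fun s => f s y) x (fx x y) /\
    is_derive (fun s => f x s) y (fy x y) /\ cont2 fx x y /\ cont2 fy x y.

(** Partial derivatives alone give no chain rule; total differentiability is what the passage to
    polar coordinates uses. *)
Lemma grad_on_differentiable D f fx fy x y : open2 D -> grad_on D f fx fy -> D x y ->
  differentiable_pt_lim f x y (fx x y) (fy x y).
Proof.
  intros HD H Hxy. apply filterdiff_differentiable_pt_lim.
  apply (is_derive_filterdiff f x y fx (fy x y)).
  - refine (proj1 (locally_2d_locally (fun u v => is_derive (fun z => f z v) u (fx u v)) x y) _).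
    destruct (HD x y Hxy) as [d Hd]. exists d.
    intros u v Hu Hv. apply H, Hd; assumption.
  - apply H, Hxy.
  - destruct (H x y Hxy) as (_ & _ & C & _). apply continuity_2d_pt_filterlim in C. exact C.
Qed.

Lemma grad_on_cont D f fx fy x y : open2 D -> grad_on D f fx fy -> D x y -> cont2 f x y.
Proof.
  intros HD H Hxy. apply differentiable_continuity_pt. exists (fx x y), (fy x y).
  apply (grad_on_differentiable D); assumption.
Qed.

Lemma grad_on_sub (D D' : R -> R -> Prop) f fx fy : (forall x y, D' x y -> D x y) ->
  grad_on D f fx fy -> grad_on D' f fx fy.
Proof. intros S H x y Hxy. apply H, S, Hxy. Qed.

(** Derivatives are carried as explicit functions, so that linear combinations and changes of
    coordinates are formulas that [ring] can compare. [j12] is the second partial derivative of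
    [j1], and [j21] the first partial derivative of [j2]. *)
Record jet := Jet { j0 : R -> R -> R; j1 : R -> R -> R; j2 : R -> R -> R;
  j11 : R -> R -> R; j12 : R -> R -> R; j21 : R -> R -> R; j22 : R -> R -> R }.

Definition jet_on (D : R -> R -> Prop) (j : jet) : Prop :=
  grad_on D (j0 j) (j1 j) (j2 j) /\ grad_on D (j1 j) (j11 j) (j12 j) /\
  grad_on D (j2 j) (j21 j) (j22 j).

Definition jconst (k : R) : jet :=
  Jet (fun _ _ => k) (fun _ _ => 0) (fun _ _ => 0) (fun _ _ => 0) (fun _ _ => 0)
      (fun _ _ => 0) (fun _ _ => 0).

Definition jlin (p : R) (f : jet) (q : R) (g : jet) : jet :=
  Jet (fun x y => p * j0 f x y + q * j0 g x y) (fun x y => p * j1 f x y + q * j1 g x y)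
      (fun x y => p * j2 f x y + q * j2 g x y) (fun x y => p * j11 f x y + q * j11 g x y)
      (fun x y => p * j12 f x y + q * j12 g x y) (fun x y => p * j21 f x y + q * j21 g x y)
      (fun x y => p * j22 f x y + q * j22 g x y).

Lemma is_derive_const_R (k x : R) : is_derive (fun _ => k) x 0.
Proof. exact (@is_derive_const R_AbsRing R_NormedModule k x). Qed.

Ltac derive_values :=
  repeat match goal with H : is_derive ?f ?x ?l |- _ =>
    let E := fresh in
    assert (E : Derive (fun s => f s) x = l) by (apply is_derive_unique; exact H);
    rewrite E; clear H E end.
Ltac derive_side := repeat split; try assumption; try (eexists; eassumption).

Lemma grad_on_const D k : grad_on D (fun _ _ => k) (fun _ _ => 0) (fun _ _ => 0).
Proof.
  intros x y _. split; [|split; [|split]]; try apply continuity_2d_pt_const; apply is_derive_const_R.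
Qed.

Lemma jet_on_const D k : jet_on D (jconst k).
Proof. exact (conj (grad_on_const D k) (conj (grad_on_const D 0) (grad_on_const D 0))). Qed.

Lemma is_derive_lin (f g : R -> R) x l m p q : is_derive f x l -> is_derive g x m ->
  is_derive (fun s => p * f s + q * g s) x (p * l + q * m).
Proof.
  intros Hf Hg. apply (@is_derive_plus R_AbsRing R_NormedModule);
    apply is_derive_scal; assumption.
Qed.

Lemma grad_on_lin D p f f1 f2 q g g1 g2 : grad_on D f f1 f2 -> grad_on D g g1 g2 ->
  grad_on D (fun x y => p * f x y + q * g x y) (fun x y => p * f1 x y + q * g1 x y)
    (fun x y => p * f2 x y + q * g2 x y).
Proof.
  intros Hf Hg x y Hxy. destruct (Hf x y Hxy) as (A1 & A2 & A3 & A4).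
  destruct (Hg x y Hxy) as (B1 & B2 & B3 & B4).
  split; [|split; [|split]].
  - apply (is_derive_lin (fun s => f s y) (fun s => g s y)); assumption.
  - apply (is_derive_lin (fun s => f x s) (fun s => g x s)); assumption.
  - cont2_auto.
  - cont2_auto.
Qed.

Lemma jet_on_lin D p f q g : jet_on D f -> jet_on D g -> jet_on D (jlin p f q g).
Proof.
  intros (A1 & A2 & A3) (B1 & B2 & B3).
  exact (conj (grad_on_lin D p _ _ _ q _ _ _ A1 B1) (conj (grad_on_lin D p _ _ _ q _ _ _ A2 B2)
    (grad_on_lin D p _ _ _ q _ _ _ A3 B3))).
Qed.

(** Coefficients of an operator [d_1 (w1 d_1 f) + d_2 (w2 d_2 f)], so that one computation covers
    both the coordinates [(rho, z)] and the polar ones. *)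
Record weights := Weights { w1 : R -> R -> R; w2 : R -> R -> R;
  dw1 : R -> R -> R; dw2 : R -> R -> R }.

Definition weights_ok (W : weights) : Prop := forall x y,
  is_derive (fun s => w1 W s y) x (dw1 W x y) /\ is_derive (fun s => w2 W x s) y (dw2 W x y) /\
  cont2 (w1 W) x y /\ cont2 (w2 W) x y /\ cont2 (dw1 W) x y /\ cont2 (dw2 W) x y.

Definition wdiv (W : weights) (j : jet) (x y : R) : R :=
  dw1 W x y * j1 j x y + w1 W x y * j11 j x y + (dw2 W x y * j2 j x y + w2 W x y * j22 j x y).

(** [E = ja + i jb] and [L = jc + i jd]. *)
Record fields := Fields { ja : jet; jb : jet; jc : jet; jd : jet }.

Definition fields_on D (F : fields) : Prop :=
  jet_on D (ja F) /\ jet_on D (jb F) /\ jet_on D (jc F) /\ jet_on D (jd F).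

Section Ernst.
Context (W : weights) (F : fields).

Definition fX x y := j0 (ja F) x y + j0 (jc F) x y * j0 (jc F) x y + j0 (jd F) x y * j0 (jd F) x y.

(** [X1, T1] are the real and imaginary parts of [d_1 E + 2 conj L d_1 L]. *)
Definition fX1 x y :=
  j1 (ja F) x y + 2 * (j0 (jc F) x y * j1 (jc F) x y + j0 (jd F) x y * j1 (jd F) x y).
Definition fX2 x y :=
  j2 (ja F) x y + 2 * (j0 (jc F) x y * j2 (jc F) x y + j0 (jd F) x y * j2 (jd F) x y).
Definition fT1 x y :=
  j1 (jb F) x y + 2 * (j0 (jc F) x y * j1 (jd F) x y - j0 (jd F) x y * j1 (jc F) x y).
Definition fT2 x y :=
  j2 (jb F) x y + 2 * (j0 (jc F) x y * j2 (jd F) x y - j0 (jd F) x y * j2 (jc F) x y).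

(** [X div (w grad (f + i g)) = w grad (f + i g) . (X_i + i T_i)], an equation that is
    complex linear in [f + i g]; it holds for [E], [L] and constants. *)
Definition solves (f g : jet) (x y : R) : Prop :=
  fX x y * wdiv W f x y =
    w1 W x y * (j1 f x y * fX1 x y - j1 g x y * fT1 x y) +
    w2 W x y * (j2 f x y * fX2 x y - j2 g x y * fT2 x y) /\
  fX x y * wdiv W g x y =
    w1 W x y * (j1 f x y * fT1 x y + j1 g x y * fX1 x y) +
    w2 W x y * (j2 f x y * fT2 x y + j2 g x y * fX2 x y).

Definition ernst_at x y : Prop :=
  0 < fX x y /\ solves (ja F) (jb F) x y /\ solves (jc F) (jd F) x y.

Lemma solves_const k l x y : solves (jconst k) (jconst l) x y.
Proof. unfold solves, wdiv; simpl. split; ring. Qed.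

(** Adding [(p + i q) (f' + i g')]. *)
Lemma solves_add f g p q f' g' x y : solves f g x y -> solves f' g' x y ->
  solves (jlin 1 f 1 (jlin p f' (- q) g')) (jlin 1 g 1 (jlin p g' q f')) x y.
Proof.
  intros [A1 A2] [B1 B2]. unfold solves, wdiv in *; simpl.
  split; apply Rminus_diag_uniq.
  - match type of A1 with ?l = ?r => match type of B1 with ?l1 = ?r1 => match type of B2 with ?l2 = ?r2 =>
      transitivity ((l - r) + p * (l1 - r1) - q * (l2 - r2)); [ring|rewrite A1, B1, B2; ring] end end end.
  - match type of A2 with ?l = ?r => match type of B1 with ?l1 = ?r1 => match type of B2 with ?l2 = ?r2 =>
      transitivity ((l - r) + q * (l1 - r1) + p * (l2 - r2)); [ring|rewrite A2, B1, B2; ring] end end end.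
Qed.

(** The Noether current [Re (conj f grad g - g grad conj f - i conj f g T / X) w / X] of
    the complex functions [f = f1 + i f2] and [g = g1 + i g2]. *)
Definition current1 (f1 f2 g1 g2 : jet) x y : R :=
  w1 W x y * (j0 f1 x y * j1 g1 x y - j0 g1 x y * j1 f1 x y +
              j0 f2 x y * j1 g2 x y - j0 g2 x y * j1 f2 x y) / fX x y +
  w1 W x y * (j0 f1 x y * j0 g2 x y - j0 f2 x y * j0 g1 x y) * fT1 x y / (fX x y * fX x y).
Definition current2 (f1 f2 g1 g2 : jet) x y : R :=
  w2 W x y * (j0 f1 x y * j2 g1 x y - j0 g1 x y * j2 f1 x y +
              j0 f2 x y * j2 g2 x y - j0 g2 x y * j2 f2 x y) / fX x y +
  w2 W x y * (j0 f1 x y * j0 g2 x y - j0 f2 x y * j0 g1 x y) * fT2 x y / (fX x y * fX x y).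

End Ernst.

(** The derivative of one component of the current along its own coordinate, as a function of
    numbers: both components share it, and conservation becomes an algebraic identity. *)
Definition dcurrent (w dw : R) (X X' f1 f2 g1 g2 f1' f2' g1' g2' f1'' f2'' g1'' g2'' T T' : R) : R :=
  dw * (f1 * g1' - g1 * f1' + f2 * g2' - g2 * f2') / X +
  w * (f1 * g1'' - g1 * f1'' + f2 * g2'' - g2 * f2'') / X -
  w * (f1 * g1' - g1 * f1' + f2 * g2' - g2 * f2') * X' / (X * X) +
  dw * (f1 * g2 - f2 * g1) * T / (X * X) +
  w * (f1' * g2 + f1 * g2' - f2' * g1 - f2 * g1') * T / (X * X) +
  w * (f1 * g2 - f2 * g1) * T' / (X * X) -
  2 * w * (f1 * g2 - f2 * g1) * T * X' / (X * X * X).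

Lemma is_derive_current (w dw X f1 f2 g1 g2 f1' f2' g1' g2' T : R -> R) (x X' f1'' f2'' g1'' g2'' T' : R) :
  is_derive w x (dw x) -> is_derive X x X' -> 
  is_derive f1 x (f1' x) -> is_derive f2 x (f2' x) -> is_derive g1 x (g1' x) -> is_derive g2 x (g2' x) ->
  is_derive f1' x f1'' -> is_derive f2' x f2'' -> is_derive g1' x g1'' -> is_derive g2' x g2'' ->
  is_derive T x T' -> X x <> 0 ->
  is_derive (fun s => w s * (f1 s * g1' s - g1 s * f1' s + f2 s * g2' s - g2 s * f2' s) / X s +
    w s * (f1 s * g2 s - f2 s * g1 s) * T s / (X s * X s)) x
  (dcurrent (w x) (dw x) (X x) X' (f1 x) (f2 x) (g1 x) (g2 x) (f1' x) (f2' x) (g1' x) (g2' x)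
     f1'' f2'' g1'' g2'' (T x) T').
Proof.
  intros Hw HX H1 H2 H3 H4 H5 H6 H7 H8 HT HX0. unfold dcurrent.
  auto_derive.
  - derive_side. apply Rmult_integral_contrapositive_currified; assumption.
  - derive_values.
    field. exact HX0.
Qed.

Ltac req := match goal with |- @eq _ ?a ?b => change (@eq R a b) end.

Section Conservation.
Context (W : weights) (F : fields).

(** [d_i T_i]; the products of first derivatives cancel. *)
Definition fT11 x y :=
  j11 (jb F) x y + 2 * (j0 (jc F) x y * j11 (jd F) x y - j0 (jd F) x y * j11 (jc F) x y).
Definition fT22 x y :=
  j22 (jb F) x y + 2 * (j0 (jc F) x y * j22 (jd F) x y - j0 (jd F) x y * j22 (jc F) x y).

(** Equivalent to [div (w T / X^2) = 0]. It is the imaginary part of the equation for [E] plus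
    [2 conj L] times the equation for [L]; the term [grad conj L . grad L] is real and drops out. *)
Lemma div_twist x y : ernst_at W F x y ->
  fX F x y * (dw1 W x y * fT1 F x y + w1 W x y * fT11 x y + (dw2 W x y * fT2 F x y + w2 W x y * fT22 x y)) =
  2 * (w1 W x y * (fX1 F x y * fT1 F x y) + w2 W x y * (fX2 F x y * fT2 F x y)).
Proof.
  intros (_ & [_ Hb] & [Hc Hd]).
  transitivity (fX F x y * wdiv W (jb F) x y +
    2 * (j0 (jc F) x y * (fX F x y * wdiv W (jd F) x y) - j0 (jd F) x y * (fX F x y * wdiv W (jc F) x y))).
  - unfold wdiv, fT1, fT2, fT11, fT22. ring.
  - rewrite Hb, Hc, Hd. unfold fT1, fT2, fX1, fX2. ring.
Qed.

Definition dcurrent1 (f1 f2 g1 g2 : jet) x y : R :=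
  dcurrent (w1 W x y) (dw1 W x y) (fX F x y) (fX1 F x y) (j0 f1 x y) (j0 f2 x y) (j0 g1 x y) (j0 g2 x y)
    (j1 f1 x y) (j1 f2 x y) (j1 g1 x y) (j1 g2 x y) (j11 f1 x y) (j11 f2 x y) (j11 g1 x y) (j11 g2 x y)
    (fT1 F x y) (fT11 x y).
Definition dcurrent2 (f1 f2 g1 g2 : jet) x y : R :=
  dcurrent (w2 W x y) (dw2 W x y) (fX F x y) (fX2 F x y) (j0 f1 x y) (j0 f2 x y) (j0 g1 x y) (j0 g2 x y)
    (j2 f1 x y) (j2 f2 x y) (j2 g1 x y) (j2 g2 x y) (j22 f1 x y) (j22 f2 x y) (j22 g1 x y) (j22 g2 x y)
    (fT2 F x y) (fT22 x y).

(** In the divergence, the gradients of [X] supplied by the field equations cancel those from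
    differentiating [1 / X], and the terms along [T] cancel the derivative of [f1 g2 - f2 g1]. What
    is left is that coefficient times [div (w T / X^2)]. *)
Lemma current_conserved f1 f2 g1 g2 x y :
  ernst_at W F x y -> solves W F f1 f2 x y -> solves W F g1 g2 x y ->
  dcurrent1 f1 f2 g1 g2 x y + dcurrent2 f1 f2 g1 g2 x y = 0.
Proof.
  intros HE Hf Hg. pose proof (div_twist x y HE) as HT.
  destruct HE as (HX & _ & _). assert (HX0 : fX F x y <> 0) by lra. 
  destruct Hf as [Hf1 Hf2]. destruct Hg as [Hg1 Hg2].
  unfold dcurrent1, dcurrent2, dcurrent, wdiv in *.
  generalize dependent (fX F x y). generalize dependent (fT11 x y). generalize dependent (fT22 x y).
  generalize dependent (fX1 F x y). generalize dependent (fX2 F x y).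
  generalize dependent (fT1 F x y). generalize dependent (fT2 F x y).
  generalize (w1 W x y) (w2 W x y) (dw1 W x y) (dw2 W x y).
  generalize (j0 f1 x y) (j1 f1 x y) (j2 f1 x y) (j11 f1 x y) (j22 f1 x y).
  generalize (j0 f2 x y) (j1 f2 x y) (j2 f2 x y) (j11 f2 x y) (j22 f2 x y).
  generalize (j0 g1 x y) (j1 g1 x y) (j2 g1 x y) (j11 g1 x y) (j22 g1 x y).
  generalize (j0 g2 x y) (j1 g2 x y) (j2 g2 x y) (j11 g2 x y) (j22 g2 x y).
  intros q0 q1 q2 q11 q22 p0 p1 p2 p11 p22 b0 b1 b2 b11 b22 a0 a1 a2 a11 a22 u1 u2 v1 v2
    T2 T1 X2 X1 T22 T11 X _ Hf1 Hf2 Hg1 Hg2 HT HX0.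
  set (Df1 := v1 * a1 + u1 * a11 + (v2 * a2 + u2 * a22)) in *.
  set (Df2 := v1 * b1 + u1 * b11 + (v2 * b2 + u2 * b22)) in *.
  set (Dg1 := v1 * p1 + u1 * p11 + (v2 * p2 + u2 * p22)) in *.
  set (Dg2 := v1 * q1 + u1 * q11 + (v2 * q2 + u2 * q22)) in *.
  set (DT := v1 * T1 + u1 * T11 + (v2 * T2 + u2 * T22)) in *.
  (* The second derivatives are grouped into exactly the combinations that the field equations and
     [div_twist] evaluate. *)
  transitivity ((a0 * (X * Dg1) - p0 * (X * Df1) + b0 * (X * Dg2) - q0 * (X * Df2)) / (X * X)
    - (u1 * (a0 * p1 - p0 * a1 + b0 * q1 - q0 * b1) * X1 + u2 * (a0 * p2 - p0 * a2 + b0 * q2 - q0 * b2) * X2) / (X * X)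
    + (u1 * (a1 * q0 + a0 * q1 - b1 * p0 - b0 * p1) * T1 + u2 * (a2 * q0 + a0 * q2 - b2 * p0 - b0 * p2) * T2) / (X * X)
    + (a0 * q0 - b0 * p0) * (X * DT) / (X * X * X)
    - 2 * (a0 * q0 - b0 * p0) * (u1 * T1 * X1 + u2 * T2 * X2) / (X * X * X)).
  - unfold Df1, Df2, Dg1, Dg2, DT. field. exact HX0.
  - rewrite HT, Hf1, Hf2, Hg1, Hg2. field. exact HX0.
Qed.

Lemma is_derive_fX D x y : fields_on D F -> D x y ->
  is_derive (fun s => fX F s y) x (fX1 F x y) /\ is_derive (fun s => fX F x s) y (fX2 F x y).
Proof.
  intros ((A & _) & _ & (C & _) & (E & _)) H.
  destruct (A x y H) as (A1 & A2 & _). destruct (C x y H) as (C1 & C2 & _).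
  destruct (E x y H) as (E1 & E2 & _).
  assert (G : forall (a c d : R -> R) s a' c' d', is_derive a s a' -> is_derive c s c' -> is_derive d s d' ->
    is_derive (fun s => a s + c s * c s + d s * d s) s (a' + 2 * (c s * c' + d s * d'))).
  { intros a c d s a' c' d' H1 H2 H3. auto_derive.
    - derive_side.
    - derive_values. ring. }
  split.
  - exact (G (fun s => j0 (ja F) s y) (fun s => j0 (jc F) s y) (fun s => j0 (jd F) s y) x _ _ _ A1 C1 E1).
  - exact (G (fun s => j0 (ja F) x s) (fun s => j0 (jc F) x s) (fun s => j0 (jd F) x s) y _ _ _ A2 C2 E2).
Qed.

Lemma is_derive_fT D x y : fields_on D F -> D x y ->
  is_derive (fun s => fT1 F s y) x (fT11 x y) /\ is_derive (fun s => fT2 F x s) y (fT22 x y).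
Proof.
  intros ((A & _) & (B0 & B1 & B2) & (C0 & C1 & C2) & (E0 & E1 & E2)) H.
  assert (G : forall (b' c d c' d' : R -> R) s b'' c'' d'', is_derive b' s b'' -> is_derive c s (c' s) ->
    is_derive d s (d' s) -> is_derive c' s c'' -> is_derive d' s d'' ->
    is_derive (fun s => b' s + 2 * (c s * d' s - d s * c' s)) s (b'' + 2 * (c s * d'' - d s * c''))).
  { intros b' c d c' d' s b'' c'' d'' H1 H2 H3 H4 H5. auto_derive.
    - derive_side.
    - derive_values. ring. }
  split.
  - apply (G (fun s => j1 (jb F) s y) (fun s => j0 (jc F) s y) (fun s => j0 (jd F) s y)
      (fun s => j1 (jc F) s y) (fun s => j1 (jd F) s y)).
    + exact (proj1 (B1 x y H)).
    + exact (proj1 (C0 x y H)).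
    + exact (proj1 (E0 x y H)).
    + exact (proj1 (C1 x y H)).
    + exact (proj1 (E1 x y H)).
  - apply (G (fun s => j2 (jb F) x s) (fun s => j0 (jc F) x s) (fun s => j0 (jd F) x s)
      (fun s => j2 (jc F) x s) (fun s => j2 (jd F) x s)).
    + exact (proj1 (proj2 (B2 x y H))).
    + exact (proj1 (proj2 (C0 x y H))).
    + exact (proj1 (proj2 (E0 x y H))).
    + exact (proj1 (proj2 (C2 x y H))).
    + exact (proj1 (proj2 (E2 x y H))).
Qed.

Lemma is_derive_current12 D f1 f2 g1 g2 x y : weights_ok W -> fields_on D F ->
  jet_on D f1 -> jet_on D f2 -> jet_on D g1 -> jet_on D g2 -> D x y -> fX F x y <> 0 ->
  is_derive (fun s => current1 W F f1 f2 g1 g2 s y) x (dcurrent1 f1 f2 g1 g2 x y) /\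
  is_derive (fun s => current2 W F f1 f2 g1 g2 x s) y (dcurrent2 f1 f2 g1 g2 x y).
Proof.
  intros HW HF (A0 & A1 & A2) (B0 & B1 & B2) (C0 & C1 & C2) (E0 & E1 & E2) H HX.
  destruct (HW x y) as (W1 & W2 & _).
  destruct (is_derive_fX D x y HF H) as [X1 X2]. destruct (is_derive_fT D x y HF H) as [T1 T2].
  split.
  - exact (is_derive_current (fun s => w1 W s y) (fun s => dw1 W s y) (fun s => fX F s y)
      (fun s => j0 f1 s y) (fun s => j0 f2 s y) (fun s => j0 g1 s y) (fun s => j0 g2 s y)
      (fun s => j1 f1 s y) (fun s => j1 f2 s y) (fun s => j1 g1 s y) (fun s => j1 g2 s y)
      (fun s => fT1 F s y) x _ _ _ _ _ _ W1 X1
      (proj1 (A0 x y H)) (proj1 (B0 x y H)) (proj1 (C0 x y H)) (proj1 (E0 x y H))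
      (proj1 (A1 x y H)) (proj1 (B1 x y H)) (proj1 (C1 x y H)) (proj1 (E1 x y H)) T1 HX).
  - exact (is_derive_current (fun s => w2 W x s) (fun s => dw2 W x s) (fun s => fX F x s)
      (fun s => j0 f1 x s) (fun s => j0 f2 x s) (fun s => j0 g1 x s) (fun s => j0 g2 x s)
      (fun s => j2 f1 x s) (fun s => j2 f2 x s) (fun s => j2 g1 x s) (fun s => j2 g2 x s)
      (fun s => fT2 F x s) y _ _ _ _ _ _ W2 X2
      (proj1 (proj2 (A0 x y H))) (proj1 (proj2 (B0 x y H))) (proj1 (proj2 (C0 x y H))) (proj1 (proj2 (E0 x y H)))
      (proj1 (proj2 (A2 x y H))) (proj1 (proj2 (B2 x y H))) (proj1 (proj2 (C2 x y H))) (proj1 (proj2 (E2 x y H))) T2 HX).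
Qed.

Lemma jet_cont D f x y : open2 D -> jet_on D f -> D x y ->
  cont2 (j0 f) x y /\ cont2 (j1 f) x y /\ cont2 (j2 f) x y /\ cont2 (j11 f) x y /\ cont2 (j22 f) x y.
Proof.
  intros HD (A0 & A1 & A2) H. split; [apply (grad_on_cont D _ _ _ x y HD A0 H)|].
  destruct (A0 x y H) as (_ & _ & Q1 & Q2). destruct (A1 x y H) as (_ & _ & Q3 & _).
  destruct (A2 x y H) as (_ & _ & _ & Q4). auto.
Qed.

Lemma current_cont D f1 f2 g1 g2 x y : open2 D -> weights_ok W -> fields_on D F ->
  jet_on D f1 -> jet_on D f2 -> jet_on D g1 -> jet_on D g2 -> D x y -> fX F x y <> 0 ->
  cont2 (fX F) x y /\
  cont2 (current1 W F f1 f2 g1 g2) x y /\ cont2 (current2 W F f1 f2 g1 g2) x y /\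
  cont2 (dcurrent1 f1 f2 g1 g2) x y /\ cont2 (dcurrent2 f1 f2 g1 g2) x y.
Proof.
  intros HD HW (Fa & Fb & Fc & Fd) J1 J2 J3 J4 H HX.
  destruct (HW x y) as (_ & _ & W1 & W2 & W3 & W4).
  destruct (jet_cont D _ x y HD J1 H) as (? & ? & ? & ? & ?).
  destruct (jet_cont D _ x y HD J2 H) as (? & ? & ? & ? & ?).
  destruct (jet_cont D _ x y HD J3 H) as (? & ? & ? & ? & ?).
  destruct (jet_cont D _ x y HD J4 H) as (? & ? & ? & ? & ?).
  destruct (jet_cont D _ x y HD Fa H) as (? & ? & ? & ? & ?).
  destruct (jet_cont D _ x y HD Fb H) as (? & ? & ? & ? & ?).
  destruct (jet_cont D _ x y HD Fc H) as (? & ? & ? & ? & ?).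
  destruct (jet_cont D _ x y HD Fd H) as (? & ? & ? & ? & ?).
  assert (CX : cont2 (fX F) x y) by (unfold fX; cont2_auto).
  assert (CX1 : cont2 (fX1 F) x y) by (unfold fX1; cont2_auto).
  assert (CX2 : cont2 (fX2 F) x y) by (unfold fX2; cont2_auto).
  assert (CT1 : cont2 (fT1 F) x y) by (unfold fT1; cont2_auto).
  assert (CT2 : cont2 (fT2 F) x y) by (unfold fT2; cont2_auto).
  assert (CT11 : cont2 fT11 x y) by (unfold fT11; cont2_auto).
  assert (CT22 : cont2 fT22 x y) by (unfold fT22; cont2_auto).
  assert (HXX : fX F x y * fX F x y <> 0) by (apply Rmult_integral_contrapositive_currified; exact HX).
  assert (HXXX : fX F x y * fX F x y * fX F x y <> 0)
    by (apply Rmult_integral_contrapositive_currified; assumption).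
  split; [exact CX|].
  unfold current1, current2, dcurrent1, dcurrent2, dcurrent.
  split; [|split; [|split]]; cont2_auto.
Qed.

End Conservation.

(** * The equations in polar coordinates *)

Definition polar_fun (z0 : R) (f : R -> R -> R) : R -> R -> R :=
  fun r t => f (r * sin t) (z0 + r * cos t).

Definition polar_dom (z0 : R) (D : R -> R -> Prop) : R -> R -> Prop :=
  fun r t => D (r * sin t) (z0 + r * cos t).

Definition polar_d1 (fx fz : R -> R -> R) z0 r t :=
  polar_fun z0 fx r t * sin t + polar_fun z0 fz r t * cos t.
Definition polar_d2 (fx fz : R -> R -> R) z0 r t :=
  r * (polar_fun z0 fx r t * cos t - polar_fun z0 fz r t * sin t).

Definition polar_jet (z0 : R) (j : jet) : jet :=
  Jet (polar_fun z0 (j0 j)) (polar_d1 (j1 j) (j2 j) z0) (polar_d2 (j1 j) (j2 j) z0)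
    (fun r t => polar_d1 (j11 j) (j12 j) z0 r t * sin t + polar_d1 (j21 j) (j22 j) z0 r t * cos t)
    (fun r t => polar_d2 (j11 j) (j12 j) z0 r t * sin t + polar_fun z0 (j1 j) r t * cos t +
      (polar_d2 (j21 j) (j22 j) z0 r t * cos t - polar_fun z0 (j2 j) r t * sin t))
    (fun r t => polar_fun z0 (j1 j) r t * cos t - polar_fun z0 (j2 j) r t * sin t +
      r * (polar_d1 (j11 j) (j12 j) z0 r t * cos t - polar_d1 (j21 j) (j22 j) z0 r t * sin t))
    (fun r t => r * (polar_d2 (j11 j) (j12 j) z0 r t * cos t - polar_fun z0 (j1 j) r t * sin t -
      (polar_d2 (j21 j) (j22 j) z0 r t * sin t + polar_fun z0 (j2 j) r t * cos t))).

Definition polar_fields (z0 : R) (F : fields) : fields :=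
  Fields (polar_jet z0 (ja F)) (polar_jet z0 (jb F)) (polar_jet z0 (jc F)) (polar_jet z0 (jd F)).

Definition cart_weights : weights :=
  Weights (fun x _ => x) (fun x _ => x) (fun _ _ => 1) (fun _ _ => 0).

(** With [rho = r sin t] and the flat metric [dr^2 + r^2 dt^2], the weights of [rho grad] are
    [rho * r] radially and [rho / r] in the angle; written this way they remain continuous at
    [r = 0]. *)
Definition polar_weights : weights :=
  Weights (fun r t => r * r * sin t) (fun _ t => sin t) (fun r t => 2 * r * sin t) (fun _ t => cos t).

Lemma polar_weights_ok : weights_ok polar_weights.
Proof.
  intros r t. simpl. split; [|split; [|split; [|split; [|split]]]].
  - auto_derive; [auto|ring].
  - auto_derive; [auto|ring].
  - cont2_auto.
  - cont2_auto.
  - cont2_auto.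
  - cont2_auto.
Qed.

Lemma locally_2d_comp (P : R -> R -> Prop) (u v : R -> R -> R) x y :
  locally_2d P (u x y) (v x y) -> cont2 u x y -> cont2 v x y ->
  locally_2d (fun x y => P (u x y) (v x y)) x y.
Proof.
  intros [d Hd] Hu Hv. destruct (Hu d) as [d1 H1]. destruct (Hv d) as [d2 H2].
  assert (Pd : 0 < Rmin d1 d2) by (apply Rmin_pos; apply cond_pos).
  exists (mkposreal _ Pd). simpl. intros a b Ha Hb.
  pose proof (Rmin_l d1 d2). pose proof (Rmin_r d1 d2).
  apply Hd; [apply H1|apply H2]; lra.
Qed.

Lemma polar_locally (P : R -> R -> Prop) z0 r t : locally_2d P (r * sin t) (z0 + r * cos t) ->
  locally_2d (polar_dom z0 P) r t.
Proof.
  intros H. apply (locally_2d_comp P (fun r t => r * sin t) (fun r t => z0 + r * cos t)); [exact H| |];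
    cont2_auto.
Qed.

Lemma polar_fun_cont z0 f r t : cont2 f (r * sin t) (z0 + r * cos t) -> cont2 (polar_fun z0 f) r t.
Proof. intros H eps. exact (polar_locally _ z0 r t (H eps)). Qed.

Lemma polar_dom_open z0 D : open2 D -> open2 (polar_dom z0 D).
Proof. intros HD r t H. exact (polar_locally D z0 r t (HD _ _ H)). Qed.

Lemma grad_on_polar z0 D f fx fz : open2 D -> grad_on D f fx fz ->
  grad_on (polar_dom z0 D) (polar_fun z0 f) (polar_d1 fx fz z0) (polar_d2 fx fz z0).
Proof.
  intros HD H r t Hrt.
  pose proof (grad_on_differentiable D f fx fz _ _ HD H Hrt) as Hd.
  destruct (H _ _ Hrt) as (_ & _ & C1 & C2).
  apply polar_fun_cont in C1. apply polar_fun_cont in C2.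
  split; [|split; [|split]].
  - apply is_derive_Reals. unfold polar_d1, polar_fun.
    apply (derivable_pt_lim_comp_2d f (fun r => r * sin t) (fun r => z0 + r * cos t) r);
      [exact Hd| |]; apply is_derive_Reals; auto_derive; auto; ring.
  - apply is_derive_Reals. unfold polar_d2, polar_fun.
    replace (r * (fx (r * sin t) (z0 + r * cos t) * cos t - fz (r * sin t) (z0 + r * cos t) * sin t)) with
      (fx (r * sin t) (z0 + r * cos t) * (r * cos t) + fz (r * sin t) (z0 + r * cos t) * (- r * sin t)) by ring.
    apply (derivable_pt_lim_comp_2d f (fun t => r * sin t) (fun t => z0 + r * cos t) t);
      [exact Hd| |]; apply is_derive_Reals; auto_derive; auto; ring.
  - unfold polar_d1. cont2_auto.
  - unfold polar_d2. cont2_auto.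
Qed.

Lemma grad_on_cont_all D f fx fy x y : open2 D -> grad_on D f fx fy -> D x y ->
  cont2 f x y /\ cont2 fx x y /\ cont2 fy x y.
Proof.
  intros HD H Hxy. split; [apply (grad_on_cont D _ _ _ _ _ HD H Hxy)|].
  destruct (H _ _ Hxy) as (_ & _ & C1 & C2). auto.
Qed.

Lemma is_derive_comb (f g u v : R -> R) x f' g' u' v' :
  is_derive f x f' -> is_derive g x g' -> is_derive u x u' -> is_derive v x v' ->
  is_derive (fun s => f s * u s + g s * v s) x (f' * u x + f x * u' + (g' * v x + g x * v')).
Proof.
  intros H1 H2 H3 H4. auto_derive.
  - derive_side.
  - derive_values. ring.
Qed.

Lemma is_derive_sin_R t : is_derive sin t (cos t).
Proof. apply is_derive_Reals, derivable_pt_lim_sin. Qed.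
Lemma is_derive_cos_R t : is_derive cos t (- sin t).
Proof. apply is_derive_Reals, derivable_pt_lim_cos. Qed.

Lemma jet_on_polar z0 D j : open2 D -> jet_on D j -> jet_on (polar_dom z0 D) (polar_jet z0 j).
Proof.
  intros HD (A0 & A1 & A2).
  pose proof (grad_on_polar z0 D _ _ _ HD A0) as P0.
  pose proof (grad_on_polar z0 D _ _ _ HD A1) as P1.
  pose proof (grad_on_polar z0 D _ _ _ HD A2) as P2.
  pose proof (polar_dom_open z0 D HD) as HP.
  split; [exact P0|]. 
  split; intros r t H; 
    destruct (grad_on_cont_all _ _ _ _ r t HP P1 H) as (? & ? & ?);
    destruct (grad_on_cont_all _ _ _ _ r t HP P2 H) as (? & ? & ?);
    destruct (P1 r t H) as (D1 & D2 & _); destruct (P2 r t H) as (E1 & E2 & _); simpl.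
  - split; [|split; [|split]].
    + evar_last.
      * exact (is_derive_comb (fun s => polar_fun z0 (j1 j) s t) (fun s => polar_fun z0 (j2 j) s t)
          (fun _ => sin t) (fun _ => cos t) r _ _ _ _ D1 E1 (is_derive_const_R _ _) (is_derive_const_R _ _)).
      * simpl. ring.
    + evar_last.
      * exact (is_derive_comb (fun s => polar_fun z0 (j1 j) r s) (fun s => polar_fun z0 (j2 j) r s)
          sin cos t _ _ _ _ D2 E2 (is_derive_sin_R t) (is_derive_cos_R t)).
      * simpl. ring.
    + cont2_auto.
    + cont2_auto.
  - split; [|split; [|split]].
    + apply is_derive_ext with (fun s => polar_fun z0 (j1 j) s t * (s * cos t) +
        polar_fun z0 (j2 j) s t * (s * (- sin t))).
      { intros s. unfold polar_d2. req. ring. }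
      assert (L : forall k, is_derive (fun s => s * k) r k) by (intros; auto_derive; [auto|ring]).
      evar_last.
      * exact (is_derive_comb (fun s => polar_fun z0 (j1 j) s t) (fun s => polar_fun z0 (j2 j) s t)
          (fun s => s * cos t) (fun s => s * (- sin t)) r _ _ _ _ D1 E1 (L _) (L _)).
      * simpl. ring.
    + apply is_derive_ext with (fun s => polar_fun z0 (j1 j) r s * (r * cos s) +
        polar_fun z0 (j2 j) r s * (- (r * sin s))).
      { intros s. unfold polar_d2. req. ring. }
      assert (L1 : is_derive (fun s => r * cos s) t (- (r * sin t))) by (auto_derive; [auto|ring]).
      assert (L2 : is_derive (fun s => - (r * sin s)) t (- (r * cos t))) by (auto_derive; [auto|ring]).
      evar_last.
      * exact (is_derive_comb (fun s => polar_fun z0 (j1 j) r s) (fun s => polar_fun z0 (j2 j) r s)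
          (fun s => r * cos s) (fun s => - (r * sin s)) t _ _ _ _ D2 E2 L1 L2).
      * simpl. ring.
    + cont2_auto.
    + cont2_auto.
Qed.

(** The factor [r] is the Jacobian of polar coordinates. *)
Lemma polar_wdiv z0 j r t :
  wdiv polar_weights (polar_jet z0 j) r t = r * wdiv cart_weights j (r * sin t) (z0 + r * cos t).
Proof.
  unfold wdiv; simpl. unfold polar_d1, polar_d2, polar_fun.
  pose proof (sin2_cos2 t) as S. unfold Rsqr in S.
  set (x := r * sin t). set (z := z0 + r * cos t).
  transitivity (r * (1 * j1 j x z * (sin t * sin t + cos t * cos t)) +
    r * (r * sin t * (j11 j x z * (sin t * sin t + cos t * cos t))) +
    r * (r * sin t * (j22 j x z * (sin t * sin t + cos t * cos t)))); [unfold x, z; ring|].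
  rewrite S. unfold x. ring.
Qed.

(** [d_r] and [d_t / r] form a rotated orthonormal frame, so the scalar products of gradients on the
    right also acquire exactly the factor [r]. *)
Lemma polar_solves z0 F f g r t :
  solves cart_weights F f g (r * sin t) (z0 + r * cos t) ->
  solves polar_weights (polar_fields z0 F) (polar_jet z0 f) (polar_jet z0 g) r t.
Proof.
  intros [H1 H2]. unfold solves. rewrite !polar_wdiv.
  change (fX (polar_fields z0 F) r t) with (fX F (r * sin t) (z0 + r * cos t)).
  rewrite <- !Rmult_assoc, !(Rmult_comm (fX F (r * sin t) (z0 + r * cos t)) r), !Rmult_assoc, H1, H2.
  unfold fX1, fX2, fT1, fT2; simpl. unfold polar_d1, polar_d2, polar_fun.
  pose proof (sin2_cos2 t) as S. unfold Rsqr in S.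
  set (x := r * sin t). set (z := z0 + r * cos t).
  set (X1 := j1 (ja F) x z + 2 * (j0 (jc F) x z * j1 (jc F) x z + j0 (jd F) x z * j1 (jd F) x z)).
  set (X2 := j2 (ja F) x z + 2 * (j0 (jc F) x z * j2 (jc F) x z + j0 (jd F) x z * j2 (jd F) x z)).
  set (T1 := j1 (jb F) x z + 2 * (j0 (jc F) x z * j1 (jd F) x z - j0 (jd F) x z * j1 (jc F) x z)).
  set (T2 := j2 (jb F) x z + 2 * (j0 (jc F) x z * j2 (jd F) x z - j0 (jd F) x z * j2 (jc F) x z)).
  split.
  - transitivity (r * (x * (j1 f x z * X1 * 1 - j1 g x z * T1 * 1) + x * (j2 f x z * X2 * 1 - j2 g x z * T2 * 1)));
      [ring|]. rewrite <- S. unfold X1, X2, T1, T2, x. ring.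
  - transitivity (r * (x * (j1 f x z * T1 * 1 + j1 g x z * X1 * 1) + x * (j2 f x z * T2 * 1 + j2 g x z * X2 * 1)));
      [ring|]. rewrite <- S. unfold X1, X2, T1, T2, x. ring.
Qed.

Lemma polar_ernst z0 F r t : ernst_at cart_weights F (r * sin t) (z0 + r * cos t) ->
  ernst_at polar_weights (polar_fields z0 F) r t.
Proof.
  intros (H1 & H2 & H3). split; [exact H1|]. split; apply polar_solves; assumption.
Qed.

Lemma polar_fields_on z0 D F : open2 D -> fields_on D F ->
  fields_on (polar_dom z0 D) (polar_fields z0 F).
Proof.
  intros HD (A & B & C & E). exact (conj (jet_on_polar _ _ _ HD A) (conj (jet_on_polar _ _ _ HD B)
    (conj (jet_on_polar _ _ _ HD C) (jet_on_polar _ _ _ HD E)))).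
Qed.

(** * Charges at infinity *)

Lemma is_derive_minus_R (f g : R -> R) x l m : is_derive f x l -> is_derive g x m ->
  is_derive (fun s => f s - g s) x (l - m).
Proof. exact (@is_derive_minus R_AbsRing R_NormedModule f g x l m). Qed.

Lemma is_derive_plus_R (f g : R -> R) x l m : is_derive f x l -> is_derive g x m ->
  is_derive (fun s => f s + g s) x (l + m).
Proof. exact (@is_derive_plus R_AbsRing R_NormedModule f g x l m). Qed.

Lemma is_derive_opp_R (f : R -> R) x l : is_derive f x l -> is_derive (fun s => - f s) x (- l).
Proof. exact (@is_derive_opp R_AbsRing R_NormedModule f x l). Qed.

Lemma deriv_le (f g f' g' : R -> R) a b : a <= b ->
  (forall x, a <= x <= b -> is_derive f x (f' x)) ->
  (forall x, a <= x <= b -> is_derive g x (g' x)) ->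
  (forall x, a <= x <= b -> f' x <= g' x) -> f b - f a <= g b - g a.
Proof.
  intros Hab Hf Hg Hle.
  destruct (MVT_gen (fun x => g x - f x) a b (fun x => g' x - f' x)) as (c & Hc & E).
  - intros x Hx. rewrite Rmin_left, Rmax_right in Hx by lra.
    apply is_derive_minus_R; [apply Hg|apply Hf]; lra.
  - intros x Hx. rewrite Rmin_left, Rmax_right in Hx by lra. apply continuity_pt_filterlim.
    apply (ex_derive_continuous (fun x => g x - f x) x). exists (g' x - f' x).
    apply is_derive_minus_R; [apply Hg|apply Hf]; lra.
  - rewrite Rmin_left, Rmax_right in Hc by lra. specialize (Hle c Hc).
    assert (0 <= (g' c - f' c) * (b - a)) by (apply Rmult_le_pos; lra). lra.
Qed.

Lemma is_derive_inv_R k x : x <> 0 -> is_derive (fun x => - (k / x)) x (k / (x * x)).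
Proof. intros H. auto_derive; [exact H|field; exact H]. Qed.

(** A nonnegative [y = O(r^-2)] with [m = r^2 y'] nondecreasing: were [m] positive
    somewhere, [y] could not tend to zero. *)
Lemma energy_ode (y m dm : R -> R) (R1 C : R) : 0 < R1 -> 0 <= C ->
  (forall r, R1 < r -> is_derive y r (m r / (r * r)) /\ is_derive m r (dm r) /\ 0 <= dm r /\
     0 <= y r <= C / (r * r)) ->
  forall r, 2 * R1 < r -> m r <= 0 /\ - m r <= 4 * C / r.
Proof.
  intros HR HC H.
  assert (Mono : forall r s, R1 < r -> r <= s -> m r <= m s).
  { intros r s Hr Hs.
    assert (0 - 0 <= m s - m r); [|lra].
    apply (deriv_le (fun _ => 0) m (fun _ => 0) dm r s Hs).
    - intros; apply is_derive_const_R.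
    - intros x Hx; apply H; lra.
    - intros x Hx; apply H; lra. }
  assert (Neg : forall r, R1 < r -> m r <= 0).
  { intros r Hr. apply Rnot_lt_le. intros Hm.
    (* From [r] to any [s >= 2 * r] the function [y] grows by at least [m r / (2 * r)]; the second
       entry makes [s] so large that [C / (s * s)] lies below this. *)
    set (s := Rmax (2 * r) (4 * C / m r + 1)).
    assert (S1 : 2 * r <= s) by apply Rmax_l. assert (S2 : 4 * C / m r + 1 <= s) by apply Rmax_r.
    assert (Hd : - (m r / s) - - (m r / r) <= y s - y r).
    { apply (deriv_le (fun x => - (m r / x)) y (fun x => m r / (x * x)) (fun x => m x / (x * x)) r s); [lra| | |].
      - intros x Hx. apply is_derive_inv_R. lra.
      - intros x Hx; apply H; lra.
      - intros x Hx. apply Rmult_le_compat_r; [|apply Mono; lra].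
        left; apply Rinv_0_lt_compat, Rmult_lt_0_compat; lra. }
    destruct (H s) as (_ & _ & _ & [_ Ys]); [lra|]. destruct (H r Hr) as (_ & _ & _ & [Yr _]).
    assert (Q1 : m r / s <= m r / (2 * r)).
    { apply Rmult_le_compat_l; [lra|]. apply Rinv_le_contravar; lra. }
    assert (Q2 : m r / (2 * r) = m r / r / 2) by (field; lra).
    assert (Q3 : 2 * r * (C / (s * s)) < m r / 1).
    { assert (C / (s * s) * s * s = C) by (field; lra).
      assert (0 <= C / (s * s)) by (apply Rdiv_le_0_compat; [lra|apply Rmult_lt_0_compat; lra]).
      assert (4 * C < m r * s).
      { apply Rlt_le_trans with (m r * (4 * C / m r + 1)); [|apply Rmult_le_compat_l; lra].
        replace (m r * (4 * C / m r + 1)) with (4 * C + m r) by (field; lra). lra. }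
      assert (2 * r * (C / (s * s)) <= s * (C / (s * s))) by (apply Rmult_le_compat_r; lra).
      apply Rmult_lt_reg_r with s; [lra|]. nra. }
    assert (Q4 : C / (s * s) < m r / r / 2).
    { apply Rmult_lt_reg_l with (2 * r); [lra|]. replace (2 * r * (m r / r / 2)) with (m r / 1) by (field; lra).
      exact Q3. }
    lra. }
  intros r Hr. split; [apply Neg; lra|].
  (* On [[r / 2, r]] the slope is at most [m r / (x * x)], so [y r - y (r / 2) <= m r / r]; the
     upper bound on [y (r / 2)] then limits how negative [m r] can be. *)
  assert (Hd : y r - y (r / 2) <= - (m r / r) - - (m r / (r / 2))).
  { apply (deriv_le y (fun x => - (m r / x)) (fun x => m x / (x * x)) (fun x => m r / (x * x))); [lra| | |].
    - intros x Hx; apply H; lra.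
    - intros x Hx. apply is_derive_inv_R. lra.
    - intros x Hx. apply Rmult_le_compat_r; [|apply Mono; lra].
      left; apply Rinv_0_lt_compat, Rmult_lt_0_compat; lra. }
  destruct (H (r / 2)) as (_ & _ & _ & [_ Y2]); [lra|]. destruct (H r) as (_ & _ & _ & [Y1 _]); [lra|].
  replace (C / (r / 2 * (r / 2))) with (4 * C / r / r) in Y2 by (field; lra).
  replace (- (m r / r) - - (m r / (r / 2))) with (m r / r) in Hd by (field; lra).
  assert (Q : - (m r / r) <= 4 * C / r / r) by lra.
  replace (- (m r / r)) with (- m r / r) in Q by (field; lra).
  apply (Rmult_le_reg_r (/ r)); [apply Rinv_0_lt_compat; lra|]. exact Q.
Qed.

(** The flux [Phi r] equals [r^2 A'] with [A = const + 2 T / r + O(r^-2)], up to an error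
    that is small in the mean; [m] is the radial flux of the energy. *)
Definition has_charge (Phi : R -> R) (T : R) : Prop :=
  exists (K R1 A0 : R) (A A' m dm : R -> R), 0 < K /\ 0 < R1 /\ forall r, R1 < r ->
    is_derive A r (A' r) /\ Rabs (A r - A0 - 2 * T / r) <= K / (r * r) /\
    is_derive m r (dm r) /\ 0 <= dm r /\ m r <= 0 /\ - m r <= K / r /\
    forall s, 0 < s -> Rabs (Phi r - r * r * A' r) <= K * (/ s + s * dm r).

(** Over [[S, 2 * S]] the difference [A1 - A2] changes by [- (T1 - T2) / S] up to [O(S^-2)],
    according to its expansion. Its derivative is an error term, which integrates to [O(S^-2)] as
    well, so [Rabs (T1 - T2) * S] stays bounded. *)
Lemma charge_unique Phi1 Phi2 T1 T2 R0 : has_charge Phi1 T1 -> has_charge Phi2 T2 ->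
  (forall r, R0 < r -> Phi1 r = Phi2 r) -> T1 = T2.
Proof.
  intros (K1 & S1 & B1 & A1 & A1' & m1 & dm1 & P1 & Q1 & H1)
    (K2 & S2 & B2 & A2 & A2' & m2 & dm2 & P2 & Q2 & H2) HE.
  set (K := K1 + K2).
  assert (Main : forall S, Rabs R0 + S1 + S2 + 1 < S -> Rabs (T1 - T2) * S <= (2 * K * (1 + 2 * K) + 2 * K)).
  { intros S HS. pose proof (Rle_abs R0). pose proof (Rabs_pos R0).
    set (D := fun r => A1 r - A2 r).
    assert (PS : 0 < / S) by (apply Rinv_0_lt_compat; lra).
    assert (HD : forall r, S <= r -> is_derive D r (A1' r - A2' r) /\
      Rabs (A1' r - A2' r) <= K * (/ S + S * (dm1 r + dm2 r)) * (/ S * / S)).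
    { intros r Hr. destruct (H1 r) as (D1 & _ & _ & E1 & _ & _ & F1); [lra|].
      destruct (H2 r) as (D2 & _ & _ & E2 & _ & _ & F2); [lra|].
      split; [apply is_derive_minus_R; assumption|].
      (* The free parameter [s] is set to [S]: over an interval of length [S], both [/ s] and
         [s * dm] then contribute a bounded amount, since [m] is [O(/ S)]. *)
      specialize (F1 S ltac:(lra)). specialize (F2 S ltac:(lra)). rewrite <- (HE r) in F2 by lra.
      assert (F : Rabs (r * r * (A1' r - A2' r)) <= K * (/ S + S * (dm1 r + dm2 r))).
      { unfold K. apply Rabs_le_between in F1, F2. apply Rabs_le_between.
        assert (0 <= K1 * (S * dm2 r)) by (apply Rmult_le_pos; [lra|apply Rmult_le_pos; lra]).
        assert (0 <= K2 * (S * dm1 r)) by (apply Rmult_le_pos; [lra|apply Rmult_le_pos; lra]).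
        nra. }
      assert (Prr : 0 < r * r) by (apply Rmult_lt_0_compat; lra).
      rewrite Rabs_mult, (Rabs_pos_eq (r * r)) in F by lra.
      assert (Hrr : S * S <= r * r) by (apply Rmult_le_compat; lra).
      assert (F' : S * S * Rabs (A1' r - A2' r) <= K * (/ S + S * (dm1 r + dm2 r))).
      { apply Rle_trans with (2 := F). apply Rmult_le_compat_r; [apply Rabs_pos|exact Hrr]. }
      apply Rmult_le_compat_r with (r := / S * / S) in F'; [|apply Rmult_le_pos; lra].
      replace (S * S * Rabs (A1' r - A2' r) * (/ S * / S)) with (Rabs (A1' r - A2' r)) in F' by (field; lra).
      exact F'. }
    (* An antiderivative of the bound on [A1' - A2']; comparing derivatives replaces an integral of
       [dm1] and [dm2], which are not assumed continuous. *)
    set (h := fun r => K * (/ S * / S * / S) * r + K * (S * (/ S * / S)) * (m1 r + m2 r)).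
    set (h' := fun r => K * (/ S * / S * / S) * 1 + K * (S * (/ S * / S)) * (dm1 r + dm2 r)).
    assert (Hh : forall r, S <= r -> is_derive h r (h' r)).
    { intros r Hr. destruct (H1 r) as (_ & _ & D1 & _); [lra|]. destruct (H2 r) as (_ & _ & D2 & _); [lra|].
      apply is_derive_lin; [apply (@is_derive_id R_AbsRing)|].
      apply is_derive_plus_R; assumption. }
    assert (Hh' : forall r, S <= r -> Rabs (A1' r - A2' r) <= h' r).
    { intros r Hr. destruct (HD r Hr) as [_ B]. apply Rle_trans with (1 := B). unfold h'. apply Req_le. ring. }
    assert (Up : D (2 * S) - D S <= h (2 * S) - h S).
    { apply (deriv_le D h (fun r => A1' r - A2' r) h'); [lra| | |].
      - intros x Hx; apply HD; lra.
      - intros x Hx; apply Hh; lra.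
      - intros x Hx. apply Rle_trans with (1 := Rle_abs _). apply Hh'; lra. }
    assert (Lo : - D (2 * S) - - D S <= h (2 * S) - h S).
    { apply (deriv_le (fun x => - D x) h (fun r => - (A1' r - A2' r)) h'); [lra| | |].
      - intros x Hx. apply is_derive_opp_R. apply HD; lra.
      - intros x Hx; apply Hh; lra.
      - intros x Hx. apply Rle_trans with (1 := Rle_abs _). rewrite Rabs_Ropp. apply Hh'; lra. }
    destruct (H1 S) as (_ & Z1 & _ & _ & _ & M1 & _); [lra|].
    destruct (H2 S) as (_ & Z2 & _ & _ & _ & M2 & _); [lra|].
    destruct (H1 (2 * S)) as (_ & Z3 & _ & _ & M3 & _); [lra|].
    destruct (H2 (2 * S)) as (_ & Z4 & _ & _ & M4 & _); [lra|].
    assert (Hb : h (2 * S) - h S <= K * (/ S * / S) * (1 + K)).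
    { unfold h.
      replace (K * (/ S * / S * / S) * (2 * S) + K * (S * (/ S * / S)) * (m1 (2 * S) + m2 (2 * S)) -
        (K * (/ S * / S * / S) * S + K * (S * (/ S * / S)) * (m1 S + m2 S))) with
        (K * (/ S * / S) * (1 + S * (m1 (2 * S) + m2 (2 * S) - m1 S - m2 S))) by (field; lra).
      apply Rmult_le_compat_l; [unfold K; apply Rmult_le_pos; [lra|apply Rmult_le_pos; lra]|].
      apply Rplus_le_compat_l. apply (Rmult_le_reg_l (/ S)); [exact PS|].
      rewrite <- Rmult_assoc, Rinv_l, Rmult_1_l by lra. unfold K, Rdiv in *. lra. }
    replace (2 * T1 / (2 * S)) with (T1 * / S) in Z3 by (field; lra).
    replace (2 * T2 / (2 * S)) with (T2 * / S) in Z4 by (field; lra).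
    replace (2 * T1 / S) with (2 * (T1 * / S)) in Z1 by (field; lra).
    replace (2 * T2 / S) with (2 * (T2 * / S)) in Z2 by (field; lra).
    assert (QQ : forall k, 0 < k -> k / (2 * S * (2 * S)) <= k * (/ S * / S)).
    { intros k Hk. replace (k / (2 * S * (2 * S))) with (k * (/ S * / S) / 4) by (field; lra).
      assert (0 <= k * (/ S * / S)) by (apply Rmult_le_pos; [lra|apply Rmult_le_pos; lra]). lra. }
    pose proof (QQ K1 P1). pose proof (QQ K2 P2).
    replace (K1 / (S * S)) with (K1 * (/ S * / S)) in Z1 by (field; lra).
    replace (K2 / (S * S)) with (K2 * (/ S * / S)) in Z2 by (field; lra).
    apply Rabs_le_between in Z1, Z2, Z3, Z4.
    assert (Fin : Rabs ((T1 - T2) * / S) <= K * (/ S * / S) * (1 + K) + 2 * K * (/ S * / S)).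
    { unfold D in Up, Lo. unfold K in *. apply Rabs_le_between. split; lra. }
    rewrite Rabs_mult, (Rabs_pos_eq (/ S)) in Fin by lra.
    assert (PK : 0 < K) by (unfold K; lra).
    apply Rmult_le_compat_r with (r := S * S) in Fin; [|apply Rmult_le_pos; lra].
    replace (Rabs (T1 - T2) * / S * (S * S)) with (Rabs (T1 - T2) * S) in Fin by (field; lra).
    replace ((K * (/ S * / S) * (1 + K) + 2 * K * (/ S * / S)) * (S * S)) with (K * (1 + K) + 2 * K) in Fin by (field; lra).
    nra. }
  apply Rminus_diag_uniq, Rabs_eq_0. apply Rle_antisym; [|apply Rabs_pos].
  apply Rnot_lt_le. intros Hp.
  set (C := 2 * K * (1 + 2 * K) + 2 * K) in *.
  assert (PC : 0 < C) by (unfold C, K; nra).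
  set (S := Rabs R0 + S1 + S2 + 2 + C / Rabs (T1 - T2)).
  assert (0 < C / Rabs (T1 - T2)) by (apply Rdiv_lt_0_compat; assumption).
  specialize (Main S ltac:(unfold S; lra)). pose proof (Rabs_pos R0).
  assert (Rabs (T1 - T2) * (C / Rabs (T1 - T2)) = C) by (field; lra).
  assert (0 < Rabs (T1 - T2) * (Rabs R0 + S1 + S2 + 2)) by (apply Rmult_lt_0_compat; lra).
  unfold S in Main. nra.
Qed.

(** * Squares of jets and means over half circles *)

Definition jsq (f : jet) : jet :=
  Jet (fun x y => j0 f x y * j0 f x y) (fun x y => 2 * (j0 f x y * j1 f x y))
    (fun x y => 2 * (j0 f x y * j2 f x y))
    (fun x y => 2 * (j1 f x y * j1 f x y + j0 f x y * j11 f x y))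
    (fun x y => 2 * (j2 f x y * j1 f x y + j0 f x y * j12 f x y))
    (fun x y => 2 * (j1 f x y * j2 f x y + j0 f x y * j21 f x y))
    (fun x y => 2 * (j2 f x y * j2 f x y + j0 f x y * j22 f x y)).

Lemma is_derive_mult_R k (f g : R -> R) x l m : is_derive f x l -> is_derive g x m ->
  is_derive (fun s => k * (f s * g s)) x (k * (l * g x + f x * m)).
Proof.
  intros Hf Hg. auto_derive.
  - derive_side.
  - derive_values. ring.
Qed.

Lemma grad_on_mult D k f f1 f2 g g1 g2 : open2 D -> grad_on D f f1 f2 -> grad_on D g g1 g2 ->
  grad_on D (fun x y => k * (f x y * g x y)) (fun x y => k * (f1 x y * g x y + f x y * g1 x y))
    (fun x y => k * (f2 x y * g x y + f x y * g2 x y)).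
Proof.
  intros HD Hf Hg x y H. destruct (grad_on_cont_all D f f1 f2 x y HD Hf H) as (? & ? & ?).
  destruct (grad_on_cont_all D g g1 g2 x y HD Hg H) as (? & ? & ?).
  destruct (Hf x y H) as (A1 & A2 & _). destruct (Hg x y H) as (B1 & B2 & _).
  split; [|split; [|split]].
  - exact (is_derive_mult_R k (fun s => f s y) (fun s => g s y) x _ _ A1 B1).
  - exact (is_derive_mult_R k (fun s => f x s) (fun s => g x s) y _ _ A2 B2).
  - cont2_auto.
  - cont2_auto.
Qed.

Lemma grad_on_ext D f f1 f2 g g1 g2 : grad_on D f f1 f2 -> (forall x y, f x y = g x y) ->
  (forall x y, f1 x y = g1 x y) -> (forall x y, f2 x y = g2 x y) -> grad_on D g g1 g2.
Proof.
  intros H E0 E1 E2 x y Hxy. destruct (H x y Hxy) as (A1 & A2 & A3 & A4).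
  split; [|split; [|split]].
  - rewrite <- E1. apply is_derive_ext with (2 := A1). intros; apply E0.
  - rewrite <- E2. apply is_derive_ext with (2 := A2). intros; apply E0.
  - apply continuity_2d_pt_ext with (2 := A3). exact E1.
  - apply continuity_2d_pt_ext with (2 := A4). exact E2.
Qed.

Lemma jet_on_sq D f : open2 D -> jet_on D f -> jet_on D (jsq f).
Proof.
  intros HD (A0 & A1 & A2). split; [|split].
  - apply (grad_on_ext _ _ _ _ _ _ _ (grad_on_mult D 1 _ _ _ _ _ _ HD A0 A0)); intros; simpl; ring.
  - apply (grad_on_ext _ _ _ _ _ _ _ (grad_on_mult D 2 _ _ _ _ _ _ HD A0 A1)); intros; simpl; ring.
  - apply (grad_on_ext _ _ _ _ _ _ _ (grad_on_mult D 2 _ _ _ _ _ _ HD A0 A2)); intros; simpl; ring.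
Qed.

Definition far (R0 : R) : R -> R -> Prop := fun r _ => R0 < r.

Lemma far_open R0 : open2 (far R0).
Proof.
  intros r t H. unfold far in *. assert (P : 0 < r - R0) by lra. exists (mkposreal _ P).
  simpl. intros u v Hu _. apply Rabs_lt_between in Hu. lra.
Qed.

Lemma ex_RInt_far (f : R -> R -> R) r : (forall t, cont2 f r t) -> ex_RInt (fun t => f r t) 0 PI.
Proof.
  intros H. apply (@ex_RInt_continuous R_CompleteNormedModule). intros t _.
  apply cont2_continuous_r, H.
Qed.

Lemma is_derive_mean R0 (g gx : R -> R -> R) r :
  (forall r t, R0 < r -> is_derive (fun s => g s t) r (gx r t) /\ cont2 gx r t /\ cont2 g r t) ->
  R0 < r -> is_derive (fun r => RInt (fun t => g r t) 0 PI) r (RInt (fun t => gx r t) 0 PI).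
Proof.
  intros H Hr.
  assert (P : 0 < r - R0) by lra.
  replace (RInt (fun t => gx r t) 0 PI) with (RInt (fun t => Derive (fun u => g u t) r) 0 PI).
  2:{ apply RInt_ext. intros t _. apply is_derive_unique. apply H, Hr. }
  apply is_derive_RInt_param.
  - exists (mkposreal _ P). intros u Hu t _. change (Rabs (u - r) < r - R0) in Hu.
    apply Rabs_lt_between in Hu. exists (gx u t). apply H. lra.
  - intros t _. apply continuity_2d_pt_ext_loc with gx; [|apply H, Hr].
    exists (mkposreal _ P). simpl. intros u v Hu _. apply Rabs_lt_between in Hu. symmetry.
    apply is_derive_unique. apply H. lra.
  - exists (mkposreal _ P). intros u Hu. change (Rabs (u - r) < r - R0) in Hu.
    apply Rabs_lt_between in Hu. apply ex_RInt_far. intros t. apply H. lra.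
Qed.

Lemma RInt_abs_le (f g : R -> R) a b : a <= b -> ex_RInt f a b -> ex_RInt g a b ->
  (forall t, a < t < b -> Rabs (f t) <= g t) -> Rabs (RInt f a b) <= RInt g a b.
Proof.
  intros Hab Hf Hg H. apply Rabs_le_between. split.
  - assert (E : RInt (fun t => - g t) a b = - RInt g a b).
    { apply (@RInt_opp R_CompleteNormedModule). exact Hg. }
    rewrite <- E. apply RInt_le; [exact Hab| |exact Hf|].
    + apply (@ex_RInt_opp R_NormedModule). exact Hg.
    + intros t Ht. specialize (H t Ht). apply Rabs_le_between in H. lra.
  - apply RInt_le; [exact Hab|exact Hf|exact Hg|].
    intros t Ht. specialize (H t Ht). apply Rabs_le_between in H. lra.
Qed.

Lemma RInt_sin_0_PI : is_RInt sin 0 PI 2.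
Proof.
  replace 2 with (- cos PI - - cos 0) by (rewrite cos_PI, cos_0; ring).
  apply (is_RInt_derive (fun t => - cos t) sin).
  - intros t _. auto_derive; [auto|ring].
  - intros t _. apply continuity_pt_filterlim, continuity_sin.
Qed.

Section FarJet.
Context (R0 : R) (HR0 : 0 < R0) (f : jet) (Hf : jet_on (far R0) f).

Local Lemma fcont r t : R0 < r ->
  cont2 (j0 f) r t /\ cont2 (j1 f) r t /\ cont2 (j2 f) r t /\ cont2 (j11 f) r t /\ cont2 (j22 f) r t.
Proof. exact (jet_cont (far R0) f r t (far_open R0) Hf). Qed.

Lemma mean_derive r : R0 < r ->
  is_derive (fun r => RInt (fun t => j0 f r t * sin t) 0 PI) r (RInt (fun t => j1 f r t * sin t) 0 PI).
Proof.
  intros Hr. apply (is_derive_mean R0 (fun r t => j0 f r t * sin t) (fun r t => j1 f r t * sin t)); [|exact Hr].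
  clear r Hr. intros r t Hr. destruct (fcont r t Hr) as (? & ? & ? & ? & ?).
  split; [|split; cont2_auto].
  apply is_derive_ext with (fun s => sin t * j0 f s t); [intros; req; ring|].
  replace (j1 f r t * sin t) with (sin t * j1 f r t) by ring. apply is_derive_scal.
  destruct Hf as (A & _). destruct (A r t Hr) as (D & _). exact D.
Qed.

Lemma mean_scal r : R0 < r ->
  RInt (fun t => r * r * sin t * j1 f r t) 0 PI = r * r * RInt (fun t => j1 f r t * sin t) 0 PI.
Proof.
  intros Hr. transitivity (RInt (fun t => r * r * (j1 f r t * sin t)) 0 PI).
  { apply RInt_ext. intros t _. req. ring. }
  apply (@RInt_scal R_CompleteNormedModule (fun t => j1 f r t * sin t) 0 PI (r * r)).
  apply (ex_RInt_far (fun r t => j1 f r t * sin t)). intros t.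
  destruct (fcont r t Hr) as (? & ? & ? & ? & ?). cont2_auto.
Qed.

(** The angular part of the divergence integrates to zero because [sin] vanishes on the axis. *)
Lemma mean_div r : R0 < r ->
  is_derive (fun r => RInt (fun t => r * r * sin t * j1 f r t) 0 PI) r
    (RInt (fun t => wdiv polar_weights f r t) 0 PI).
Proof.
  intros Hr.
  set (gx := fun r t => 2 * r * sin t * j1 f r t + r * r * sin t * j11 f r t).
  set (gt := fun r t => cos t * j2 f r t + sin t * j22 f r t).
  assert (Cx : forall r t, R0 < r -> cont2 gx r t /\ cont2 gt r t /\ cont2 (fun r t => r * r * sin t * j1 f r t) r t).
  { clear r Hr. intros r t Hr. destruct (fcont r t Hr) as (? & ? & ? & ? & ?).
    unfold gx, gt. split; [|split]; cont2_auto. }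
  assert (E0 : RInt (fun t => gt r t) 0 PI = 0).
  { apply is_RInt_unique. replace 0 with (sin PI * j2 f r PI - sin 0 * j2 f r 0) at 2
      by (rewrite sin_PI, sin_0; ring).
    apply (is_RInt_derive (fun t => sin t * j2 f r t) (fun t => gt r t)).
    - intros t _. destruct Hf as (_ & _ & A). destruct (A r t Hr) as (_ & D & _).
      apply is_derive_ext with (fun s => 1 * (sin s * j2 f r s)); [intros; req; ring|].
      replace (gt r t) with (1 * (cos t * j2 f r t + sin t * j22 f r t)) by (unfold gt; ring).
      apply (is_derive_mult_R 1 sin (fun s => j2 f r s)); [apply is_derive_sin_R|exact D].
    - intros t _. apply cont2_continuous_r, Cx, Hr. }
  assert (E : RInt (fun t => wdiv polar_weights f r t) 0 PI = RInt (fun t => gx r t) 0 PI).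
  { transitivity (RInt (fun t => gx r t) 0 PI + RInt (fun t => gt r t) 0 PI); [|rewrite E0; req; ring].
    transitivity (RInt (fun t => gx r t + gt r t) 0 PI); [reflexivity|].
    apply (@RInt_plus R_CompleteNormedModule); apply ex_RInt_far; intros t; apply Cx, Hr. }
  rewrite E.
  apply (is_derive_mean R0 (fun r t => r * r * sin t * j1 f r t) gx); [|exact Hr].
  clear r Hr E0 E. intros r t Hr. split; [|split; apply Cx, Hr].
  destruct Hf as (_ & A & _). destruct (A r t Hr) as (D & _).
  apply is_derive_ext with (fun s => sin t * ((s * s) * j1 f s t)); [intros; req; ring|].
  replace (gx r t) with (sin t * ((2 * r) * j1 f r t + (r * r) * j11 f r t)) by (unfold gx; ring).
  apply (is_derive_mult_R (sin t) (fun s => s * s) (fun s => j1 f s t)); [|exact D].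
  auto_derive; [auto|ring].
Qed.
End FarJet.

(** * Expansions in powers of [1 / r], uniform in the angle *)

Definition appr (f : R -> R -> R) (k : R) : Prop :=
  exists K R1, 0 <= K /\ 1 <= R1 /\ forall r t, R1 < r -> Rabs (f r t - k) <= K / r.

(** The condition [1 <= R1] lets an error [O(r^-2)] be absorbed into [O(r^-1)], which is how
    products and [appr2_appr] are handled. *)
Definition appr2 (f : R -> R -> R) (k l : R) : Prop :=
  exists K R1, 0 <= K /\ 1 <= R1 /\ forall r t, R1 < r -> Rabs (f r t - k - l / r) <= K / (r * r).

Lemma div_r2_le K r : 0 <= K -> 1 < r -> K / (r * r) <= K / r.
Proof.
  intros HK Hr. apply Rmult_le_compat_l; [exact HK|]. apply Rinv_le_contravar; nra.
Qed.

Lemma appr2_appr f k l : appr2 f k l -> appr f k.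
Proof.
  intros (K & R1 & HK & HR & H). exists (K + Rabs l), R1. pose proof (Rabs_pos l).
  split; [lra|split; [exact HR|]]. intros r t Hr. specialize (H r t Hr).
  pose proof (div_r2_le K r HK ltac:(lra)).
  replace (f r t - k) with ((f r t - k - l / r) + l / r) by ring.
  apply Rle_trans with (1 := Rabs_triang _ _).
  unfold Rdiv in *. rewrite Rabs_mult, (Rabs_pos_eq (/ r)) by (left; apply Rinv_0_lt_compat; lra). lra.
Qed.

Lemma appr_ext f g k l : appr f k -> (forall r t, f r t = g r t) -> k = l -> appr g l.
Proof.
  intros (K & R1 & HK & HR & H) E <-. exists K, R1. split; [exact HK|split; [exact HR|]].
  intros r t Hr. rewrite <- E. apply H, Hr.
Qed.

Lemma appr_lin p f k q g l : appr f k -> appr g l ->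
  appr (fun r t => p * f r t + q * g r t) (p * k + q * l).
Proof.
  intros (K & R1 & HK & HR & H) (K' & R1' & HK' & HR' & H').
  exists (Rabs p * K + Rabs q * K'), (R1 + R1').
  pose proof (Rabs_pos p). pose proof (Rabs_pos q).
  split; [apply Rplus_le_le_0_compat; apply Rmult_le_pos; assumption|split; [lra|]].
  intros r t Hr. specialize (H r t ltac:(lra)). specialize (H' r t ltac:(lra)).
  replace (p * f r t + q * g r t - (p * k + q * l)) with (p * (f r t - k) + q * (g r t - l)) by ring.
  apply Rle_trans with (1 := Rabs_triang _ _). rewrite !Rabs_mult.
  replace ((Rabs p * K + Rabs q * K') / r) with (Rabs p * (K / r) + Rabs q * (K' / r)) by (unfold Rdiv; ring).
  apply Rplus_le_compat; apply Rmult_le_compat_l; assumption.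
Qed.

Lemma appr_mult f k g l : appr f k -> appr g l -> appr (fun r t => f r t * g r t) (k * l).
Proof.
  intros (K & R1 & HK & HR & H) (K' & R1' & HK' & HR' & H').
  exists (K * (Rabs l + K') + Rabs k * K'), (R1 + R1').
  pose proof (Rabs_pos k). pose proof (Rabs_pos l).
  split; [apply Rplus_le_le_0_compat; apply Rmult_le_pos; lra|split; [lra|]].
  intros r t Hr. specialize (H r t ltac:(lra)). specialize (H' r t ltac:(lra)).
  assert (Pi : 0 < / r) by (apply Rinv_0_lt_compat; lra).
  assert (Pi1 : / r <= 1) by (rewrite <- Rinv_1; apply Rinv_le_contravar; lra).
  replace (f r t * g r t - k * l) with ((f r t - k) * (l + (g r t - l)) + k * (g r t - l)) by ring.
  apply Rle_trans with (1 := Rabs_triang _ _). rewrite !Rabs_mult.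
  replace ((K * (Rabs l + K') + Rabs k * K') / r) with ((K / r) * (Rabs l + K') + Rabs k * (K' / r)) by (unfold Rdiv; ring).
  apply Rplus_le_compat; [|apply Rmult_le_compat_l; assumption].
  apply Rmult_le_compat; try apply Rabs_pos; [exact H|].
  apply Rle_trans with (1 := Rabs_triang _ _). apply Rplus_le_compat_l.
  apply Rle_trans with (1 := H'). unfold Rdiv. rewrite <- (Rmult_1_r K') at 2. apply Rmult_le_compat_l; assumption.
Qed.

Lemma appr_small f k e : appr f k -> 0 < e -> exists R1, 1 <= R1 /\ forall r t, R1 < r -> Rabs (f r t - k) <= e.
Proof.
  intros (K & R1 & HK & HR & H) He. exists (R1 + K / e).
  assert (0 <= K / e) by (apply Rdiv_le_0_compat; lra).
  split; [lra|]. intros r t Hr. apply Rle_trans with (1 := H r t ltac:(lra)).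
  apply (Rmult_le_reg_r r); [lra|]. replace (K / r * r) with K by (field; lra).
  assert (e * (K / e) = K) by (field; lra). nra.
Qed.

Lemma appr_inv f : appr f 1 -> appr (fun r t => / f r t) 1.
Proof.
  intros Hf. destruct (appr_small f 1 (1/2) Hf ltac:(lra)) as (R2 & HR2 & H2).
  destruct Hf as (K & R1 & HK & HR & H).
  exists (2 * K), (R1 + R2). split; [lra|split; [lra|]]. intros r t Hr.
  specialize (H r t ltac:(lra)). specialize (H2 r t ltac:(lra)). 
  assert (Hp : 1/2 <= f r t) by (apply Rabs_le_between in H2; lra).
  replace (/ f r t - 1) with (- (f r t - 1) * / f r t) by (field; lra).
  rewrite Rabs_mult, Rabs_Ropp, (Rabs_pos_eq (/ f r t)) by (left; apply Rinv_0_lt_compat; lra).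
  replace (2 * K / r) with (K / r * 2) by (unfold Rdiv; ring).
  apply Rmult_le_compat; [apply Rabs_pos|left; apply Rinv_0_lt_compat; lra|exact H|].
  replace 2 with (/ (1/2)) by field. apply Rinv_le_contravar; lra.
Qed.

Lemma appr2_lin p f k k' q g l l' : appr2 f k k' -> appr2 g l l' ->
  appr2 (fun r t => p * f r t + q * g r t) (p * k + q * l) (p * k' + q * l').
Proof.
  intros (K & R1 & HK & HR & H) (K' & R1' & HK' & HR' & H').
  exists (Rabs p * K + Rabs q * K'), (R1 + R1').
  pose proof (Rabs_pos p). pose proof (Rabs_pos q).
  split; [apply Rplus_le_le_0_compat; apply Rmult_le_pos; assumption|split; [lra|]].
  intros r t Hr. specialize (H r t ltac:(lra)). specialize (H' r t ltac:(lra)).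
  replace (p * f r t + q * g r t - (p * k + q * l) - (p * k' + q * l') / r) with
    (p * (f r t - k - k' / r) + q * (g r t - l - l' / r)) by (unfold Rdiv; ring).
  apply Rle_trans with (1 := Rabs_triang _ _). rewrite !Rabs_mult.
  replace ((Rabs p * K + Rabs q * K') / (r * r)) with (Rabs p * (K / (r * r)) + Rabs q * (K' / (r * r))) by (unfold Rdiv; ring).
  apply Rplus_le_compat; apply Rmult_le_compat_l; assumption.
Qed.

Lemma appr2_const k : appr2 (fun _ _ => k) k 0.
Proof.
  exists 0, 1. split; [lra|split; [lra|]]. intros r t Hr.
  replace (k - k - 0 / r) with 0 by (unfold Rdiv; ring). rewrite Rabs_R0. unfold Rdiv; lra.
Qed.

Lemma appr2_ext f g k l k' l' : appr2 f k k' -> (forall r t, f r t = g r t) -> k = l -> k' = l' -> appr2 g l l'.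
Proof.
  intros (K & R1 & HK & HR & H) E <- <-. exists K, R1. split; [exact HK|split; [exact HR|]].
  intros r t Hr. rewrite <- E. apply H, Hr.
Qed.

Lemma sum_sq_bound (a b c d : R) :
  (Rabs a + Rabs b + Rabs c + Rabs d) * (Rabs a + Rabs b + Rabs c + Rabs d) <= 4 * (a * a + b * b + c * c + d * d).
Proof.
  assert (E : forall x, x * x = Rabs x * Rabs x).
  { intros x. rewrite <- Rabs_mult. symmetry. apply Rabs_pos_eq. nra. }
  rewrite (E a), (E b), (E c), (E d).
  generalize (Rabs a) (Rabs b) (Rabs c) (Rabs d). intros x y z w.
  pose proof (Rle_0_sqr (x - y)). pose proof (Rle_0_sqr (x - z)). pose proof (Rle_0_sqr (x - w)).
  pose proof (Rle_0_sqr (y - z)). pose proof (Rle_0_sqr (y - w)). pose proof (Rle_0_sqr (z - w)).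
  unfold Rsqr in *. lra.
Qed.

Lemma sum_sq_pos (a b c d : R) : 0 <= a * a + b * b + c * c + d * d.
Proof.
  pose proof (Rle_0_sqr a). pose proof (Rle_0_sqr b). pose proof (Rle_0_sqr c). pose proof (Rle_0_sqr d).
  unfold Rsqr in *. lra.
Qed.

Lemma Rabs_mult_le a b x y : Rabs a <= x -> Rabs b <= y -> Rabs (a * b) <= x * y.
Proof. intros. rewrite Rabs_mult. apply Rmult_le_compat; try apply Rabs_pos; assumption. Qed.

(** The right-hand sides of the field equations are quadratic in the gradient. Each of [X] and [T]
    is at most [1 + 2 * K] times the sum of the absolute values of [a], [b], [c], [d]; the square of
    that sum costs a factor 4 by Cauchy-Schwarz, and 2 counts the two products for each pair of
    components. *)
Lemma small_nonlinear e K x y z w a b c d p q : 0 <= e -> 0 <= K ->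
  Rabs x <= e -> Rabs y <= e -> Rabs z <= e -> Rabs w <= e -> Rabs p <= K -> Rabs q <= K ->
  let X := a + 2 * (p * c + q * d) in let T := b + 2 * (p * d - q * c) in
  Rabs (x * (a * X - b * T) + y * (a * T + b * X) + (z * (c * X - d * T) + w * (c * T + d * X)))
  <= 8 * (1 + 2 * K) * e * (a * a + b * b + c * c + d * d).
Proof.
  intros He HK Hx Hy Hz Hw Hp Hq X T.
  set (S := Rabs a + Rabs b + Rabs c + Rabs d).
  pose proof (Rabs_pos a). pose proof (Rabs_pos b). pose proof (Rabs_pos c). pose proof (Rabs_pos d).
  assert (Tri : forall u v, Rabs (u - v) <= Rabs u + Rabs v).
  { intros u v. unfold Rminus. rewrite <- (Rabs_Ropp v). apply Rabs_triang. }
  assert (A2 : Rabs 2 = 2) by (apply Rabs_pos_eq; lra).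
  assert (HX : Rabs X <= (1 + 2 * K) * S).
  { unfold X. apply Rle_trans with (1 := Rabs_triang _ _). rewrite Rabs_mult, A2.
    pose proof (Rabs_triang (p * c) (q * d)).
    pose proof (Rabs_mult_le p c K _ Hp (Rle_refl _)). pose proof (Rabs_mult_le q d K _ Hq (Rle_refl _)).
    unfold S. assert (0 <= K * Rabs a) by (apply Rmult_le_pos; assumption).
    assert (0 <= K * Rabs b) by (apply Rmult_le_pos; assumption). lra. }
  assert (HT : Rabs T <= (1 + 2 * K) * S).
  { unfold T. apply Rle_trans with (1 := Rabs_triang _ _). rewrite Rabs_mult, A2.
    pose proof (Tri (p * d) (q * c)).
    pose proof (Rabs_mult_le p d K _ Hp (Rle_refl _)). pose proof (Rabs_mult_le q c K _ Hq (Rle_refl _)).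
    unfold S. assert (0 <= K * Rabs a) by (apply Rmult_le_pos; assumption).
    assert (0 <= K * Rabs b) by (apply Rmult_le_pos; assumption). lra. }
  set (Z := (1 + 2 * K) * S) in *.
  assert (HZ : 0 <= Z) by (apply Rle_trans with (2 := HX), Rabs_pos).
  assert (One : forall k u v g h, Rabs k <= e -> Rabs g <= Z -> Rabs h <= Z ->
    Rabs (k * (u * g + v * h)) <= e * ((Rabs u + Rabs v) * Z) /\
    Rabs (k * (u * g - v * h)) <= e * ((Rabs u + Rabs v) * Z)).
  { intros k u v g h Hk Hg Hh.
    pose proof (Rabs_mult_le u g _ _ (Rle_refl _) Hg). pose proof (Rabs_mult_le v h _ _ (Rle_refl _) Hh).
    split; apply Rabs_mult_le; try exact Hk.
    - apply Rle_trans with (1 := Rabs_triang _ _). lra.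
    - apply Rle_trans with (1 := Tri _ _). lra. }
  destruct (One x a b X T Hx HX HT) as [_ O1]. destruct (One y a b T X Hy HT HX) as [O2 _].
  destruct (One z c d X T Hz HX HT) as [_ O3]. destruct (One w c d T X Hw HT HX) as [O4 _].
  apply Rle_trans with (2 * e * (S * Z)).
  - apply Rle_trans with (1 := Rabs_triang _ _).
    pose proof (Rabs_triang (x * (a * X - b * T)) (y * (a * T + b * X))).
    pose proof (Rabs_triang (z * (c * X - d * T)) (w * (c * T + d * X))).
    replace (2 * e * (S * Z)) with (e * ((Rabs a + Rabs b) * Z) + e * ((Rabs a + Rabs b) * Z) +
      (e * ((Rabs c + Rabs d) * Z) + e * ((Rabs c + Rabs d) * Z))) by (unfold S; ring). lra.
  - unfold Z. pose proof (sum_sq_bound a b c d) as Q. fold S in Q.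
    replace (2 * e * (S * ((1 + 2 * K) * S))) with (2 * e * (1 + 2 * K) * (S * S)) by ring.
    replace (8 * (1 + 2 * K) * e * (a * a + b * b + c * c + d * d)) with
      (2 * e * (1 + 2 * K) * (4 * (a * a + b * b + c * c + d * d))) by ring.
    apply Rmult_le_compat_l; [|exact Q]. apply Rmult_le_pos; lra.
Qed.

(** * The energy estimate and the flux of one solution at infinity *)

Section FarFlux.
Context (R0 : R) (F : fields) (HR0 : 0 < R0) (HF : fields_on (far R0) F)
  (HE : forall r t, R0 < r -> 0 < t < PI -> ernst_at polar_weights F r t)
  (ea eb ec ed ka kb kc kd : R)
  (Aa : appr2 (j0 (ja F)) ea ka) (Ab : appr2 (j0 (jb F)) eb kb)
  (Ac : appr2 (j0 (jc F)) ec kc) (Ad : appr2 (j0 (jd F)) ed kd)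
  (HX : ea + ec * ec + ed * ed = 1).

Definition q1 r t := j1 (ja F) r t * j1 (ja F) r t + j1 (jb F) r t * j1 (jb F) r t +
  j1 (jc F) r t * j1 (jc F) r t + j1 (jd F) r t * j1 (jd F) r t.
Definition q2 r t := j2 (ja F) r t * j2 (ja F) r t + j2 (jb F) r t * j2 (jb F) r t +
  j2 (jc F) r t * j2 (jc F) r t + j2 (jd F) r t * j2 (jd F) r t.
Definition S1 r t := Rabs (j1 (ja F) r t) + Rabs (j1 (jb F) r t) + Rabs (j1 (jc F) r t) + Rabs (j1 (jd F) r t).

Lemma q1_cont r t : R0 < r -> cont2 (fun r t => r * r * sin t * q1 r t) r t.
Proof.
  intros Hr. destruct HF as (A & B & C & D).
  destruct (jet_cont _ _ r t (far_open R0) A Hr) as (_ & ? & _).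
  destruct (jet_cont _ _ r t (far_open R0) B Hr) as (_ & ? & _).
  destruct (jet_cont _ _ r t (far_open R0) C Hr) as (_ & ? & _).
  destruct (jet_cont _ _ r t (far_open R0) D Hr) as (_ & ? & _).
  unfold q1. cont2_auto.
Qed.

Definition jdiff (u : jet) (k : R) : jet := jlin 1 u (-1) (jconst k).
(** Squared Euclidean distance of the potentials from their limits at infinity. *)
Definition jdist : jet :=
  jlin 1 (jlin 1 (jsq (jdiff (ja F) ea)) 1 (jsq (jdiff (jb F) eb)))
       1 (jlin 1 (jsq (jdiff (jc F) ec)) 1 (jsq (jdiff (jd F) ed))).

Lemma appr_fX : appr (fX F) 1.
Proof.
  apply appr_ext with (fun r t => 1 * j0 (ja F) r t + 1 * (1 * (j0 (jc F) r t * j0 (jc F) r t) +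
    1 * (j0 (jd F) r t * j0 (jd F) r t))) (1 * ea + 1 * (1 * (ec * ec) + 1 * (ed * ed))).
  - apply (appr_lin 1 (j0 (ja F)) ea 1); [apply appr2_appr with ka, Aa|].
    apply (appr_lin 1 (fun r t => j0 (jc F) r t * j0 (jc F) r t) _ 1
      (fun r t => j0 (jd F) r t * j0 (jd F) r t));
      apply appr_mult; eapply appr2_appr; eassumption.
  - intros r t. unfold fX. ring.
  - lra.
Qed.

Lemma jdist_on : jet_on (far R0) jdist.
Proof.
  destruct HF as (A & B & C & D).
  assert (G : forall u k, jet_on (far R0) u -> jet_on (far R0) (jsq (jdiff u k))).
  { intros u k Hu. apply jet_on_sq; [apply far_open|]. apply jet_on_lin; [exact Hu|apply jet_on_const]. }
  unfold jdist. apply jet_on_lin; apply jet_on_lin; apply G; assumption.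
Qed.

(** The divergence is twice the energy density plus twice the product of [u - u_infinity] with
    [div (w grad u)]. By the field equations the latter is quadratic in the gradient, and its small
    prefactor far out lets the energy absorb it. *)
Lemma jdist_div : exists R1, R0 < R1 /\ forall r t, R1 < r -> 0 < t < PI ->
  r * r * sin t * q1 r t <= wdiv polar_weights jdist r t.
Proof.
  set (K := Rabs ec + Rabs ed + 1).
  pose proof (Rabs_pos ec) as Pc. pose proof (Rabs_pos ed) as Pd.
  assert (PK : 0 < K) by (unfold K; lra).
  (* Makes the constant of [small_nonlinear] equal to [1/4]. Dividing by [fX >= 1/2] turns this into
     [1/2], so half of the term [2 * P] survives and dominates the radial energy. *)
  set (e := / (32 * (1 + 2 * K))).
  assert (Pe : 0 < e) by (apply Rinv_0_lt_compat; lra).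
  assert (Pe1 : e <= 1).
  { unfold e. rewrite <- Rinv_1. apply Rinv_le_contravar; lra. }
  destruct (appr_small _ _ e (appr2_appr _ _ _ Aa) Pe) as (Ra & La & Sa).
  destruct (appr_small _ _ e (appr2_appr _ _ _ Ab) Pe) as (Rb & Lb & Sb).
  destruct (appr_small _ _ e (appr2_appr _ _ _ Ac) Pe) as (Rc & Lc & Sc).
  destruct (appr_small _ _ e (appr2_appr _ _ _ Ad) Pe) as (Rd & Ld & Sd).
  destruct (appr_small _ _ (1/2) appr_fX ltac:(lra)) as (Rx & Lx & Sx).
  exists (R0 + Ra + Rb + Rc + Rd + Rx). split; [lra|]. intros r t Hr Ht.
  specialize (Sa r t ltac:(lra)). specialize (Sb r t ltac:(lra)). specialize (Sc r t ltac:(lra)).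
  specialize (Sd r t ltac:(lra)). specialize (Sx r t ltac:(lra)).
  destruct (HE r t ltac:(lra) Ht) as (_ & [Ea Eb] & [Ec Ed]).
  assert (Ps : 0 < sin t) by (apply sin_gt_0; lra).
  assert (Pw : 0 <= r * r * sin t) by (apply Rmult_le_pos; [apply Rmult_le_pos; lra|lra]).
  assert (Bc : Rabs (j0 (jc F) r t) <= K).
  { replace (j0 (jc F) r t) with ((j0 (jc F) r t - ec) + ec) by ring.
    apply Rle_trans with (1 := Rabs_triang _ _). unfold K. lra. }
  assert (Bd : Rabs (j0 (jd F) r t) <= K).
  { replace (j0 (jd F) r t) with ((j0 (jd F) r t - ed) + ed) by ring.
    apply Rle_trans with (1 := Rabs_triang _ _). unfold K. lra. }
  set (x := j0 (ja F) r t - ea) in *. set (y := j0 (jb F) r t - eb) in *.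
  set (z := j0 (jc F) r t - ec) in *. set (w := j0 (jd F) r t - ed) in *.
  pose proof (small_nonlinear e K x y z w (j1 (ja F) r t) (j1 (jb F) r t) (j1 (jc F) r t) (j1 (jd F) r t)
    (j0 (jc F) r t) (j0 (jd F) r t) ltac:(lra) ltac:(lra) Sa Sb Sc Sd Bc Bd) as N1.
  pose proof (small_nonlinear e K x y z w (j2 (ja F) r t) (j2 (jb F) r t) (j2 (jc F) r t) (j2 (jd F) r t)
    (j0 (jc F) r t) (j0 (jd F) r t) ltac:(lra) ltac:(lra) Sa Sb Sc Sd Bc Bd) as N2.
  cbv zeta in N1, N2. fold (q1 r t) in N1. fold (q2 r t) in N2.
  fold (fX1 F r t) (fT1 F r t) in N1. fold (fX2 F r t) (fT2 F r t) in N2.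
  replace (8 * (1 + 2 * K) * e) with (1 / 4) in N1, N2 by (unfold e; field; lra).
  match type of N1 with Rabs ?n <= _ => set (n1 := n) in * end.
  match type of N2 with Rabs ?n <= _ => set (n2 := n) in * end.
  set (D := x * wdiv polar_weights (ja F) r t + y * wdiv polar_weights (jb F) r t +
    (z * wdiv polar_weights (jc F) r t + w * wdiv polar_weights (jd F) r t)).
  assert (ED : fX F r t * D = r * r * sin t * n1 + sin t * n2).
  { unfold D. transitivity (x * (fX F r t * wdiv polar_weights (ja F) r t) +
      y * (fX F r t * wdiv polar_weights (jb F) r t) + (z * (fX F r t * wdiv polar_weights (jc F) r t) +
      w * (fX F r t * wdiv polar_weights (jd F) r t))); [ring|].
    rewrite Ea, Eb, Ec, Ed. unfold n1, n2. simpl. ring. }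
  assert (EW : wdiv polar_weights jdist r t = 2 * D + 2 * (r * r * sin t * q1 r t + sin t * q2 r t)).
  { unfold D, wdiv, jdist, q1, q2, x, y, z, w; simpl. ring. }
  assert (Q2 : 0 <= q2 r t).
  { apply sum_sq_pos. }
  assert (Q1 : 0 <= q1 r t).
  { apply sum_sq_pos. }
  assert (M1 : r * r * sin t * - n1 <= r * r * sin t * (1 / 4 * q1 r t)).
  { apply Rmult_le_compat_l; [exact Pw|]. apply Rabs_le_between in N1. lra. }
  assert (M2 : sin t * - n2 <= sin t * (1 / 4 * q2 r t)).
  { apply Rmult_le_compat_l; [lra|]. apply Rabs_le_between in N2. lra. }
  apply Rabs_le_between in Sx.
  assert (P1 : 0 <= r * r * sin t * q1 r t) by (apply Rmult_le_pos; assumption).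
  assert (P2 : 0 <= sin t * q2 r t) by (apply Rmult_le_pos; lra).
  set (P := r * r * sin t * q1 r t + sin t * q2 r t) in *.
  assert (HD : - (P / 4) <= fX F r t * D) by (rewrite ED; unfold P; lra).
  assert (HD2 : - (P / 2) <= D).
  { apply Rnot_lt_le. intros Hlt. assert (HP : 0 <= P) by (unfold P; lra).
    assert (fX F r t * (- D) > 1/2 * (P / 2)); [|lra].
    apply Rlt_gt, Rlt_le_trans with (1/2 * (- D)); [lra|]. apply Rmult_le_compat_r; lra. }
  rewrite EW. fold P. assert (r * r * sin t * q1 r t <= P) by (unfold P; lra). lra.
Qed.

(** [energy_ode] is applied to the mean of [jdist] with weight [sin t], which is [O(r^-2)] because
    every potential is within [O(r^-1)] of its limit. Its radial flux [m] is nondecreasing by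
    [jdist_div]. This replaces pointwise decay of derivatives. *)
Lemma energy_bound : exists (K R1 : R) (m dm : R -> R), 0 < K /\ R0 < R1 /\ forall r, R1 < r ->
  is_derive m r (dm r) /\ RInt (fun t => r * r * sin t * q1 r t) 0 PI <= dm r /\ 0 <= dm r /\
  m r <= 0 /\ - m r <= K / r.
Proof.
  destruct jdist_div as (R1 & L1 & H1).
  assert (Gd : forall u k l, appr2 (j0 u) k l -> exists C Rc, 0 <= C /\ 1 <= Rc /\ forall r t, Rc < r ->
    0 <= j0 (jsq (jdiff u k)) r t <= C / (r * r)).
  { intros u k l Hu. destruct (appr2_appr _ _ _ Hu) as (K & Rk & HK & HRk & H).
    exists (K * K), Rk. split; [apply Rmult_le_pos; assumption|split; [exact HRk|]].
    intros r t Hr. specialize (H r t Hr). simpl.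
    replace (1 * j0 u r t + -1 * k) with (j0 u r t - k) by ring.
    replace (K * K / (r * r)) with (K / r * (K / r)) by (field; lra).
    assert (Sq : 0 <= (j0 u r t - k) * (j0 u r t - k)) by apply Rle_0_sqr.
    split; [exact Sq|]. rewrite <- (Rabs_pos_eq _ Sq).
    apply Rabs_mult_le; exact H. }
  destruct (Gd _ _ _ Aa) as (Ca & Ra' & PCa & PRa & Ga). destruct (Gd _ _ _ Ab) as (Cb & Rb & PCb & PRb & Gb).
  destruct (Gd _ _ _ Ac) as (Cc & Rc & PCc & PRc & Gc). destruct (Gd _ _ _ Ad) as (Cd & Rd & PCd & PRd & Gdd).
  set (C := Ca + Cb + Cc + Cd).
  set (R2 := R1 + Ra' + Rb + Rc + Rd).
  set (y := fun r => RInt (fun t => j0 jdist r t * sin t) 0 PI).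
  set (m := fun r => RInt (fun t => r * r * sin t * j1 jdist r t) 0 PI).
  set (dm := fun r => RInt (fun t => wdiv polar_weights jdist r t) 0 PI).
  pose proof jdist_on as HJ. pose proof PI_RGT_0 as HPI.
  assert (Cont : forall r t, R0 < r -> cont2 (wdiv polar_weights jdist) r t /\ cont2 (fun r t => r * r * sin t * q1 r t) r t /\
     cont2 (fun r t => j0 jdist r t * sin t) r t).
  { intros r t Hr. destruct (jet_cont _ _ r t (far_open R0) HJ Hr) as (? & ? & ? & ? & ?).
    destruct (polar_weights_ok r t) as (_ & _ & ? & ? & ? & ?).
    split; [unfold wdiv; cont2_auto|split; [apply q1_cont, Hr|cont2_auto]]. }
  assert (Hdm : forall r, R2 < r -> RInt (fun t => r * r * sin t * q1 r t) 0 PI <= dm r).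
  { intros r Hr. unfold R2 in Hr. unfold dm. apply RInt_le; [lra| | |].
    - apply (ex_RInt_far (fun r t => r * r * sin t * q1 r t)). intros t. apply Cont. lra.
    - apply ex_RInt_far. intros t. apply Cont. lra.
    - intros t Ht. apply H1; [lra|exact Ht]. }
  assert (Hq : forall r, R2 < r -> 0 <= RInt (fun t => r * r * sin t * q1 r t) 0 PI).
  { intros r Hr. unfold R2 in Hr. apply RInt_ge_0; [lra| |].
    - apply (ex_RInt_far (fun r t => r * r * sin t * q1 r t)). intros t. apply Cont. lra.
    - intros t Ht. apply Rmult_le_pos.
      + apply Rmult_le_pos; [nra|left; apply sin_gt_0; lra].
      + apply sum_sq_pos. }
  assert (Hode : forall r, R2 < r -> is_derive y r (m r / (r * r)) /\ is_derive m r (dm r) /\ 0 <= dm r /\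
    0 <= y r <= (2 * C) / (r * r)).
  { intros r Hr. assert (Hr0 : R0 < r) by (unfold R2 in Hr; lra).
    split; [|split; [|split]].
    - replace (m r / (r * r)) with (RInt (fun t => j1 jdist r t * sin t) 0 PI).
      + apply (mean_derive R0 jdist HJ); exact Hr0.
      + unfold m. rewrite (mean_scal R0 jdist HJ r Hr0).
        assert (E : forall u, u = r * r * u / (r * r)) by (intros; field; lra). apply E.
    - apply (mean_div R0 jdist HJ); exact Hr0.
    - apply Rle_trans with (2 := Hdm r Hr). apply Hq, Hr.
    - assert (Hb : forall t, 0 < t < PI -> 0 <= j0 jdist r t * sin t <= C / (r * r) * sin t).
      { intros t Ht. unfold R2 in Hr.
        destruct (Ga r t ltac:(lra)). destruct (Gb r t ltac:(lra)). destruct (Gc r t ltac:(lra)). destruct (Gdd r t ltac:(lra)).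
        assert (Hs : 0 < sin t) by (apply sin_gt_0; lra).
        assert (E : j0 jdist r t = j0 (jsq (jdiff (ja F) ea)) r t + j0 (jsq (jdiff (jb F) eb)) r t +
          j0 (jsq (jdiff (jc F) ec)) r t + j0 (jsq (jdiff (jd F) ed)) r t) by (simpl; ring).
        assert (E2 : C / (r * r) = Ca / (r * r) + Cb / (r * r) + Cc / (r * r) + Cd / (r * r)) by (unfold C, Rdiv; ring).
        rewrite E, E2. split; [apply Rmult_le_pos; lra|apply Rmult_le_compat_r; lra]. }
      assert (Ex : ex_RInt (fun t => j0 jdist r t * sin t) 0 PI).
      { apply (ex_RInt_far (fun r t => j0 jdist r t * sin t)). intros t. apply Cont, Hr0. }
      split.
      + apply RInt_ge_0; [lra|exact Ex|]. intros t Ht. apply Hb, Ht.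
      + assert (I : is_RInt (fun t => C / (r * r) * sin t) 0 PI (C / (r * r) * 2)).
        { apply (@is_RInt_scal R_NormedModule sin 0 PI (C / (r * r)) 2 RInt_sin_0_PI). }
        replace (2 * C / (r * r)) with (RInt (fun t => C / (r * r) * sin t) 0 PI).
        2:{ rewrite (is_RInt_unique _ _ _ _ I). req. unfold Rdiv; ring. }
        apply RInt_le; [lra|exact Ex|exists (C / (r * r) * 2); exact I|]. intros t Ht. apply Hb, Ht. }
  assert (PC : 0 <= 2 * C) by (unfold C; lra).
  assert (PR2 : 0 < R2) by (unfold R2; lra).
  (* [energy_ode] bounds [m] beyond twice its radius. The inner 2 is the integral of [sin], and
     [+ 1] makes the constant positive. *)
  exists (4 * (2 * C) + 1), (2 * R2), m, dm. split; [lra|split; [unfold R2; lra|]].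
  intros r Hr. destruct (energy_ode y m dm R2 (2 * C) PR2 PC Hode r Hr) as [M1 M2].
  destruct (Hode r ltac:(lra)) as (_ & D & P & _).
  split; [exact D|split; [apply Hdm; lra|split; [exact P|split; [exact M1|]]]].
  apply Rle_trans with (1 := M2). apply Rmult_le_compat_r; [left; apply Rinv_0_lt_compat; lra|lra].
Qed.

(** A coefficient of size [O(1/r)] times a radial gradient: the kind of error that the energy
    estimate makes negligible in the mean. *)
Definition err (e : R -> R -> R) : Prop :=
  exists K R1, 0 <= K /\ 1 <= R1 /\ forall r t, R1 < r -> Rabs (e r t) <= K / r * S1 r t.

Lemma err_lin p e q e' : err e -> err e' -> err (fun r t => p * e r t + q * e' r t).
Proof.
  intros (K & R1 & HK & HR & H) (K' & R1' & HK' & HR' & H').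
  exists (Rabs p * K + Rabs q * K'), (R1 + R1').
  pose proof (Rabs_pos p). pose proof (Rabs_pos q).
  split; [apply Rplus_le_le_0_compat; apply Rmult_le_pos; assumption|split; [lra|]].
  intros r t Hr. specialize (H r t ltac:(lra)). specialize (H' r t ltac:(lra)).
  apply Rle_trans with (1 := Rabs_triang _ _). rewrite !Rabs_mult.
  replace ((Rabs p * K + Rabs q * K') / r * S1 r t) with
    (Rabs p * (K / r * S1 r t) + Rabs q * (K' / r * S1 r t)) by (unfold Rdiv; ring).
  apply Rplus_le_compat; apply Rmult_le_compat_l; assumption.
Qed.

Definition controlled (u : R -> R -> R) : Prop :=
  exists C, 0 <= C /\ forall r t, Rabs (u r t) <= C * S1 r t.

Lemma err_mult f k u : appr f k -> controlled u -> err (fun r t => (f r t - k) * u r t).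
Proof.
  intros (K & R1 & HK & HR & H) (C & HC & Hu). exists (K * C), R1.
  split; [apply Rmult_le_pos; assumption|split; [exact HR|]]. intros r t Hr.
  replace (K * C / r * S1 r t) with (K / r * (C * S1 r t)) by (unfold Rdiv; ring).
  apply Rabs_mult_le; [apply H, Hr|apply Hu].
Qed.

Lemma controlled_lin p u q v : controlled u -> controlled v -> controlled (fun r t => p * u r t + q * v r t).
Proof.
  intros (C & HC & H) (C' & HC' & H'). exists (Rabs p * C + Rabs q * C').
  pose proof (Rabs_pos p). pose proof (Rabs_pos q).
  split; [apply Rplus_le_le_0_compat; apply Rmult_le_pos; assumption|].
  intros r t. specialize (H r t). specialize (H' r t). apply Rle_trans with (1 := Rabs_triang _ _).
  rewrite !Rabs_mult. rewrite Rmult_plus_distr_r, !Rmult_assoc.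
  apply Rplus_le_compat; apply Rmult_le_compat_l; assumption.
Qed.

Lemma controlled_components : controlled (j1 (ja F)) /\ controlled (j1 (jb F)) /\
  controlled (j1 (jc F)) /\ controlled (j1 (jd F)).
Proof.
  assert (G : forall u : R -> R -> R, (forall r t, Rabs (u r t) <= S1 r t) -> controlled u).
  { intros u H. exists 1. split; [lra|]. intros r t. rewrite Rmult_1_l. apply H. }
  repeat split; apply G; intros r t; unfold S1;
    pose proof (Rabs_pos (j1 (ja F) r t)); pose proof (Rabs_pos (j1 (jb F) r t));
    pose proof (Rabs_pos (j1 (jc F) r t)); pose proof (Rabs_pos (j1 (jd F) r t)); lra.
Qed.

(** The constants and the linear combinations of the potentials and constants are of this kind; the
    last condition bounds the radial derivative by those of the potentials. *)
Definition admissible (f : jet) (k l : R) : Prop :=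
  jet_on (far R0) f /\ appr2 (j0 f) k l /\ controlled (j1 f).

Lemma admissible_const k : admissible (jconst k) k 0.
Proof.
  split; [apply jet_on_const|split; [exact (appr2_const k)|]]. exists 0. split; [lra|].
  intros r t. simpl. rewrite Rabs_R0. lra.
Qed.

Lemma admissible_lin p f k k' q g l l' : admissible f k k' -> admissible g l l' ->
  admissible (jlin p f q g) (p * k + q * l) (p * k' + q * l').
Proof.
  intros (A1 & A2 & A3) (B1 & B2 & B3). split; [apply jet_on_lin; assumption|split].
  - exact (appr2_lin p (j0 f) k k' q (j0 g) l l' A2 B2).
  - apply (controlled_lin p (j1 f) q (j1 g)); assumption.
Qed.

Lemma admissible_components : admissible (ja F) ea ka /\ admissible (jb F) eb kb /\
  admissible (jc F) ec kc /\ admissible (jd F) ed kd.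
Proof.
  destruct controlled_components as (C1 & C2 & C3 & C4). destruct HF as (F1 & F2 & F3 & F4).
  exact (conj (conj F1 (conj Aa C1)) (conj (conj F2 (conj Ab C2)) (conj (conj F3 (conj Ac C3)) (conj F4 (conj Ad C4))))).
Qed.

(** The flux is asymptotically that of the linearised current; the part of the latter along
    [T] carries no charge because the NUT parameter [kb + 2 (ec kd - ed kc)] vanishes. *)
Lemma far_flux f1 f2 g1 g2 f10 f20 g10 g20 f11 f21 g11 g21 :
  kb + 2 * (ec * kd - ed * kc) = 0 ->
  admissible f1 f10 f11 -> admissible f2 f20 f21 -> admissible g1 g10 g11 -> admissible g2 g20 g21 ->
  has_charge (fun r => RInt (fun t => current1 polar_weights F f1 f2 g1 g2 r t) 0 PI)
    (f10 * g11 - g10 * f11 + f20 * g21 - g20 * f21).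
Proof.
  intros HNUT Hf1 Hf2 Hg1 Hg2.
  set (kap := f10 * g20 - f20 * g10).
  set (L := jlin 1 (jlin 1 (jlin f10 g1 (- g10) f1) 1 (jlin f20 g2 (- g20) f2))
     kap (jlin 1 (jb F) 2 (jlin ec (jd F) (- ed) (jc F)))).
  destruct admissible_components as (Ca & Cb & Cc & Cd).
  assert (HL : admissible L (1 * (1 * (f10 * g10 + - g10 * f10) + 1 * (f20 * g20 + - g20 * f20)) +
       kap * (1 * eb + 2 * (ec * ed + - ed * ec)))
      (1 * (1 * (f10 * g11 + - g10 * f11) + 1 * (f20 * g21 + - g20 * f21)) +
       kap * (1 * kb + 2 * (ec * kd + - ed * kc)))).
  { unfold L. repeat apply admissible_lin; assumption. }
  replace (1 * (1 * (f10 * g11 + - g10 * f11) + 1 * (f20 * g21 + - g20 * f21)) +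
       kap * (1 * kb + 2 * (ec * kd + - ed * kc))) with
    (f10 * g11 - g10 * f11 + f20 * g21 - g20 * f21) in HL.
  2:{ transitivity (f10 * g11 - g10 * f11 + f20 * g21 - g20 * f21 + kap * (kb + 2 * (ec * kd - ed * kc)));
      [rewrite HNUT; ring|ring]. }
  set (T := f10 * g11 - g10 * f11 + f20 * g21 - g20 * f21) in *.
  match type of HL with admissible _ ?k _ => set (L0 := k) in * end.
  set (iX := fun r t => / fX F r t).
  assert (AX : appr iX 1) by (apply appr_inv, appr_fX).
  assert (AC : forall u k l, admissible u k l -> appr (j0 u) k /\ appr (fun r t => j0 u r t * iX r t) k /\ controlled (j1 u)).
  { intros u k l (_ & H & C). apply appr2_appr in H. split; [exact H|split; [|exact C]].
    apply appr_ext with (fun r t => j0 u r t * iX r t) (k * 1); [apply appr_mult; assumption|reflexivity|ring]. }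
  destruct (AC _ _ _ Hf1) as (Af1 & Bf1 & Df1). destruct (AC _ _ _ Hf2) as (Af2 & Bf2 & Df2).
  destruct (AC _ _ _ Hg1) as (Ag1 & Bg1 & Dg1). destruct (AC _ _ _ Hg2) as (Ag2 & Bg2 & Dg2).
  destruct (AC _ _ _ Cb) as (_ & _ & Db). destruct (AC _ _ _ Cc) as (Acc & _ & Dc).
  destruct (AC _ _ _ Cd) as (Add & _ & Dd).
  set (M := fun r t => 1 * (j0 f1 r t * iX r t * (j0 g2 r t * iX r t)) + - (1) * (j0 f2 r t * iX r t * (j0 g1 r t * iX r t))).
  assert (AM : appr M kap).
  { apply appr_ext with M (1 * (f10 * g20) + - (1) * (f20 * g10)); [|reflexivity|unfold kap; ring].
    apply (appr_lin 1 (fun r t => j0 f1 r t * iX r t * (j0 g2 r t * iX r t)) _ (-(1))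
      (fun r t => j0 f2 r t * iX r t * (j0 g1 r t * iX r t))).
    - apply (appr_mult (fun r t => j0 f1 r t * iX r t) f10 (fun r t => j0 g2 r t * iX r t)); assumption.
    - apply (appr_mult (fun r t => j0 f2 r t * iX r t) f20 (fun r t => j0 g1 r t * iX r t)); assumption. }
  (* The error of the freezing, term by term: each is a coefficient minus its limit, times a radial
     derivative. *)
  set (e1 := fun r t => 1 * ((j0 f1 r t * iX r t - f10) * j1 g1 r t) + - (1) * ((j0 g1 r t * iX r t - g10) * j1 f1 r t)).
  set (e2 := fun r t => 1 * ((j0 f2 r t * iX r t - f20) * j1 g2 r t) + - (1) * ((j0 g2 r t * iX r t - g20) * j1 f2 r t)).
  set (e3 := fun r t => 2 * ((M r t * j0 (jc F) r t - kap * ec) * j1 (jd F) r t) +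
     - (2) * ((M r t * j0 (jd F) r t - kap * ed) * j1 (jc F) r t)).
  set (e := fun r t => 1 * (1 * e1 r t + 1 * e2 r t) + 1 * (1 * ((M r t - kap) * j1 (jb F) r t) + 1 * e3 r t)).
  assert (He : err e).
  { apply err_lin; apply err_lin.
    - apply err_lin; [apply (err_mult (fun r t => j0 f1 r t * iX r t))|apply (err_mult (fun r t => j0 g1 r t * iX r t))]; assumption.
    - apply err_lin; [apply (err_mult (fun r t => j0 f2 r t * iX r t))|apply (err_mult (fun r t => j0 g2 r t * iX r t))]; assumption.
    - apply (err_mult M); assumption.
    - apply err_lin; [apply (err_mult (fun r t => M r t * j0 (jc F) r t))|apply (err_mult (fun r t => M r t * j0 (jd F) r t))];
        try assumption; apply appr_mult; assumption. }
  destruct He as (Ke & Re & PKe & PRe & He).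
  destruct energy_bound as (Km & Rm & m & dm & PKm & PRm & Hm).
  destruct HL as (JL & (KL & RL & PKL & PRL & HLA) & _).
  destruct (appr_small _ _ (1/2) appr_fX ltac:(lra)) as (Rx & Lx & Sx).
  pose proof PI_RGT_0 as HPI.
  exists (2 * KL + Km + 2 * Ke), (R0 + Re + Rm + RL + Rx), (L0 * 2),
    (fun r => RInt (fun t => j0 L r t * sin t) 0 PI), (fun r => RInt (fun t => j1 L r t * sin t) 0 PI), m, dm.
  split; [lra|split; [lra|]]. intros r Hr.
  assert (Hr0 : R0 < r) by lra.
  destruct (Hm r ltac:(lra)) as (M1 & M2 & M3 & M4 & M5).
  assert (CL := fun t => jet_cont _ _ r t (far_open R0) JL Hr0).
  split; [apply (mean_derive R0 L JL r Hr0)|].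
  assert (Prr : 0 < r * r) by (apply Rmult_lt_0_compat; lra).
  assert (Pirr : 0 < / (r * r)) by (apply Rinv_0_lt_compat, Prr).
  split.
  { assert (I : is_RInt (fun t => (L0 + T / r) * sin t) 0 PI ((L0 + T / r) * 2))
      by (apply (@is_RInt_scal R_NormedModule sin 0 PI (L0 + T / r) 2 RInt_sin_0_PI)).
    assert (Iu : is_RInt (fun t => KL / (r * r) * sin t) 0 PI (KL / (r * r) * 2))
      by (apply (@is_RInt_scal R_NormedModule sin 0 PI (KL / (r * r)) 2 RInt_sin_0_PI)).
    assert (EL : ex_RInt (fun t => j0 L r t * sin t) 0 PI).
    { apply (ex_RInt_far (fun r t => j0 L r t * sin t)). intros t.
      destruct (CL t) as (? & ? & ? & ? & ?). cont2_auto. }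
    assert (Ed : RInt (fun t => j0 L r t * sin t - (L0 + T / r) * sin t) 0 PI =
      RInt (fun t => j0 L r t * sin t) 0 PI - (L0 + T / r) * 2).
    { rewrite <- (is_RInt_unique _ _ _ _ I). apply (@RInt_minus R_CompleteNormedModule); [exact EL|].
      eexists; exact I. }
    replace (RInt (fun t => j0 L r t * sin t) 0 PI - L0 * 2 - 2 * T / r) with
      (RInt (fun t => j0 L r t * sin t) 0 PI - (L0 + T / r) * 2) by (unfold Rdiv; ring).
    rewrite <- Ed.
    apply Rle_trans with (RInt (fun t => KL / (r * r) * sin t) 0 PI).
    - apply RInt_abs_le; [lra| |eexists; exact Iu|].
      + apply (@ex_RInt_minus R_NormedModule); [exact EL|eexists; exact I].
      + intros t Ht. assert (Hs : 0 < sin t) by (apply sin_gt_0; lra).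
        rewrite <- Rmult_minus_distr_r. rewrite Rabs_mult, (Rabs_pos_eq (sin t)) by lra.
        apply Rmult_le_compat_r; [lra|].
        replace (j0 L r t - (L0 + T / r)) with (j0 L r t - L0 - T / r) by ring. apply HLA. lra.
    - rewrite (is_RInt_unique _ _ _ _ Iu).
      assert (KL / (r * r) * 2 <= (2 * KL + Km + 2 * Ke) / (r * r)); [|assumption].
      unfold Rdiv. replace (KL * / (r * r) * 2) with (2 * KL * / (r * r)) by ring.
      apply Rmult_le_compat_r; lra. }
  split; [exact M1|split; [exact M3|split; [exact M4|split]]].
  { apply Rle_trans with (1 := M5). apply Rmult_le_compat_r; [left; apply Rinv_0_lt_compat; lra|lra]. }
  intros s Hs.
  assert (CF : forall t, cont2 (current1 polar_weights F f1 f2 g1 g2) r t).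
  { intros t. apply (current_cont polar_weights F (far R0)); try apply Hf1; try apply Hf2; try apply Hg1; try apply Hg2.
    - apply far_open. - apply polar_weights_ok. - exact HF. - exact Hr0.
    - specialize (Sx r t ltac:(lra)). apply Rabs_le_between in Sx. lra. }
  rewrite <- (mean_scal R0 L JL r Hr0).
  assert (E1 : ex_RInt (fun t => current1 polar_weights F f1 f2 g1 g2 r t) 0 PI) by (apply ex_RInt_far; exact CF).
  assert (E2 : ex_RInt (fun t => r * r * sin t * j1 L r t) 0 PI).
  { apply (ex_RInt_far (fun r t => r * r * sin t * j1 L r t)). intros t.
    destruct (CL t) as (? & ? & ? & ? & ?). cont2_auto. }
  assert (E3 : ex_RInt (fun t => r * r * sin t * q1 r t) 0 PI).
  { apply (ex_RInt_far (fun r t => r * r * sin t * q1 r t)). intros t. apply q1_cont, Hr0. }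
  assert (Edf : RInt (fun t => current1 polar_weights F f1 f2 g1 g2 r t - r * r * sin t * j1 L r t) 0 PI =
    RInt (fun t => current1 polar_weights F f1 f2 g1 g2 r t) 0 PI - RInt (fun t => r * r * sin t * j1 L r t) 0 PI)
    by (apply (@RInt_minus R_CompleteNormedModule); assumption).
  rewrite <- Edf.
  (* The two integrals bound the error, proportional to [r * S1], after it is split into a constant
     and a multiple of the energy; [s] balances them freely. *)
  assert (I1 : is_RInt (fun t => Ke * / s / 2 * sin t) 0 PI (Ke * / s / 2 * 2))
    by (apply (@is_RInt_scal R_NormedModule sin 0 PI (Ke * / s / 2) 2 RInt_sin_0_PI)).
  assert (I2 : is_RInt (fun t => 2 * Ke * s * (r * r * sin t * q1 r t)) 0 PI
      (2 * Ke * s * RInt (fun t => r * r * sin t * q1 r t) 0 PI)).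
  { apply (@is_RInt_scal R_NormedModule (fun t => r * r * sin t * q1 r t) 0 PI (2 * Ke * s)).
    apply (@RInt_correct R_CompleteNormedModule). exact E3. }
  assert (I3 := @is_RInt_plus R_NormedModule _ _ _ _ _ _ I1 I2).
  apply Rle_trans with (Ke * / s / 2 * 2 + 2 * Ke * s * RInt (fun t => r * r * sin t * q1 r t) 0 PI).
  - assert (EI : Ke * / s / 2 * 2 + 2 * Ke * s * RInt (fun t => r * r * sin t * q1 r t) 0 PI =
      RInt (fun t => Ke * / s / 2 * sin t + 2 * Ke * s * (r * r * sin t * q1 r t)) 0 PI)
      by (symmetry; exact (is_RInt_unique _ _ _ _ I3)).
    rewrite EI. apply RInt_abs_le; [lra| |eexists; exact I3|].
    + apply (@ex_RInt_minus R_NormedModule); assumption.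
    + intros t Ht. assert (Hsn : 0 < sin t) by (apply sin_gt_0; lra).
      specialize (Sx r t ltac:(lra)). apply Rabs_le_between in Sx.
      replace (current1 polar_weights F f1 f2 g1 g2 r t - r * r * sin t * j1 L r t) with (r * r * sin t * e r t).
      2:{ unfold e, e1, e2, e3, M, iX, L, current1, fT1, kap; simpl. field. lra. }
      rewrite Rabs_mult, (Rabs_pos_eq (r * r * sin t)) by (apply Rmult_le_pos; lra).
      specialize (He r t ltac:(lra)).
      apply Rle_trans with (r * r * sin t * (Ke / r * S1 r t)).
      { apply Rmult_le_compat_l; [apply Rmult_le_pos; lra|exact He]. }
      change (r * r * sin t * (Ke / r * S1 r t) <= Ke * / s / 2 * sin t + 2 * Ke * s * (r * r * sin t * q1 r t)).
      replace (r * r * sin t * (Ke / r * S1 r t)) with (Ke * sin t * (r * S1 r t)) by (field; lra).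
      replace (Ke * / s / 2 * sin t + 2 * Ke * s * (r * r * sin t * q1 r t)) with
        (Ke * sin t * (/ s / 2 + s * r * r / 2 * (4 * q1 r t))) by (field; lra).
      apply Rmult_le_compat_l; [apply Rmult_le_pos; lra|].
      pose proof (sum_sq_bound (j1 (ja F) r t) (j1 (jb F) r t) (j1 (jc F) r t) (j1 (jd F) r t)) as SB.
      fold (S1 r t) in SB. fold (q1 r t) in SB.
      apply Rle_trans with (/ s / 2 + s * r * r / 2 * (S1 r t * S1 r t)).
      * (* AM-GM *)
        apply Rminus_le. replace (r * S1 r t - (/ s / 2 + s * r * r / 2 * (S1 r t * S1 r t))) with
          (- (s / 2 * ((/ s - r * S1 r t) * (/ s - r * S1 r t)))) by (field; lra).
        pose proof (Rle_0_sqr (/ s - r * S1 r t)) as Sq. unfold Rsqr in Sq.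
        assert (0 <= s / 2 * ((/ s - r * S1 r t) * (/ s - r * S1 r t))) by (apply Rmult_le_pos; lra). lra.
      * apply Rplus_le_compat_l. apply Rmult_le_compat_l; [|exact SB].
        apply Rmult_le_pos; [|lra]. apply Rmult_le_pos; [apply Rmult_le_pos; lra|lra].
  - assert (Q : 2 * Ke * s * RInt (fun t => r * r * sin t * q1 r t) 0 PI <= 2 * Ke * s * dm r).
    { apply Rmult_le_compat_l; [apply Rmult_le_pos; lra|exact M2]. }
    assert (Ps : 0 < / s) by (apply Rinv_0_lt_compat, Hs).
    assert (0 <= Ke * / s) by (apply Rmult_le_pos; lra).
    assert (0 <= (2 * KL + Km) * (/ s + s * dm r)).
    { apply Rmult_le_pos; [lra|]. apply Rplus_le_le_0_compat; [lra|apply Rmult_le_pos; lra]. }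
    replace ((2 * KL + Km + 2 * Ke) * (/ s + s * dm r)) with
      ((2 * KL + Km) * (/ s + s * dm r) + (2 * (Ke * / s) + 2 * Ke * s * dm r)) by ring.
    lra.
Qed.
End FarFlux.

(** * The fields of a solution *)

(** A plane that crosses the axis: [x] takes both signs, so the regularity of [lift f] on the
    spacetime yields derivatives at [x = 0] too. *)
Definition meridian (x z : R) : pt :=
  fun i => match i with Defs.c0 => 0 | Defs.c1 => x | Defs.c2 => 0 | Defs.c3 => z end.

Lemma upd_meridian_x x z s : upd (meridian x z) Defs.c1 s = meridian s z.
Proof.
  apply functional_extensionality. intros i. unfold upd.
  destruct i; destruct (idx_eq_dec _ _); simpl; congruence.
Qed.

Lemma upd_meridian_z x z s : upd (meridian x z) Defs.c3 s = meridian x s.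
Proof.
  apply functional_extensionality. intros i. unfold upd.
  destruct i; destruct (idx_eq_dec _ _); simpl; congruence.
Qed.

Lemma half_plane_meridian x z : half_plane (meridian x z) = (Rabs x, z).
Proof.
  unfold half_plane; simpl. f_equal. rewrite <- sqrt_Rsqr_abs. f_equal. unfold Rsqr. ring.
Qed.

Definition slice (f : pt -> R) : R -> R -> R := fun x z => f (meridian x z).

Lemma slice_cont (f : pt -> R) x z : continuous f (meridian x z) -> cont2 (slice f) x z.
Proof.
  intros H eps. destruct (proj1 (filterlim_locally f (f (meridian x z))) H eps) as [d Hd].
  exists d. intros u v Hu Hv. apply (Hd (meridian u v)). intros i.
  destruct i; simpl; [apply ball_center|exact Hu|apply ball_center|exact Hv].
Qed.

Lemma pd_slice_x f x z : pd Defs.c1 f (meridian x z) = Derive (fun s => slice f s z) x.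
Proof.
  unfold pd, slice. apply Derive_ext. intros s. rewrite upd_meridian_x. reflexivity.
Qed.

Lemma pd_slice_z f x z : pd Defs.c3 f (meridian x z) = Derive (fun s => slice f x s) z.
Proof.
  unfold pd, slice. apply Derive_ext. intros s. rewrite upd_meridian_z. reflexivity.
Qed.

Lemma grad_on_slice (D : pt -> Prop) f :
  (forall i, (forall x, D x -> ex_derive (fun s => f (upd x i s)) (x i)) /\
     (forall x, D x -> continuous (pd i f) x)) ->
  grad_on (fun x z => D (meridian x z)) (slice f) (slice (pd Defs.c1 f)) (slice (pd Defs.c3 f)).
Proof.
  intros H x z Hxz. split; [|split; [|split]].
  - change (slice (pd Defs.c1 f) x z) with (pd Defs.c1 f (meridian x z)). rewrite pd_slice_x.
    apply Derive_correct. apply ex_derive_ext with (fun s => f (upd (meridian x z) Defs.c1 s)).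
    + intros s. rewrite upd_meridian_x. reflexivity.
    + apply (proj1 (H Defs.c1) _ Hxz).
  - change (slice (pd Defs.c3 f) x z) with (pd Defs.c3 f (meridian x z)). rewrite pd_slice_z.
    apply Derive_correct. apply ex_derive_ext with (fun s => f (upd (meridian x z) Defs.c3 s)).
    + intros s. rewrite upd_meridian_z. reflexivity.
    + apply (proj1 (H Defs.c3) _ Hxz).
  - apply slice_cont, (H Defs.c1), Hxz.
  - apply slice_cont, (H Defs.c3), Hxz.
Qed.

Definition jet_of (f : pt -> R) : jet :=
  Jet (slice f) (slice (pd Defs.c1 f)) (slice (pd Defs.c3 f)) (slice (pd Defs.c1 (pd Defs.c1 f)))
    (slice (pd Defs.c3 (pd Defs.c1 f))) (slice (pd Defs.c1 (pd Defs.c3 f))) (slice (pd Defs.c3 (pd Defs.c3 f))).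

Lemma jet_on_slice (D : pt -> Prop) f : Cn 2 D f -> jet_on (fun x z => D (meridian x z)) (jet_of f).
Proof.
  intros [_ H].
  assert (G : forall i, grad_on (fun x z => D (meridian x z)) (slice (pd i f))
    (slice (pd Defs.c1 (pd i f))) (slice (pd Defs.c3 (pd i f)))).
  { intros i. apply grad_on_slice. intros j. destruct (H i) as [_ [_ Hi]].
    split; [apply (Hi j)|]. apply (proj1 (proj2 (Hi j))). }
  split; [|split; apply G].
  apply grad_on_slice. intros i. split; [apply (H i)|]. apply (proj1 (proj2 (H i))).
Qed.

Section Potentials.
Context (B : boundary_curve).

(** Reflected in the axis, so that the axis consists of interior points. *)
Definition ext2 (x z : R) : Prop := exterior B (Rabs x, z).

Lemma ext2_open : open2 ext2.
Proof.
  intros x z H. destruct (exterior_local B (Rabs x, z)) as (e & He & Hl).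
  - apply Rabs_pos.
  - apply exterior_off_curve, H.
  - exists (mkposreal e He). simpl. intros u v Hu Hv. apply (Hl (Rabs u, v)); simpl.
    + apply Rabs_pos.
    + apply Rle_lt_trans with (2 := Hu). apply Rabs_triang_inv2.
    + exact Hv.
    + exact H.
Qed.

Definition comp_jet (f : R * R -> R) : jet := jet_of (lift f).

Lemma comp_jet_on f : Cn 2 (spacetime_interior B) (lift f) -> jet_on ext2 (comp_jet f).
Proof.
  intros H. apply jet_on_slice in H. destruct H as (A & A1 & A2).
  assert (S : forall x z, ext2 x z -> spacetime_interior B (meridian x z)).
  { intros x z Hxz. unfold spacetime_interior. rewrite half_plane_meridian. exact Hxz. }
  split; [|split]; (eapply grad_on_sub; [exact S|]); assumption.
Qed.

Lemma comp_jet_0 f x z : j0 (comp_jet f) x z = f (Rabs x, z).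
Proof. simpl. unfold slice, lift. rewrite half_plane_meridian. reflexivity. Qed.

Lemma comp_jet_1 f x z : 0 < x -> j1 (comp_jet f) x z = Derive (fun s => f (s, z)) x.
Proof.
  intros Hx. change (j1 (comp_jet f) x z) with (pd Defs.c1 (lift f) (meridian x z)). rewrite pd_slice_x.
  apply Derive_ext_loc. exists (mkposreal x Hx). intros s Hs. apply Rabs_lt_between in Hs.
  unfold minus, plus, opp in Hs; simpl in Hs.
  transitivity (j0 (comp_jet f) s z); [reflexivity|]. rewrite comp_jet_0, Rabs_pos_eq by lra. reflexivity.
Qed.

Lemma comp_jet_2 f x z : 0 < x -> j2 (comp_jet f) x z = Derive (fun s => f (x, s)) z.
Proof.
  intros Hx. change (j2 (comp_jet f) x z) with (pd Defs.c3 (lift f) (meridian x z)). rewrite pd_slice_z.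
  apply Derive_ext. intros s.
  transitivity (j0 (comp_jet f) x s); [reflexivity|]. rewrite comp_jet_0, Rabs_pos_eq by lra. reflexivity.
Qed.

Definition comp_fields (E L : R * R -> C) : fields :=
  Fields (comp_jet (fun p => Re (E p))) (comp_jet (fun p => Im (E p)))
    (comp_jet (fun p => Re (L p))) (comp_jet (fun p => Im (L p))).

Lemma Cmod_sq (z : C) : Cmod z ^ 2 = Re z * Re z + Im z * Im z.
Proof. unfold Cmod. rewrite pow2_sqrt by nra. unfold Re, Im. ring. Qed.

Lemma comp_fX E L x z : fX (comp_fields E L) x z = - ernst_N (E (Rabs x, z)) (L (Rabs x, z)).
Proof.
  unfold fX, comp_fields, ja, jc, jd. rewrite !comp_jet_0. unfold ernst_N. rewrite Cmod_sq. ring.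
Qed.

Lemma d_rho_comp f x z : 0 < x -> d_rho f (x, z) =
  (j1 (comp_jet (fun p => Re (f p))) x z, j1 (comp_jet (fun p => Im (f p))) x z).
Proof. intros Hx. rewrite !comp_jet_1 by exact Hx. reflexivity. Qed.

Lemma d_z_comp f x z : 0 < x -> d_z f (x, z) =
  (j2 (comp_jet (fun p => Re (f p))) x z, j2 (comp_jet (fun p => Im (f p))) x z).
Proof. intros Hx. rewrite !comp_jet_2 by exact Hx. reflexivity. Qed.

Lemma d_rho_rho f x z : 0 < x -> ext2 x z ->
  jet_on ext2 (comp_jet (fun p => Re (f p))) -> jet_on ext2 (comp_jet (fun p => Im (f p))) ->
  d_rho (fun q => (RtoC (fst q) * d_rho f q)%C) (x, z) =
  (j1 (comp_jet (fun p => Re (f p))) x z + x * j11 (comp_jet (fun p => Re (f p))) x z,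
   j1 (comp_jet (fun p => Im (f p))) x z + x * j11 (comp_jet (fun p => Im (f p))) x z).
Proof.
  intros Hx Hxz HR HI.
  assert (G : forall u, jet_on ext2 u -> is_derive (fun s => 1 * (s * j1 u s z)) x (j1 u x z + x * j11 u x z)).
  { intros u (_ & A & _). destruct (A x z Hxz) as (D & _).
    replace (j1 u x z + x * j11 u x z) with (1 * (1 * j1 u x z + x * j11 u x z)) by ring.
    apply (is_derive_mult_R 1 (fun s => s) (fun s => j1 u s z)); [apply (@is_derive_id R_AbsRing)|exact D]. }
  apply injective_projections.
  - rewrite <- (is_derive_unique _ _ _ (G _ HR)). apply Derive_ext_loc.
    exists (mkposreal x Hx). intros s Hs. apply Rabs_lt_between in Hs.
    unfold minus, plus, opp in Hs; simpl in Hs. cbn [fst snd]. rewrite d_rho_comp by lra.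
    unfold Re at 1, Cmult, RtoC; cbn [fst snd]. req. ring.
  - rewrite <- (is_derive_unique _ _ _ (G _ HI)). apply Derive_ext_loc.
    exists (mkposreal x Hx). intros s Hs. apply Rabs_lt_between in Hs.
    unfold minus, plus, opp in Hs; simpl in Hs. cbn [fst snd]. rewrite d_rho_comp by lra.
    unfold Im at 1, Cmult, RtoC; cbn [fst snd]. req. ring.
Qed.

Lemma d_z_z f x z : 0 < x -> ext2 x z ->
  jet_on ext2 (comp_jet (fun p => Re (f p))) -> jet_on ext2 (comp_jet (fun p => Im (f p))) ->
  d_z (fun q => (RtoC (fst q) * d_z f q)%C) (x, z) =
  (x * j22 (comp_jet (fun p => Re (f p))) x z, x * j22 (comp_jet (fun p => Im (f p))) x z).
Proof.
  intros Hx Hxz HR HI.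
  assert (G : forall u, jet_on ext2 u -> is_derive (fun s => x * j2 u x s) z (x * j22 u x z)).
  { intros u (_ & _ & A). destruct (A x z Hxz) as (_ & D & _). apply is_derive_scal. exact D. }
  apply injective_projections.
  - rewrite <- (is_derive_unique _ _ _ (G _ HR)). apply Derive_ext. intros s. cbn [fst snd].
    rewrite d_z_comp by lra. unfold Re at 1, Cmult, RtoC; cbn [fst snd]. req. ring.
  - rewrite <- (is_derive_unique _ _ _ (G _ HI)). apply Derive_ext. intros s. cbn [fst snd].
    rewrite d_z_comp by lra. unfold Im at 1, Cmult, RtoC; cbn [fst snd]. req. ring.
Qed.

(** Real and imaginary parts of the Ernst operator; the overall sign changes because [N = - X]. *)
Lemma ernst_operator_solves E L f x z : 0 < x -> ext2 x z ->
  jet_on ext2 (comp_jet (fun p => Re (f p))) -> jet_on ext2 (comp_jet (fun p => Im (f p))) ->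
  ernst_operator E L f (x, z) = RtoC 0 ->
  solves cart_weights (comp_fields E L) (comp_jet (fun p => Re (f p))) (comp_jet (fun p => Im (f p))) x z.
Proof.
  intros Hx Hxz HR HI H. unfold ernst_operator in H.
  rewrite d_rho_rho, d_z_z in H by assumption. rewrite !d_rho_comp, !d_z_comp in H by exact Hx.
  assert (EX : ernst_N (E (x, z)) (L (x, z)) = - fX (comp_fields E L) x z).
  { rewrite comp_fX, Rabs_pos_eq by lra. ring. }
  rewrite EX in H.
  assert (EL : L (x, z) = (j0 (jc (comp_fields E L)) x z, j0 (jd (comp_fields E L)) x z)).
  { unfold comp_fields, jc, jd. rewrite !comp_jet_0, Rabs_pos_eq by lra. destruct (L (x, z)); reflexivity. }
  rewrite EL in H.
  assert (H1 := f_equal fst H). assert (H2 := f_equal snd H). clear H.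
  unfold Cmult, Cplus, Cconj, RtoC in H1, H2. cbn [fst snd] in H1, H2.
  unfold solves, wdiv, fX1, fX2, fT1, fT2.
  change (comp_jet (fun p => Re (E p))) with (ja (comp_fields E L)) in *.
  change (comp_jet (fun p => Im (E p))) with (jb (comp_fields E L)) in *.
  change (comp_jet (fun p => Re (L p))) with (jc (comp_fields E L)) in *.
  change (comp_jet (fun p => Im (L p))) with (jd (comp_fields E L)) in *.
  cbn [w1 w2 dw1 dw2 cart_weights]. split.
  - apply Rminus_diag_uniq. match type of H1 with ?l = _ => transitivity (- l); [ring|rewrite H1; ring] end.
  - apply Rminus_diag_uniq. match type of H2 with ?l = _ => transitivity (- l); [ring|rewrite H2; ring] end.
Qed.

Lemma comp_fields_on E L : ernst_solution B E L -> fields_on ext2 (comp_fields E L).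
Proof.
  intros ((A1 & A2) & (A3 & A4) & _).
  exact (conj (comp_jet_on _ A1) (conj (comp_jet_on _ A2) (conj (comp_jet_on _ A3) (comp_jet_on _ A4)))).
Qed.

Lemma comp_fields_ernst E L : ernst_solution B E L ->
  (forall x z, ext2 x z -> 0 < fX (comp_fields E L) x z) /\
  (forall x z, ext2 x z -> 0 < x -> ernst_at cart_weights (comp_fields E L) x z).
Proof.
  intros HS. destruct (comp_fields_on E L HS) as (F1 & F2 & F3 & F4).
  destruct HS as (_ & _ & HN & HE).
  assert (P : forall x z, ext2 x z -> 0 < fX (comp_fields E L) x z).
  { intros x z H. rewrite comp_fX. specialize (HN _ H). lra. }
  split; [exact P|]. intros x z H Hx.
  assert (Hp : exterior_off_axis B (x, z)).
  { split; [|exact Hx]. unfold ext2 in H. rewrite Rabs_pos_eq in H by lra. exact H. }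
  destruct (HE _ Hp) as [O1 O2].
  split; [apply P, H|split]; apply ernst_operator_solves; assumption.
Qed.

End Potentials.

(** * Undoing the transformations of the family *)

Section Gauge.
Context (l1 l2 om : R) (F : fields).

(** [E + 2 conj lam L - |lam|^2 - i om] and [L - lam] with [lam = l1 + i l2]: the inverse of the
    transformation of [cauchy_family]. *)
Definition gauge : fields :=
  Fields
    (jlin 1 (jlin 1 (ja F) 1 (jlin (2 * l1) (jc F) (- (- 2 * l2)) (jd F)))
       1 (jlin 1 (jconst (- (l1 * l1 + l2 * l2))) (- 0) (jconst (- om))))
    (jlin 1 (jlin 1 (jb F) 1 (jlin (2 * l1) (jd F) (- 2 * l2) (jc F)))
       1 (jlin 1 (jconst (- om)) 0 (jconst (- (l1 * l1 + l2 * l2)))))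
    (jlin 1 (jc F) 1 (jlin 1 (jconst (- l1)) (- 0) (jconst (- l2))))
    (jlin 1 (jd F) 1 (jlin 1 (jconst (- l2)) 0 (jconst (- l1)))).

Lemma gauge_fX x y : fX gauge x y = fX F x y.
Proof. unfold fX; simpl. ring. Qed.

(** [X] and [grad E + 2 conj L grad L] are gauge invariant, and the linear equation involves the
    potentials only through them. *)
Lemma gauge_solves W f g x y : solves W F f g x y -> solves W gauge f g x y.
Proof.
  unfold solves. rewrite gauge_fX.
  replace (fX1 gauge x y) with (fX1 F x y) by (unfold fX1; simpl; ring).
  replace (fX2 gauge x y) with (fX2 F x y) by (unfold fX2; simpl; ring).
  replace (fT1 gauge x y) with (fT1 F x y) by (unfold fT1; simpl; ring).
  replace (fT2 gauge x y) with (fT2 F x y) by (unfold fT2; simpl; ring).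
  auto.
Qed.

(** The new potentials are complex combinations of [1], [E] and [L]. The coefficients of [gauge],
    such as [- 0] and [- (- 2 * l2)], are spelled as in [solves_add], so that it applies by
    unification. *)
Lemma gauge_ernst W x y : ernst_at W F x y -> ernst_at W gauge x y.
Proof.
  intros (H1 & H2 & H3). split; [rewrite gauge_fX; exact H1|].
  split; apply gauge_solves; repeat apply solves_add; try assumption; apply solves_const.
Qed.

Lemma gauge_on D : fields_on D F -> fields_on D gauge.
Proof.
  intros (A & A1 & A2 & A3).
  split; [|split; [|split]]; repeat (apply jet_on_lin); try assumption; apply jet_on_const.
Qed.
End Gauge.

(** * Equality of the fluxes of two solutions *)

(** The complex solutions [1], [E], [L], [-i E] and [-i L] that enter the currents; the real
    part of the current of [f] and [-i g] is the imaginary part of that of [f] and [g]. *)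
Inductive sel := SOne | SE | SL | SiE | SiL.

Definition sre (s : sel) (F : fields) : jet :=
  match s with SOne => jconst 1 | SE => ja F | SL => jc F | SiE => jb F | SiL => jd F end.
Definition sim (s : sel) (F : fields) : jet :=
  match s with SOne => jconst 0 | SE => jb F | SL => jd F
  | SiE => jlin (-1) (ja F) 0 (jconst 0) | SiL => jlin (-1) (jc F) 0 (jconst 0) end.

Lemma sel_on D F s : fields_on D F -> jet_on D (sre s F) /\ jet_on D (sim s F).
Proof.
  intros (H1 & H2 & H3 & H4).
  destruct s; split; simpl; try assumption; try apply jet_on_const;
    apply jet_on_lin; try assumption; apply jet_on_const.
Qed.

Lemma solves_minus_i W F f g x y : solves W F f g x y -> solves W F g (jlin (-1) f 0 (jconst 0)) x y.
Proof.
  intros [A1 A2]. unfold solves, wdiv in *; simpl. split.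
  - rewrite A2. ring.
  - match type of A1 with ?l = ?r => transitivity (- l); [ring|rewrite A1; ring] end.
Qed.

Lemma sel_solves W F s x y : ernst_at W F x y -> solves W F (sre s F) (sim s F) x y.
Proof.
  intros (_ & H1 & H2). destruct s; simpl; try assumption.
  - apply solves_const.
  - apply solves_minus_i, H1.
  - apply solves_minus_i, H2.
Qed.

Definition cur1 F s s' := current1 polar_weights F (sre s F) (sim s F) (sre s' F) (sim s' F).
Definition cur2 F s s' := current2 polar_weights F (sre s F) (sim s F) (sre s' F) (sim s' F).

Definition eq_at (j j' : jet) x y : Prop := j0 j x y = j0 j' x y /\ j1 j x y = j1 j' x y /\ j2 j x y = j2 j' x y.
Definition fields_eq_at (F G : fields) x y : Prop :=
  eq_at (ja F) (ja G) x y /\ eq_at (jb F) (jb G) x y /\ eq_at (jc F) (jc G) x y /\ eq_at (jd F) (jd G) x y.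

Lemma sel_eq_at F G s x y : fields_eq_at F G x y -> eq_at (sre s F) (sre s G) x y /\ eq_at (sim s F) (sim s G) x y.
Proof.
  intros (H1 & H2 & H3 & H4).
  assert (M : forall j j', eq_at j j' x y -> eq_at (jlin (-1) j 0 (jconst 0)) (jlin (-1) j' 0 (jconst 0)) x y).
  { intros j j' (E0 & E1 & E2). unfold eq_at; simpl. rewrite E0, E1, E2. auto. }
  assert (K : forall k, eq_at (jconst k) (jconst k) x y) by (intros; unfold eq_at; auto).
  destruct s; split; simpl; auto.
Qed.

Lemma cur_eq_at F G s s' x y : fields_eq_at F G x y ->
  cur1 F s s' x y = cur1 G s s' x y /\ cur2 F s s' x y = cur2 G s s' x y.
Proof.
  intros H. destruct (sel_eq_at F G s x y H) as ((A0 & A1 & A2) & (B0 & B1 & B2)).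
  destruct (sel_eq_at F G s' x y H) as ((C0 & C1 & C2) & (D0 & D1 & D2)).
  destruct H as ((Ea0 & Ea1 & Ea2) & (Eb0 & Eb1 & Eb2) & (Ec0 & Ec1 & Ec2) & (Ed0 & Ed1 & Ed2)).
  unfold cur1, cur2, current1, current2, fX, fT1, fT2.
  rewrite A0, A1, A2, B0, B1, B2, C0, C1, C2, D0, D1, D2, Ea0, Eb1, Eb2, Ec0, Ec1, Ec2, Ed0, Ed1, Ed2. auto.
Qed.

Definition jcont (j : jet) x y : Prop := cont2 (j0 j) x y /\ cont2 (j1 j) x y /\ cont2 (j2 j) x y.
Definition fields_cont F x y := jcont (ja F) x y /\ jcont (jb F) x y /\ jcont (jc F) x y /\ jcont (jd F) x y.

Lemma sel_cont F s x y : fields_cont F x y -> jcont (sre s F) x y /\ jcont (sim s F) x y.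
Proof.
  intros (H1 & H2 & H3 & H4).
  assert (K : forall k, jcont (jconst k) x y) by (intros; unfold jcont; simpl; repeat split; apply continuity_2d_pt_const).
  assert (M : forall j, jcont j x y -> jcont (jlin (-1) j 0 (jconst 0)) x y).
  { intros j (E0 & E1 & E2). unfold jcont; simpl. split; [|split]; cont2_auto. }
  destruct s; split; simpl; auto.
Qed.

Lemma cur_cont F s s' x y : fields_cont F x y -> fX F x y <> 0 ->
  cont2 (cur1 F s s') x y /\ cont2 (cur2 F s s') x y.
Proof.
  intros H HX. destruct (sel_cont F s x y H) as ((? & ? & ?) & (? & ? & ?)).
  destruct (sel_cont F s' x y H) as ((? & ? & ?) & (? & ? & ?)).
  destruct H as ((? & ? & ?) & (? & ? & ?) & (? & ? & ?) & (? & ? & ?)).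
  destruct (polar_weights_ok x y) as (_ & _ & ? & ? & _).
  assert (CX : cont2 (fX F) x y) by (unfold fX; cont2_auto).
  assert (CT1 : cont2 (fT1 F) x y) by (unfold fT1; cont2_auto).
  assert (CT2 : cont2 (fT2 F) x y) by (unfold fT2; cont2_auto).
  assert (HXX : fX F x y * fX F x y <> 0) by (apply Rmult_integral_contrapositive_currified; exact HX).
  unfold cur1, cur2, current1, current2. split; cont2_auto.
Qed.

(** The radial weight contains [r * sin t]. The angular weight is only [sin t], but at [r = 0] the
    angular derivatives themselves carry a factor [r]. *)
Lemma cur_zero z0 F s s' r t : r * sin t = 0 ->
  cur1 (polar_fields z0 F) s s' r t = 0 /\ cur2 (polar_fields z0 F) s s' r t = 0.
Proof.
  intros H. unfold cur1, cur2, current1, current2; simpl.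
  rewrite (Rmult_assoc r r (sin t)), H. unfold Rdiv. split; [ring|].
  destruct (Rmult_integral _ _ H) as [E|E]; [|rewrite E; ring].
  assert (G : forall q, j2 (sre q (polar_fields z0 F)) r t = 0 /\ j2 (sim q (polar_fields z0 F)) r t = 0).
  { intros q. destruct q; simpl; unfold polar_d2; rewrite ?E; split; ring. }
  destruct (G s) as [-> ->]. destruct (G s') as [-> ->].
  assert (T : fT2 (polar_fields z0 F) r t = 0) by (unfold fT2; simpl; unfold polar_d2; rewrite E; ring).
  rewrite T. ring.
Qed.

(** * Continuation of boundary values by constants *)

Record jval := JV { v0 : R; v1 : R; v2 : R }.
Record fvals := FV { va : jval; vb : jval; vc : jval; vd : jval }.

Section Star.
Context (Om : R -> R -> Prop).

(** Two solutions with equal boundary values at a point, both continued by these constants, have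
    currents that are continuous at the point and agree outside [Om]. *)
Definition star (u : R -> R -> R) (v : R) : R -> R -> R :=
  fun x z => if excluded_middle_informative (Om x z) then u x z else v.

Definition starj (j : jet) (v : jval) : jet :=
  let o := fun _ _ : R => 0 in
  Jet (star (j0 j) (v0 v)) (star (j1 j) (v1 v)) (star (j2 j) (v2 v)) o o o o.

Definition starf (F : fields) (v : fvals) : fields :=
  Fields (starj (ja F) (va v)) (starj (jb F) (vb v)) (starj (jc F) (vc v)) (starj (jd F) (vd v)).

Definition blim (u : R -> R -> R) (p : R * R) (v : R) : Prop :=
  forall eps : posreal, exists d : posreal, forall x z, Om x z ->
    Rabs (x - fst p) < d -> Rabs (z - snd p) < d -> Rabs (u x z - v) < eps.

Definition blimj (j : jet) p (v : jval) : Prop := blim (j0 j) p (v0 v) /\ blim (j1 j) p (v1 v) /\ blim (j2 j) p (v2 v).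
Definition blimf (F : fields) p (v : fvals) : Prop :=
  blimj (ja F) p (va v) /\ blimj (jb F) p (vb v) /\ blimj (jc F) p (vc v) /\ blimj (jd F) p (vd v).

Lemma star_cont u p v : ~ Om (fst p) (snd p) -> blim u p v -> cont2 (star u v) (fst p) (snd p).
Proof.
  intros Hp H eps. destruct (H eps) as [d Hd]. exists d. intros x z Hx Hz.
  unfold star. destruct (excluded_middle_informative (Om (fst p) (snd p))); [tauto|].
  destruct (excluded_middle_informative (Om x z)).
  - apply Hd; assumption.
  - rewrite Rminus_eq_0, Rabs_R0. apply cond_pos.
Qed.

Lemma starf_polar_cont z0 F v r t : ~ Om (r * sin t) (z0 + r * cos t) ->
  blimf F (polar z0 r t) v -> fields_cont (polar_fields z0 (starf F v)) r t.
Proof.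
  intros Hp.
  assert (G : forall j w, blimj j (polar z0 r t) w -> jcont (polar_jet z0 (starj j w)) r t).
  { intros j w (H0 & H1 & H2). apply star_cont in H0, H1, H2; try exact Hp.
    apply polar_fun_cont in H0, H1, H2.
    unfold jcont; simpl. split; [exact H0|]. unfold polar_d1, polar_d2. split; cont2_auto. }
  intros (H1 & H2 & H3 & H4). exact (conj (G _ _ H1) (conj (G _ _ H2) (conj (G _ _ H3) (G _ _ H4)))).
Qed.

Lemma starf_in z0 F v r t : Om (r * sin t) (z0 + r * cos t) ->
  fields_eq_at (polar_fields z0 (starf F v)) (polar_fields z0 F) r t.
Proof.
  intros H.
  assert (G : forall j w, eq_at (polar_jet z0 (starj j w)) (polar_jet z0 j) r t).
  { intros j w. unfold eq_at; simpl. unfold polar_d1, polar_d2, polar_fun, star.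
    destruct (excluded_middle_informative _); [auto|tauto]. }
  repeat split; apply G.
Qed.

Lemma starf_out z0 F G v r t : ~ Om (r * sin t) (z0 + r * cos t) ->
  fields_eq_at (polar_fields z0 (starf F v)) (polar_fields z0 (starf G v)) r t.
Proof.
  intros H.
  assert (K : forall j j' w, eq_at (polar_jet z0 (starj j w)) (polar_jet z0 (starj j' w)) r t).
  { intros j j' w. unfold eq_at; simpl. unfold polar_d1, polar_d2, polar_fun, star.
    destruct (excluded_middle_informative _); [tauto|auto]. }
  repeat split; apply K.
Qed.

Lemma blim_lin a u b v p k l : blim u p k -> blim v p l ->
  blim (fun x z => a * u x z + b * v x z) p (a * k + b * l).
Proof.
  intros Hu Hv eps.
  assert (P : 0 < eps / (Rabs a + Rabs b + 1)).
  { apply Rdiv_lt_0_compat; [apply cond_pos|]. pose proof (Rabs_pos a). pose proof (Rabs_pos b). lra. }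
  destruct (Hu (mkposreal _ P)) as [d1 H1]. destruct (Hv (mkposreal _ P)) as [d2 H2].
  assert (Pd : 0 < Rmin d1 d2) by (apply Rmin_pos; apply cond_pos).
  exists (mkposreal _ Pd). simpl. intros x z HO Hx Hz.
  pose proof (Rmin_l d1 d2). pose proof (Rmin_r d1 d2).
  specialize (H1 x z HO ltac:(lra) ltac:(lra)). specialize (H2 x z HO ltac:(lra) ltac:(lra)). simpl in H1, H2.
  replace (a * u x z + b * v x z - (a * k + b * l)) with (a * (u x z - k) + b * (v x z - l)) by ring.
  apply Rle_lt_trans with (1 := Rabs_triang _ _). rewrite !Rabs_mult.
  pose proof (Rabs_pos a). pose proof (Rabs_pos b).
  set (e := eps / (Rabs a + Rabs b + 1)) in *.
  assert (E : eps = (Rabs a + Rabs b + 1) * e :> R) by (unfold e; field; lra).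
  rewrite E.
  assert (Rabs a * Rabs (u x z - k) <= Rabs a * e) by (apply Rmult_le_compat_l; lra).
  assert (Rabs b * Rabs (v x z - l) <= Rabs b * e) by (apply Rmult_le_compat_l; lra). lra.
Qed.

Lemma blim_const k p : blim (fun _ _ => k) p k.
Proof. intros eps. exists eps. intros. rewrite Rminus_eq_0, Rabs_R0. apply cond_pos. Qed.

Definition vlin a v b w := JV (a * v0 v + b * v0 w) (a * v1 v + b * v1 w) (a * v2 v + b * v2 w).
Lemma blimj_lin a j b j' p v w : blimj j p v -> blimj j' p w -> blimj (jlin a j b j') p (vlin a v b w).
Proof.
  intros (A0 & A1 & A2) (B0 & B1 & B2).
  exact (conj (blim_lin a _ b _ p _ _ A0 B0) (conj (blim_lin a _ b _ p _ _ A1 B1) (blim_lin a _ b _ p _ _ A2 B2))).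
Qed.
Lemma blimj_const k p : blimj (jconst k) p (JV k 0 0).
Proof. exact (conj (blim_const k p) (conj (blim_const 0 p) (blim_const 0 p))). Qed.
End Star.

(** * The difference of the currents of two solutions with the same Cauchy data *)

Section Transfer.
Context (B : boundary_curve).

Definition outside (x z : R) : Prop := exterior_off_axis B (x, z).

Lemma outside_ext2 x z : outside x z -> ext2 B x z /\ 0 < x.
Proof. intros [H Hx]. simpl in Hx. unfold ext2. rewrite Rabs_pos_eq by lra. auto. Qed.

Lemma outside_open : open2 outside.
Proof.
  intros x z H. destruct (outside_ext2 x z H) as [He Hx]. destruct (ext2_open B x z He) as [d Hd].
  assert (P : 0 < Rmin d x) by (apply Rmin_pos; [apply cond_pos|exact Hx]).
  exists (mkposreal _ P). simpl. intros u v Hu Hv.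
  pose proof (Rmin_l d x). pose proof (Rmin_r d x).
  specialize (Hd u v ltac:(lra) ltac:(lra)). apply Rabs_lt_between in Hu.
  assert (Hu0 : 0 < u) by lra. unfold ext2 in Hd. rewrite Rabs_pos_eq in Hd by lra. split; [exact Hd|exact Hu0].
Qed.

Lemma outside_closed_off_curve x z : ~ ext2 B x z \/ x < 0 -> ~ on_curve B (x, z) ->
  locally_2d (fun u v => ~ outside u v) x z.
Proof.
  intros H Hc. destruct (Rlt_or_le x 0) as [Hx|Hx].
  - assert (P : 0 < - x) by lra. exists (mkposreal _ P). simpl. intros u v Hu _ [_ Ho]. simpl in Ho.
    apply Rabs_lt_between in Hu. lra.
  - destruct H as [H|H]; [|lra]. unfold ext2 in H. rewrite Rabs_pos_eq in H by lra.
    destruct (exterior_local B (x, z) Hx Hc) as (e & He & Hl).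
    exists (mkposreal e He). simpl. intros u v Hu Hv [Ho Ho']. simpl in Ho'.
    apply H. apply (Hl (u, v)); simpl; auto. lra.
Qed.

Record good (F : fields) : Prop := {
  good_on : fields_on (ext2 B) F;
  good_pos : forall x z, ext2 B x z -> 0 < fX F x z;
  good_ernst : forall x z, ext2 B x z -> 0 < x -> ernst_at cart_weights F x z }.

Context (F G : fields) (gF : good F) (gG : good G)
  (bdry : forall p, on_curve B p -> exists v, blimf outside F p v /\ blimf outside G p v /\
    0 < v0 (va v) + v0 (vc v) * v0 (vc v) + v0 (vd v) * v0 (vd v))
  (s s' : sel) (z0 Z : R) (Hz0 : Z + 1 <= z0) (HZ : forall p, on_curve B p -> snd p <= Z).

Let pout : R -> R -> Prop := polar_dom z0 outside.
Let D1 r t := cur1 (polar_fields z0 F) s s' r t - cur1 (polar_fields z0 G) s s' r t.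
Let D2 r t := cur2 (polar_fields z0 F) s s' r t - cur2 (polar_fields z0 G) s s' r t.
Let W1 r t := if excluded_middle_informative (pout r t) then D1 r t else 0.
Let W2 r t := if excluded_middle_informative (pout r t) then D2 r t else 0.

Lemma good_cur_cont H r t : good H -> polar_dom z0 (ext2 B) r t ->
  cont2 (cur1 (polar_fields z0 H) s s') r t /\ cont2 (cur2 (polar_fields z0 H) s s') r t.
Proof.
  intros gH Hrt. pose proof (polar_fields_on z0 _ _ (ext2_open B) (good_on _ gH)) as (A & B' & C & D).
  pose proof (polar_dom_open z0 _ (ext2_open B)) as HO.
  apply cur_cont.
  - assert (K : forall j, jet_on (polar_dom z0 (ext2 B)) j -> jcont j r t).
    { intros j Hj. destruct (jet_cont _ j r t HO Hj Hrt) as (? & ? & ? & _). unfold jcont; auto. }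
    exact (conj (K _ A) (conj (K _ B') (conj (K _ C) (K _ D)))).
  - change (fX H (r * sin t) (z0 + r * cos t) <> 0). pose proof (good_pos _ gH _ _ Hrt). lra.
Qed.

Lemma pout_open : open2 pout.
Proof. apply polar_dom_open, outside_open. Qed.

(** Extending the difference by zero is continuous on the whole [(r, t)] plane, which the grid
    argument presupposes. The cases are: exterior off the axis, arc, exterior axis, and the rest. *)
Lemma W_cont r t : cont2 W1 r t /\ cont2 W2 r t.
Proof.
  destruct (excluded_middle_informative (pout r t)) as [Hin|Hout].
  { destruct (outside_ext2 _ _ Hin) as [He _].
    destruct (good_cur_cont F r t gF He) as [F1 F2]. destruct (good_cur_cont G r t gG He) as [G1 G2].
    destruct (pout_open r t Hin) as [d Hd]. split.
    - apply continuity_2d_pt_ext_loc with D1; [|unfold D1; cont2_auto].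
      exists d. intros u v Hu Hv. unfold W1. destruct (excluded_middle_informative _) as [h|h]; [reflexivity|].
      elim h. apply Hd; assumption.
    - apply continuity_2d_pt_ext_loc with D2; [|unfold D2; cont2_auto].
      exists d. intros u v Hu Hv. unfold W2. destruct (excluded_middle_informative _) as [h|h]; [reflexivity|].
      elim h. apply Hd; assumption. }
  assert (Ez : forall w1 w2, W1 = w1 -> W2 = w2 -> w1 r t = 0 /\ w2 r t = 0).
  { intros w1 w2 <- <-. unfold W1, W2. destruct (excluded_middle_informative _); [tauto|auto]. }
  (* On the arc both solutions are continued by the same constants [v]; each continued current is
     continuous at the point, and their difference vanishes outside the exterior, hence equals the
     extension by zero. *)
  destruct (classic (on_curve B (polar z0 r t))) as [Hc|Hc].
  { destruct (bdry _ Hc) as (v & BF & BG & BX).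
    assert (CF := starf_polar_cont outside z0 F v r t Hout BF).
    assert (CG := starf_polar_cont outside z0 G v r t Hout BG).
    assert (XX : forall H, fX (polar_fields z0 (starf outside H v)) r t <> 0).
    { intros H. unfold fX; simpl. unfold polar_fun, star.
      destruct (excluded_middle_informative _) as [h|h]; [elim Hout; exact h|]. lra. }
    destruct (cur_cont _ s s' r t CF (XX F)) as [F1 F2]. destruct (cur_cont _ s s' r t CG (XX G)) as [G1 G2].
    assert (E : forall u w, W1 u w = cur1 (polar_fields z0 (starf outside F v)) s s' u w -
        cur1 (polar_fields z0 (starf outside G v)) s s' u w /\
      W2 u w = cur2 (polar_fields z0 (starf outside F v)) s s' u w -
        cur2 (polar_fields z0 (starf outside G v)) s s' u w).
    { intros u w. unfold W1, W2, D1, D2. destruct (excluded_middle_informative (pout u w)) as [h|h].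
      - destruct (cur_eq_at _ _ s s' u w (starf_in outside z0 F v u w h)) as [-> ->].
        destruct (cur_eq_at _ _ s s' u w (starf_in outside z0 G v u w h)) as [-> ->]. auto.
      - destruct (cur_eq_at _ _ s s' u w (starf_out outside z0 F G v u w h)) as [-> ->]. split; ring. }
    split.
    - apply continuity_2d_pt_ext with (fun u w => cur1 (polar_fields z0 (starf outside F v)) s s' u w -
        cur1 (polar_fields z0 (starf outside G v)) s s' u w); [intros; symmetry; apply E|cont2_auto].
    - apply continuity_2d_pt_ext with (fun u w => cur2 (polar_fields z0 (starf outside F v)) s s' u w -
        cur2 (polar_fields z0 (starf outside G v)) s s' u w); [intros; symmetry; apply E|cont2_auto]. }
  (* At exterior points of the axis both currents are continuous and vanish. *)
  destruct (classic (polar_dom z0 (ext2 B) r t /\ 0 <= r * sin t)) as [[He Hp]|He].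
  { assert (H0 : r * sin t = 0).
    { destruct Hp as [Hp|Hp]; [|auto]. exfalso. apply Hout. unfold pout, polar_dom, outside. split; [|exact Hp].
      unfold polar_dom, ext2 in He. rewrite Rabs_pos_eq in He by lra. exact He. }
    destruct (good_cur_cont F r t gF He) as [F1 F2]. destruct (good_cur_cont G r t gG He) as [G1 G2].
    destruct (cur_zero z0 F s s' r t H0) as [ZF1 ZF2]. destruct (cur_zero z0 G s s' r t H0) as [ZG1 ZG2].
    assert (C1 : cont2 D1 r t) by (unfold D1; cont2_auto).
    assert (C2 : cont2 D2 r t) by (unfold D2; cont2_auto).
    assert (Z1 : D1 r t = 0) by (unfold D1; rewrite ZF1, ZG1; ring).
    assert (Z2 : D2 r t = 0) by (unfold D2; rewrite ZF2, ZG2; ring).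
    destruct (Ez _ _ eq_refl eq_refl) as [Y1 Y2].
    split; intros eps; [destruct (C1 eps) as [d Hd]|destruct (C2 eps) as [d Hd]]; exists d;
      intros u v Hu Hv; specialize (Hd u v Hu Hv); rewrite ?Y1, ?Y2; rewrite ?Z1, ?Z2 in Hd;
      unfold W1, W2; (destruct (excluded_middle_informative _); [exact Hd|]);
      rewrite Rminus_eq_0, Rabs_R0; apply cond_pos. }
  (* The remaining points have a whole neighbourhood outside the exterior, where the extension is
     zero. *)
  assert (Hn : locally_2d (fun u v => ~ outside u v) (r * sin t) (z0 + r * cos t)).
  { apply outside_closed_off_curve; [|exact Hc].
    destruct (Rle_or_lt 0 (r * sin t)) as [h|h]; [left|right; exact h]. intros He'. apply He. auto. }
  destruct (polar_locally _ z0 r t Hn) as [d Hd].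
  split; apply continuity_2d_pt_ext_loc with (fun _ _ => 0); try apply continuity_2d_pt_const;
    exists d; intros u v Hu Hv; specialize (Hd u v Hu Hv); change (~ pout u v) in Hd; unfold W1, W2;
    destruct (excluded_middle_informative _); tauto.
Qed.

Let bad r t := on_curve B (polar z0 r t) \/ (r = 0 \/ (t = 0 \/ t = PI)).

Lemma bad_not_pout r t : bad r t -> ~ pout r t.
Proof.
  intros H [He Hp]. simpl in Hp. destruct H as [H|[H|[H|H]]].
  - apply (exterior_off_curve B _ He). exact H.
  - rewrite H in Hp. lra.
  - rewrite H, sin_0 in Hp. lra.
  - rewrite H, sin_PI in Hp. lra.
Qed.

(** A segment in the [(r, t)] strip that avoids [bad] maps to a path off the arc and off the axis,
    so it cannot leave the exterior. *)
Lemma pout_segment r t r' t' :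
  (forall q, 0 <= q <= 1 -> 0 <= r + q * (r' - r) /\ 0 <= t + q * (t' - t) <= PI /\
     ~ bad (r + q * (r' - r)) (t + q * (t' - t))) ->
  pout r' t' -> pout r t.
Proof.
  intros H [He _].
  assert (Hs : forall q, 0 <= q <= 1 -> 0 < (r + q * (r' - r)) * sin (t + q * (t' - t))).
  { intros q Hq. destruct (H q Hq) as (A1 & A2 & A3). unfold bad in A3.
    apply Rmult_lt_0_compat.
    - destruct A1 as [A1|A1]; [exact A1|]. exfalso. apply A3. auto.
    - apply sin_gt_0.
      + destruct (proj1 A2) as [A|A]; [exact A|]. exfalso. apply A3. auto.
      + destruct (proj2 A2) as [A|A]; [exact A|]. exfalso. apply A3. auto. }
  split.
  - change (exterior B (polar z0 r t)).
    replace (polar z0 r t) with ((fun q => polar z0 (r + q * (r' - r)) (t + q * (t' - t))) 0)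
      by (cbv beta; f_equal; ring).
    apply (exterior_path B (fun q => polar z0 (r + q * (r' - r)) (t + q * (t' - t)))).
    + intros q. apply continuous_pair_R; apply (@ex_derive_continuous R_AbsRing R_NormedModule); auto_derive; auto.
    + intros q Hq. split; [left; apply Hs, Hq|]. destruct (H q Hq) as (_ & _ & A). unfold bad in A. tauto.
    + replace (polar z0 (r + 1 * (r' - r)) (t + 1 * (t' - t))) with (polar z0 r' t') by (f_equal; ring). exact He.
  - specialize (Hs 0 ltac:(lra)). simpl.
    replace (r + 0 * (r' - r)) with r in Hs by ring. replace (t + 0 * (t' - t)) with t in Hs by ring. exact Hs.
Qed.

(** A cell that avoids [bad] lies wholly in the exterior, where the difference is divergence free,
    or wholly outside it, where the extension is zero. The corner [(x1, y1)] decides which. *)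
Lemma flux_cell x1 x2 y1 y2 : 0 <= x1 <= x2 -> 0 <= y1 <= y2 -> y2 <= PI ->
  (forall x y, x1 <= x <= x2 -> y1 <= y <= y2 -> ~ bad x y) -> flux W1 W2 x1 x2 y1 y2 = 0.
Proof.
  intros Hx Hy Hy2 Hb.
  assert (Conn : forall x y x' y', x1 <= x <= x2 -> y1 <= y <= y2 -> x1 <= x' <= x2 -> y1 <= y' <= y2 ->
    pout x' y' -> pout x y).
  { intros x y x' y' A1 A2 A3 A4. apply pout_segment. intros q Hq.
    assert (C1 : x1 <= x + q * (x' - x) <= x2) by (destruct (Rle_dec x x'); split; nra).
    assert (C2 : y1 <= y + q * (y' - y) <= y2) by (destruct (Rle_dec y y'); split; nra).
    split; [lra|split; [lra|apply Hb; assumption]]. }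
  destruct (classic (pout x1 y1)) as [H|H].
  - pose proof (polar_fields_on z0 _ _ (ext2_open B) (good_on _ gF)) as PF.
    pose proof (polar_fields_on z0 _ _ (ext2_open B) (good_on _ gG)) as PG.
    pose proof (polar_dom_open z0 _ (ext2_open B)) as HO.
    set (dc1 := fun H : fields => dcurrent1 polar_weights H (sre s H) (sim s H) (sre s' H) (sim s' H)).
    set (dc2 := fun H : fields => dcurrent2 polar_weights H (sre s H) (sim s H) (sre s' H) (sim s' H)).
    assert (Key : forall H : fields, good H -> forall x y, pout x y ->
      is_derive (fun u => cur1 (polar_fields z0 H) s s' u y) x (dc1 (polar_fields z0 H) x y) /\
      is_derive (fun u => cur2 (polar_fields z0 H) s s' x u) y (dc2 (polar_fields z0 H) x y) /\
      cont2 (dc1 (polar_fields z0 H)) x y /\ cont2 (dc2 (polar_fields z0 H)) x y /\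
      dc1 (polar_fields z0 H) x y + dc2 (polar_fields z0 H) x y = 0).
    { intros K gK x y Hxy. destruct (outside_ext2 _ _ Hxy) as [He Hp].
      pose proof (polar_fields_on z0 _ _ (ext2_open B) (good_on _ gK)) as PK.
      pose proof (polar_ernst z0 K x y (good_ernst _ gK _ _ He Hp)) as EK.
      destruct (sel_on _ _ s PK) as [J1 J2]. destruct (sel_on _ _ s' PK) as [J3 J4].
      assert (XK : fX (polar_fields z0 K) x y <> 0) by (destruct EK as [P _]; lra).
      destruct (is_derive_current12 polar_weights (polar_fields z0 K) (polar_dom z0 (ext2 B)) _ _ _ _ x y
        polar_weights_ok PK J1 J2 J3 J4 He XK) as [Q1 Q2].
      destruct (current_cont polar_weights (polar_fields z0 K) (polar_dom z0 (ext2 B)) _ _ _ _ x y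
        HO polar_weights_ok PK J1 J2 J3 J4 He XK) as (_ & _ & _ & Q3 & Q4).
      split; [exact Q1|split; [exact Q2|split; [exact Q3|split; [exact Q4|]]]].
      apply current_conserved; [exact EK|apply sel_solves, EK|apply sel_solves, EK]. }
    apply (flux_div_free (fun x y => proj1 (W_cont x y)) (fun x y => proj2 (W_cont x y)) pout
      (fun x y => dc1 (polar_fields z0 F) x y - dc1 (polar_fields z0 G) x y)
      (fun x y => dc2 (polar_fields z0 F) x y - dc2 (polar_fields z0 G) x y)); try lra.
    + exact pout_open.
    + intros x y A1 A2. apply (Conn x y x1 y1); lra || assumption.
    + intros x y Hxy. destruct (Key F gF x y Hxy) as (F1 & F2 & F3 & F4 & F5).
      destruct (Key G gG x y Hxy) as (G1 & G2 & G3 & G4 & G5).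
      destruct (pout_open x y Hxy) as [d Hd].
      split; [|split; [|split; [|split]]].
      * apply is_derive_ext_loc with (fun u => D1 u y).
        { exists d. intros u Hu. unfold W1. destruct (excluded_middle_informative _) as [h|h]; [reflexivity|].
          elim h. apply Hd; [exact Hu|rewrite Rminus_eq_0, Rabs_R0; apply cond_pos]. }
        exact (is_derive_minus_R _ _ x _ _ F1 G1).
      * cont2_auto.
      * apply is_derive_ext_loc with (fun u => D2 x u).
        { exists d. intros u Hu. unfold W2. destruct (excluded_middle_informative _) as [h|h]; [reflexivity|].
          elim h. apply Hd; [rewrite Rminus_eq_0, Rabs_R0; apply cond_pos|exact Hu]. }
        exact (is_derive_minus_R _ _ y _ _ F2 G2).
      * cont2_auto.
      * lra.
  - assert (Zc : forall x y, x1 <= x <= x2 -> y1 <= y <= y2 -> W1 x y = 0 /\ W2 x y = 0).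
    { intros x y A1 A2. assert (N : ~ pout x y).
      { intros Hin. apply H. apply (Conn x1 y1 x y); lra || assumption. }
      unfold W1, W2. destruct (excluded_middle_informative _); [tauto|auto]. }
    apply Rabs_eq_0. apply Rle_antisym; [|apply Rabs_pos].
    replace 0 with (2 * 0 * ((x2 - x1) + (y2 - y1))) by ring.
    apply (flux_bound (fun x y => proj1 (W_cont x y)) (fun x y => proj2 (W_cont x y))); try lra.
    intros x y A1 A2. destruct (Zc x y A1 A2) as [-> ->]. rewrite Rabs_R0. lra.
Qed.

(** Applied to the rectangle [[0, R] x [0, PI]]: the sides [r = 0], [t = 0] and [t = PI] belong to
    [bad] and carry no flux, and the side [r = R] is the half circle. *)
Lemma flux_half_circle R : 0 < R -> (forall t, polar_dom z0 (ext2 B) R t) ->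
  RInt (fun t => cur1 (polar_fields z0 F) s s' R t) 0 PI =
  RInt (fun t => cur1 (polar_fields z0 G) s s' R t) 0 PI.
Proof.
  intros HR Hfar. pose proof PI_RGT_0 as HPI.
  assert (Wz : forall r t, bad r t -> W1 r t = 0 /\ W2 r t = 0).
  { intros r t Hb. apply bad_not_pout in Hb. unfold W1, W2.
    destruct (excluded_middle_informative _); [tauto|auto]. }
  assert (HG : flux W1 W2 0 R 0 PI = 0).
  { apply (thin_goursat W1 W2 bad); try assumption.
    - intros; apply W_cont.
    - intros; apply W_cont.
    - intros; apply flux_cell; try lra; assumption.
    - apply thin_sub with (fun r t => (0 <= r /\ 0 <= t <= PI /\ on_curve B (polar z0 r t)) \/
        ((r = 0 /\ 0 <= t <= PI) \/ ((0 <= r <= R /\ t = 0) \/ (0 <= r <= R /\ t = PI)))).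
      + unfold bad. intros x y. tauto.
      + apply thin_union; [apply (curve_thin B z0 Z Hz0 HZ)|].
        apply thin_union; [apply thin_vertical, HPI|].
        apply thin_union; apply thin_horizontal, HR. }
  assert (Z0 : forall f a b, (forall x, f x = 0) -> RInt f a b = 0).
  { intros f a b Hf. rewrite (RInt_ext f (fun _ => 0)) by (intros; apply Hf).
    rewrite RInt_const. apply Rmult_0_r. }
  unfold flux in HG.
  rewrite (Z0 (fun y => W1 0 y)), (Z0 (fun x => W2 x PI)), (Z0 (fun x => W2 x 0)) in HG;
    try (intros; apply Wz; unfold bad; tauto).
  assert (E : RInt (fun y => W1 R y) 0 PI = RInt (fun t => D1 R t) 0 PI).
  { apply RInt_ext. intros t Ht. rewrite Rmin_left, Rmax_right in Ht by lra.
    unfold W1. destruct (excluded_middle_informative _) as [h|h]; [reflexivity|]. elim h.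
    assert (P : 0 < R * sin t) by (apply Rmult_lt_0_compat; [exact HR|apply sin_gt_0; lra]).
    split; [|exact P]. specialize (Hfar t). unfold polar_dom, ext2 in Hfar.
    rewrite Rabs_pos_eq in Hfar by lra. exact Hfar. }
  assert (E2 : RInt (fun t => D1 R t) 0 PI = RInt (fun t => cur1 (polar_fields z0 F) s s' R t) 0 PI -
    RInt (fun t => cur1 (polar_fields z0 G) s s' R t) 0 PI).
  { apply (@RInt_minus R_CompleteNormedModule); apply ex_RInt_far; intros t;
      apply good_cur_cont; auto. }
  rewrite E, E2 in HG. lra.
Qed.

End Transfer.

(** * Asymptotics of a solution *)

(** Triangle inequality for the distances to the origin and to the shifted centre. *)
Lemma radius_polar z0 r t : 0 <= r -> Rabs (radius (Rabs (r * sin t), z0 + r * cos t) - r) <= Rabs z0.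
Proof.
  intros Hr. unfold radius; simpl fst; simpl snd.
  pose proof (sin2_cos2 t) as S. unfold Rsqr in S. pose proof (COS_bound t) as C.
  pose proof (Rabs_pos z0) as Pz.
  assert (E : Rabs (r * sin t) ^ 2 + (z0 + r * cos t) ^ 2 = r ^ 2 + 2 * r * (z0 * cos t) + z0 ^ 2).
  { rewrite pow2_abs. transitivity (r ^ 2 * (sin t * sin t + cos t * cos t) + 2 * r * (z0 * cos t) + z0 ^ 2);
      [ring|rewrite S; ring]. }
  rewrite E.
  assert (Hzc : Rabs (z0 * cos t) <= Rabs z0).
  { rewrite Rabs_mult. rewrite <- (Rmult_1_r (Rabs z0)) at 2. apply Rmult_le_compat_l; [exact Pz|].
    apply Rabs_le_between. exact C. }
  apply Rabs_le_between in Hzc. rewrite <- (pow2_abs z0).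
  set (q := r ^ 2 + 2 * r * (z0 * cos t) + Rabs z0 ^ 2).
  assert (U : q <= (r + Rabs z0) ^ 2) by (unfold q; nra).
  assert (Lo : (r - Rabs z0) ^ 2 <= q) by (unfold q; nra).
  apply Rabs_le_between. split.
  - assert (r - Rabs z0 <= sqrt q); [|lra].
    destruct (Rle_dec (r - Rabs z0) 0) as [h|h]; [apply Rle_trans with (1 := h), sqrt_pos|].
    rewrite <- (sqrt_pow2 (r - Rabs z0)) by lra. apply sqrt_le_1_alt, Lo.
  - assert (sqrt q <= r + Rabs z0); [|lra].
    rewrite <- (sqrt_pow2 (r + Rabs z0)) by lra. apply sqrt_le_1_alt, U.
Qed.

Lemma exp_second_order x : Rabs x <= 1 / 2 -> Rabs (exp x - 1 - x) <= 2 * (x * x).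
Proof.
  intros H. apply Rabs_le_between in H.
  pose proof (exp_ineq1_le x) as A. pose proof (exp_ineq1_le (- x)) as C.
  assert (E : exp x * exp (- x) = 1) by (rewrite <- exp_plus, Rplus_opp_r; apply exp_0).
  pose proof (exp_pos x) as P. pose proof (Rle_0_sqr x) as Sq. unfold Rsqr in Sq.
  assert (Q : exp x * (1 - x) <= 1) by (rewrite <- E; apply Rmult_le_compat_l; lra).
  apply Rabs_le_between. split; [lra|].
  assert (exp x <= 1 + x + 2 * (x * x)); [|lra].
  apply (Rmult_le_reg_r (1 - x)); [lra|]. apply Rle_trans with (1 := Q).
  replace ((1 + x + 2 * (x * x)) * (1 - x)) with (1 + x * x * (1 - 2 * x)) by ring.
  assert (0 <= x * x * (1 - 2 * x)) by (apply Rmult_le_pos; lra). lra.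
Qed.

Section Asymptotics.
Context (B : boundary_curve).

(** The sign of [m] follows the decay conditions: the coefficient of [1 / radius] is [- m]. *)
Definition newtonian (g : R * R -> R) (m : R) : Prop :=
  exists K R0, 0 <= K /\ 1 <= R0 /\ forall p, exterior B p -> R0 < radius p ->
    Rabs (g p + m * / radius p) <= K * (/ radius p * / radius p).

Lemma bigO_newtonian g m h : bigO B 2 h -> (forall p, 0 < radius p -> Rabs (g p + m * / radius p) <= Rabs (h p)) ->
  newtonian g m.
Proof.
  intros (K & R0 & HR & H) Hg. exists (Rabs K), (R0 + 1). split; [apply Rabs_pos|split; [lra|]].
  intros p Hp Hr. specialize (H p Hp ltac:(lra)). apply Rle_trans with (1 := Hg p ltac:(lra)).
  apply Rle_trans with (1 := H).
  replace (K / radius p ^ 2) with (K * (/ radius p * / radius p)) by (field; lra).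
  assert (0 < / radius p) by (apply Rinv_0_lt_compat; lra).
  apply Rmult_le_compat_r; [apply Rmult_le_pos; lra|apply Rle_abs].
Qed.

(** Moving the centre to [(0, z0)] changes [1 / radius] only by [O(r^-2)], so the leading
    coefficient survives. *)
Lemma newtonian_appr2 z0 g m : newtonian g m ->
  appr2 (polar_fun z0 (fun x z => g (Rabs x, z))) 0 (- m).
Proof.
  intros (K & R0 & HK & HR & H).
  destruct (exterior_far B) as (Rf & PRf & Hf).
  pose proof (Rabs_pos z0) as Pz. pose proof (Rabs_pos m) as Pm.
  exists (4 * K + 2 * Rabs m * Rabs z0), (R0 + Rf + 2 * Rabs z0).
  split; [|split; [lra|]].
  { assert (0 <= Rabs m * Rabs z0) by (apply Rmult_le_pos; assumption). lra. }
  intros r t Hr. unfold polar_fun.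
  pose proof (radius_polar z0 r t ltac:(lra)) as HQ.
  set (p := (Rabs (r * sin t), z0 + r * cos t)) in *. set (q := radius p) in *.
  apply Rabs_le_between in HQ.
  assert (Hq : r / 2 <= q) by lra. 
  assert (He : exterior B p) by (apply Hf; [apply Rabs_pos|fold q; lra]).
  specialize (H p He ltac:(fold q; lra)). fold q in H.
  assert (Pi : 0 < / q) by (apply Rinv_0_lt_compat; lra). assert (Pr : 0 < / r) by (apply Rinv_0_lt_compat; lra).
  assert (Hi : / q <= 2 * / r).
  { replace (2 * / r) with (/ (r / 2)) by (field; lra). apply Rinv_le_contravar; lra. }
  replace (g p - 0 - - m / r) with ((g p + m * / q) + m * (/ r - / q)) by (unfold Rdiv; ring).
  apply Rle_trans with (1 := Rabs_triang _ _).
  replace ((4 * K + 2 * Rabs m * Rabs z0) / (r * r)) with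
    (K * (2 * / r * (2 * / r)) + Rabs m * (Rabs z0 * (2 * / r) * / r)) by (field; lra).
  apply Rplus_le_compat.
  - apply Rle_trans with (1 := H). apply Rmult_le_compat_l; [exact HK|]. apply Rmult_le_compat; lra.
  - rewrite Rabs_mult. apply Rmult_le_compat_l; [exact Pm|].
    replace (/ r - / q) with ((q - r) * (/ q * / r)) by (field; lra).
    rewrite Rabs_mult, (Rabs_pos_eq (/ q * / r)) by (apply Rmult_le_pos; lra).
    rewrite Rmult_assoc. apply Rmult_le_compat; [apply Rabs_pos|apply Rmult_le_pos; lra| |].
    + apply Rabs_le_between. lra.
    + apply Rmult_le_compat_r; lra.
Qed.

(** The angular momentum term is itself [O(r^-2)], so the twist has no coefficient of [1 / r]. *)
Lemma newtonian_Omega h J : bigO B 3 (fun p => h p - (- (2 * snd p * J) / radius p ^ 3)) -> newtonian h 0.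
Proof.
  intros (K & R0 & HR & H). exists (Rabs K + 2 * Rabs J), (R0 + 1).
  pose proof (Rabs_pos K). pose proof (Rabs_pos J). split; [lra|split; [lra|]].
  intros p Hp Hr. specialize (H p Hp ltac:(lra)).
  assert (Hz : Rabs (snd p) <= radius p).
  { unfold radius. rewrite <- sqrt_Rsqr_abs. apply sqrt_le_1_alt. unfold Rsqr. nra. }
  set (q := radius p) in *. assert (Pi : 0 < / q) by (apply Rinv_0_lt_compat; lra).
  assert (Pi1 : / q <= 1) by (rewrite <- Rinv_1; apply Rinv_le_contravar; lra).
  replace (h p + 0 * / q) with ((h p - - (2 * snd p * J) / q ^ 3) + - (2 * (snd p * J) * / q ^ 3)) by (field; lra).
  apply Rle_trans with (1 := Rabs_triang _ _). rewrite Rabs_Ropp.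
  assert (E3 : / q ^ 3 = / q * / q * / q) by (field; lra).
  assert (P3 : 0 <= / q * / q) by (apply Rmult_le_pos; lra).
  rewrite Rmult_plus_distr_r. apply Rplus_le_compat.
  - apply Rle_trans with (1 := H). unfold Rdiv. rewrite E3.
    apply Rle_trans with (Rabs K * (/ q * / q * / q)).
    + apply Rmult_le_compat_r; [apply Rmult_le_pos; lra|apply Rle_abs].
    + apply Rmult_le_compat_l; [lra|]. rewrite <- (Rmult_1_r (/ q * / q)) at 2.
      apply Rmult_le_compat_l; lra.
  - rewrite E3, !Rabs_mult, (Rabs_pos_eq 2), !(Rabs_pos_eq (/ q)) by lra.
    replace (2 * Rabs J * (/ q * / q)) with (2 * (q * Rabs J) * (/ q * / q * / q)) by (field; lra).
    apply Rmult_le_compat_r; [apply Rmult_le_pos; lra|].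
    apply Rmult_le_compat_l; [lra|]. apply Rmult_le_compat_r; assumption.
Qed.

Lemma newtonian_L L Q : bigO B 2 (fun p => Cmod (L p - (- Q / RtoC (radius p)))) ->
  newtonian (fun p => Re (L p)) (Re Q) /\ newtonian (fun p => Im (L p)) (Im Q).
Proof.
  intros H.
  assert (E : forall p, 0 < radius p -> (L p - (- Q / RtoC (radius p)))%C =
    (Re (L p) + Re Q * / radius p, Im (L p) + Im Q * / radius p)).
  { intros p Hp. unfold Cdiv. rewrite <- RtoC_inv by lra. destruct (L p) as [x y]. destruct Q as [u v].
    unfold Cminus, Cplus, Copp, Cmult, RtoC, Re, Im; simpl. f_equal; ring. }
  split; apply (bigO_newtonian _ _ _ H); intros p Hp; rewrite (Rabs_pos_eq (Cmod _)) by apply Cmod_ge_0;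
    rewrite (E p Hp).
  - exact (Rle_trans _ _ _ (Rmax_l _ _) (Rmax_Cmod (Re (L p) + Re Q * / radius p, Im (L p) + Im Q * / radius p))).
  - exact (Rle_trans _ _ _ (Rmax_r _ _) (Rmax_Cmod (Re (L p) + Re Q * / radius p, Im (L p) + Im Q * / radius p))).
Qed.

(** [Re E = exp (2 U) - |L|^2], where [|L|^2 = O(r^-2)] and the exponential is expanded to first
    order. *)
Lemma newtonian_E E L M cr ci :
  (forall p, exterior B p -> ernst_N (E p) (L p) < 0) ->
  newtonian (fun p => Re (L p)) cr -> newtonian (fun p => Im (L p)) ci ->
  bigO B 2 (fun p => ernst_U E L p - (- M / radius p)) ->
  newtonian (fun p => Re (E p) - 1) (2 * M).
Proof.
  intros HN (K1 & R1 & P1 & L1 & H1) (K2 & R2 & P2 & L2 & H2) HU.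
  assert (NU : newtonian (ernst_U E L) M).
  { apply (bigO_newtonian _ _ _ HU). intros p Hp. right. f_equal. field. lra. }
  destruct NU as (K & R0 & PK & PR & H).
  pose proof (Rabs_pos M) as PM. pose proof (Rabs_pos cr) as Pcr. pose proof (Rabs_pos ci) as Pci.
  set (m := Rabs M + K). set (n1 := Rabs cr + K1). set (n2 := Rabs ci + K2).
  (* Beyond [4 * m] one has [|2 U| <= 1/2], as [exp_second_order] requires. The terms bound its
     remainder, the error in [2 U], and the two squares in [|L|^2]. *)
  exists (8 * (m * m) + 2 * K + n1 * n1 + n2 * n2), (R0 + R1 + R2 + 4 * m).
  assert (0 <= m * m) by (apply Rle_0_sqr). assert (0 <= n1 * n1) by (apply Rle_0_sqr).
  assert (0 <= n2 * n2) by (apply Rle_0_sqr).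
  assert (Pm : 0 <= m) by (unfold m; lra).
  split; [lra|split; [lra|]]. intros p Hp Hr.
  specialize (H p Hp ltac:(lra)). specialize (H1 p Hp ltac:(lra)). specialize (H2 p Hp ltac:(lra)).
  specialize (HN p Hp). set (q := radius p) in *.
  assert (Pi : 0 < / q) by (apply Rinv_0_lt_compat; lra).
  assert (Pi1 : / q <= 1) by (rewrite <- Rinv_1; apply Rinv_le_contravar; lra).
  assert (Dec : forall g c k, 0 <= k -> Rabs (g + c * / q) <= k * (/ q * / q) -> Rabs g <= (Rabs c + k) * / q).
  { intros g c k Hk Hg. replace g with ((g + c * / q) + - (c * / q)) by ring.
    apply Rle_trans with (1 := Rabs_triang _ _). rewrite Rabs_Ropp, Rabs_mult, (Rabs_pos_eq (/ q)) by lra.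
    assert (k * (/ q * / q) <= k * / q).
    { apply Rmult_le_compat_l; [exact Hk|]. rewrite <- (Rmult_1_r (/ q)) at 3. apply Rmult_le_compat_l; lra. }
    lra. }
  assert (D0 := Dec _ _ _ PK H). assert (D1 := Dec _ _ _ P1 H1). assert (D2 := Dec _ _ _ P2 H2).
  fold m in D0. fold n1 in D1. fold n2 in D2.
  set (U := ernst_U E L p) in *.
  assert (EX : exp (2 * U) = - ernst_N (E p) (L p)).
  { unfold U, ernst_U. replace (2 * (/ 2 * ln (- ernst_N (E p) (L p)))) with (ln (- ernst_N (E p) (L p))) by field.
    apply exp_ln. lra. }
  assert (ER : Re (E p) = exp (2 * U) - (Re (L p) * Re (L p) + Im (L p) * Im (L p))).
  { rewrite EX. unfold ernst_N. rewrite Cmod_sq. ring. }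
  rewrite ER.
  assert (HU2 : Rabs (2 * U) <= 2 * m * / q).
  { rewrite Rabs_mult, (Rabs_pos_eq 2) by lra. lra. }
  assert (Hsmall : Rabs (2 * U) <= 1 / 2).
  { apply Rle_trans with (1 := HU2). apply (Rmult_le_reg_r q); [lra|].
    rewrite Rmult_assoc, Rinv_l by lra. lra. }
  pose proof (exp_second_order _ Hsmall) as HE.
  assert (S : forall g n, Rabs g <= n * / q -> Rabs (g * g) <= n * n * (/ q * / q)).
  { intros g n Hg. replace (n * n * (/ q * / q)) with (n * / q * (n * / q)) by ring.
    apply Rabs_mult_le; exact Hg. }
  apply S in HU2. apply S in D1. apply S in D2.
  rewrite (Rabs_pos_eq (2 * U * (2 * U))) in HU2 by apply Rle_0_sqr.
  apply Rabs_le_between in HE. apply Rabs_le_between in D1. apply Rabs_le_between in D2.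
  apply Rabs_le_between in H. apply Rabs_le_between. lra.
Qed.
End Asymptotics.

(** Put [Q = p + i q] and [mu = lambda - lambda']. The first equalities give [conj mu Q = M' - M], a
    real number; the last two, multiplied by [conj Q], express [A] and [W] through [M' - M].
    Comparing [A] with its definition by [|lambda|^2] leaves a factor [M + M'], which is
    positive. *)
Lemma charges_determine_gauge l1 l2 om M p q l1' l2' om' M' p' q' :
  0 < M -> 0 < M' ->
  let ka := - (2 * M) - 2 * l1 * p - 2 * l2 * q in let ka' := - (2 * M') - 2 * l1' * p' - 2 * l2' * q' in
  let kb := - 2 * l1 * q + 2 * l2 * p in let kb' := - 2 * l1' * q' + 2 * l2' * p' in
  let ea := 1 - (l1 * l1 + l2 * l2) in let ea' := 1 - (l1' * l1' + l2' * l2') in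
  ka = ka' -> kb = kb' -> p = p' -> q = q' ->
  ea * kb - - om * ka = ea' * kb' - - om' * ka' ->
  - (ea * p) + l1 * ka + om * q + l2 * kb = - (ea' * p') + l1' * ka' + om' * q' + l2' * kb' ->
  - (ea * q) + l2 * ka - om * p - l1 * kb = - (ea' * q') + l2' * ka' - om' * p' - l1' * kb' ->
  l1 = l1' /\ l2 = l2' /\ om = om'.
Proof.
  intros PM PM' ka ka' kb kb' ea ea' Ka Kb <- <- H1 H2 H3.
  rewrite <- Ka, <- Kb in H1, H2, H3.
  set (x := l1 - l1'). set (y := l2 - l2'). set (A := ea - ea'). set (W := om - om').
  assert (E1 : x * p + y * q = M' - M) by (unfold x, y, ka, ka' in *; lra).
  assert (E2 : x * q = y * p) by (unfold x, y, kb, kb' in *; lra).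
  assert (E3 : A * kb + W * ka = 0) by (unfold A, W; lra).
  assert (E4 : - A * p + x * ka + W * q + y * kb = 0) by (unfold A, W, x, y; lra).
  assert (E5 : - A * q + y * ka - W * p - x * kb = 0) by (unfold A, W, x, y; lra).
  assert (E6 : A * (p * p + q * q) = ka * (M' - M)).
  { rewrite <- E1. assert (Z : p * (- A * p + x * ka + W * q + y * kb) + q * (- A * q + y * ka - W * p - x * kb) = 0)
      by (rewrite E4, E5; ring).
    assert (Z2 : kb * (y * p - x * q) = 0) by (rewrite E2; ring). lra. }
  assert (E7 : W * (p * p + q * q) = - kb * (M' - M)).
  { rewrite <- E1. assert (Z : q * (- A * p + x * ka + W * q + y * kb) - p * (- A * q + y * ka - W * p - x * kb) = 0)
      by (rewrite E4, E5; ring).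
    assert (Z2 : ka * (x * q - y * p) = 0) by (rewrite E2; ring). lra. }
  assert (EA : A = - 2 * (l1 * x + l2 * y) + (x * x + y * y)) by (unfold A, ea, ea', x, y; ring).
  assert (Fin : x = 0 /\ y = 0 /\ W = 0); [|unfold x, y, W in Fin; lra].
  (* Without charge [ka = - 2 * M] and [kb = 0], and the equations yield the differences after
     division by the mass. *)
  destruct (Req_dec (p * p + q * q) 0) as [Z|NZ].
  - pose proof (Rle_0_sqr p) as Sp. pose proof (Rle_0_sqr q) as Sq. unfold Rsqr in Sp, Sq.
    assert (p = 0) by (apply Rsqr_0_uniq; unfold Rsqr; lra).
    assert (q = 0) by (apply Rsqr_0_uniq; unfold Rsqr; lra).
    subst p q. assert (Eka : ka = - 2 * M) by (unfold ka; ring). assert (Ekb : kb = 0) by (unfold kb; ring).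
    rewrite Eka, Ekb in *.
    assert (x = 0) by (apply (Rmult_eq_reg_r (- 2 * M)); lra).
    assert (y = 0) by (apply (Rmult_eq_reg_r (- 2 * M)); lra).
    assert (W = 0) by (apply (Rmult_eq_reg_r (- 2 * M)); lra). auto.
  - set (s := p * p + q * q) in *. set (k := (M' - M) / s).
    assert (Ks : k * s = M' - M) by (unfold k; field; exact NZ).
    assert (Ex : x = k * p).
    { apply (Rmult_eq_reg_r s); [|exact NZ]. rewrite (Rmult_comm k p), Rmult_assoc, Ks, <- E1. unfold s.
      transitivity (p * (x * p) + q * (x * q)); [ring|rewrite E2; ring]. }
    assert (Ey : y = k * q).
    { apply (Rmult_eq_reg_r s); [|exact NZ]. rewrite (Rmult_comm k q), Rmult_assoc, Ks, <- E1. unfold s.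
      transitivity (p * (y * p) + q * (y * q)); [ring|rewrite <- E2; ring]. }
    assert (EA2 : A = ka * k).
    { apply (Rmult_eq_reg_r s); [|exact NZ]. rewrite E6, <- Ks. ring. }
    (* [A] is [ka * k] by the charges and [- 2 k Re (conj lambda Q) + k^2 s] by definition; the
       terms with [lambda] cancel and leave [k * k * s = - (2 * M) * k]. *)
    assert (Q : k * (M + M') = 0).
    { transitivity (k * (2 * M + k * s)); [rewrite Ks; ring|].
      rewrite EA2 in EA. rewrite Ex, Ey in EA.
      assert (k * k * s = - (2 * M) * k); [|lra].
      unfold ka in EA. unfold s. lra. }
    assert (k = 0) by (destruct (Rmult_integral _ _ Q); lra).
    assert (M' - M = 0) by (rewrite <- Ks, H; ring).
    split; [rewrite Ex, H; ring|split; [rewrite Ey, H; ring|]].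
    apply (Rmult_eq_reg_r s); [|exact NZ]. rewrite E7, H0. ring.
Qed.

(** Serves both the limits at infinity, with [o = 1], and the coefficients of [1 / r], with
    [o = 0]. *)
Definition selr (s : sel) (o a b c d : R) : R :=
  match s with SOne => o | SE => a | SL => c | SiE => b | SiL => d end.
Definition seli (s : sel) (a b c d : R) : R :=
  match s with SOne => 0 | SE => b | SL => d | SiE => - a | SiL => - c end.

Definition charge (s s' : sel) (ea eb ec ed ka kb kc kd : R) : R :=
  selr s 1 ea eb ec ed * selr s' 0 ka kb kc kd - selr s' 1 ea eb ec ed * selr s 0 ka kb kc kd +
  seli s ea eb ec ed * seli s' ka kb kc kd - seli s' ea eb ec ed * seli s ka kb kc kd.

(** * Boundary data and charges of a solution with its gauge undone *)

Section Solution.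
Context (B : boundary_curve) (d : cauchy_data B) (om : R) (lam : C) (E L : R * R -> C) (M J : R) (Q : C)
  (HS : solution_for (cauchy_family d om lam) E L M J Q).

Let l1 := Re lam.
Let l2 := Im lam.
Let F := gauge l1 l2 om (comp_fields E L).

Lemma solution_good : good B F.
Proof.
  destruct HS as (H & _). destruct (comp_fields_ernst B E L H) as [P1 P2].
  split.
  - apply gauge_on, comp_fields_on, H.
  - intros x z Hxz. unfold F. rewrite gauge_fX. apply P1, Hxz.
  - intros x z Hxz Hx. apply gauge_ernst, P2; assumption.
Qed.

Lemma boundary_value_blim f (b : boundary_point B) v u1 u2 : boundary_value B f b v ->
  (forall x z, outside B x z -> f (x, z) = (u1 x z, u2 x z)) ->
  blim (outside B) u1 (proj1_sig b) (Re v) /\ blim (outside B) u2 (proj1_sig b) (Im v).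
Proof.
  intros H Hf.
  assert (K : forall eps : posreal, exists d : posreal, forall x z, outside B x z ->
    Rabs (x - fst (proj1_sig b)) < d -> Rabs (z - snd (proj1_sig b)) < d ->
    Rabs (u1 x z - Re v) < eps /\ Rabs (u2 x z - Im v) < eps).
  { intros eps. destruct (proj1 (filterlim_locally f v) H eps) as [e He]. exists e.
    intros x z Ho Hx Hz. destruct (He (x, z) (conj Hx Hz) Ho) as [A1 A2]. rewrite (Hf x z Ho) in A1, A2.
    split; [exact A1|exact A2]. }
  split; intros eps; destruct (K eps) as [e He]; exists e; intros x z Ho Hx Hz; apply (He x z); assumption.
Qed.

Lemma blimj_ext Om j p v w : blimj Om j p v -> v0 v = v0 w -> v1 v = v1 w -> v2 v = v2 w -> blimj Om j p w.
Proof. intros (A0 & A1 & A2) E0 E1 E2. unfold blimj. rewrite <- E0, <- E1, <- E2. auto. Qed.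

Definition data_vals (b : boundary_point B) : fvals :=
  FV (JV (Re (data_E (fst d) b)) (Re (fst (data_dE (snd d) b))) (Re (snd (data_dE (snd d) b))))
     (JV (Im (data_E (fst d) b)) (Im (fst (data_dE (snd d) b))) (Im (snd (data_dE (snd d) b))))
     (JV (Re (data_L (fst d) b)) (Re (fst (data_dL (snd d) b))) (Re (snd (data_dL (snd d) b))))
     (JV (Im (data_L (fst d) b)) (Im (fst (data_dL (snd d) b))) (Im (snd (data_dL (snd d) b)))).

(** The inverse gauge transformation cancels the one in [cauchy_family], so the limits depend on [d]
    alone and are common to all solutions of the family. Positivity is the timelike condition on the
    data, which is gauge invariant. *)
Lemma solution_boundary (b : boundary_point B) :
  blimf (outside B) F (proj1_sig b) (data_vals b) /\
  0 < v0 (va (data_vals b)) + v0 (vc (data_vals b)) * v0 (vc (data_vals b)) +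
      v0 (vd (data_vals b)) * v0 (vd (data_vals b)).
Proof.
  destruct HS as (_ & _ & HA & HN). destruct (HA b) as (A1 & A2 & A3 & A4 & A5 & A6). specialize (HN b).
  unfold data_vals. simpl in *.
  assert (V : forall (f : R * R -> C) x z, outside B x z ->
    f (x, z) = (j0 (comp_jet (fun p => Re (f p))) x z, j0 (comp_jet (fun p => Im (f p))) x z) /\
    d_rho f (x, z) = (j1 (comp_jet (fun p => Re (f p))) x z, j1 (comp_jet (fun p => Im (f p))) x z) /\
    d_z f (x, z) = (j2 (comp_jet (fun p => Re (f p))) x z, j2 (comp_jet (fun p => Im (f p))) x z)).
  { intros f x z [_ Hx]. simpl in Hx. rewrite !comp_jet_0, Rabs_pos_eq by lra.
    split; [destruct (f (x, z)); reflexivity|split; [apply d_rho_comp, Hx|apply d_z_comp, Hx]]. }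
  destruct (boundary_value_blim _ _ _ _ _ A1 (fun x z H => proj1 (V E x z H))) as [Ea0 Eb0].
  destruct (boundary_value_blim _ _ _ _ _ A2 (fun x z H => proj1 (V L x z H))) as [Ec0 Ed0].
  destruct (boundary_value_blim _ _ _ _ _ A3 (fun x z H => proj1 (proj2 (V E x z H)))) as [Ea1 Eb1].
  destruct (boundary_value_blim _ _ _ _ _ A4 (fun x z H => proj2 (proj2 (V E x z H)))) as [Ea2 Eb2].
  destruct (boundary_value_blim _ _ _ _ _ A5 (fun x z H => proj1 (proj2 (V L x z H)))) as [Ec1 Ed1].
  destruct (boundary_value_blim _ _ _ _ _ A6 (fun x z H => proj2 (proj2 (V L x z H)))) as [Ec2 Ed2].
  pose proof (conj Ea0 (conj Ea1 Ea2) :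
    blimj (outside B) (ja (comp_fields E L)) (proj1_sig b) (JV _ _ _)) as Ja.
  pose proof (conj Eb0 (conj Eb1 Eb2) :
    blimj (outside B) (jb (comp_fields E L)) (proj1_sig b) (JV _ _ _)) as Jb.
  pose proof (conj Ec0 (conj Ec1 Ec2) :
    blimj (outside B) (jc (comp_fields E L)) (proj1_sig b) (JV _ _ _)) as Jc.
  pose proof (conj Ed0 (conj Ed1 Ed2) :
    blimj (outside B) (jd (comp_fields E L)) (proj1_sig b) (JV _ _ _)) as Jd.
  clear V A1 A2 A3 A4 A5 A6 Ea0 Eb0 Ec0 Ed0 Ea1 Eb1 Ec1 Ed1 Ea2 Eb2 Ec2 Ed2 HA.
  revert HN Ja Jb Jc Jd. unfold F, l1, l2. clear F l1 l2 HS.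
  destruct (data_E (fst d) b) as [e1 e2]. destruct (data_L (fst d) b) as [n1 n2].
  destruct (data_dE (snd d) b) as [[f1 f2] [f3 f4]]. destruct (data_dL (snd d) b) as [[m1 m2] [m3 m4]].
  destruct lam as [k1 k2].
  unfold ernst_N. rewrite Cmod_sq.
  unfold Cminus, Cplus, Copp, Cmult, Cconj, Ci, RtoC, Re, Im; simpl. intros HN Ja Jb Jc Jd.
  split.
  - split; [|split; [|split]]; simpl.
    + eapply blimj_ext;
        [exact (blimj_lin _ _ _ _ _ _ _ _ (blimj_lin _ _ _ _ _ _ _ _ Ja (blimj_lin _ _ _ _ _ _ _ _ Jc Jd))
          (blimj_lin _ _ _ _ _ _ _ _ (blimj_const _ _ _) (blimj_const _ _ _)))|simpl; ring..].
    + eapply blimj_ext;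
        [exact (blimj_lin _ _ _ _ _ _ _ _ (blimj_lin _ _ _ _ _ _ _ _ Jb (blimj_lin _ _ _ _ _ _ _ _ Jd Jc))
          (blimj_lin _ _ _ _ _ _ _ _ (blimj_const _ _ _) (blimj_const _ _ _)))|simpl; ring..].
    + eapply blimj_ext;
        [exact (blimj_lin _ _ _ _ _ _ _ _ Jc (blimj_lin _ _ _ _ _ _ _ _ (blimj_const _ _ _) (blimj_const _ _ _)))|simpl; ring..].
    + eapply blimj_ext;
        [exact (blimj_lin _ _ _ _ _ _ _ _ Jd (blimj_lin _ _ _ _ _ _ _ _ (blimj_const _ _ _) (blimj_const _ _ _)))|simpl; ring..].
  - match type of HN with ?x < 0 => match goal with |- 0 < ?y => replace y with (- x) by ring end end. lra.
Qed.

(** Undoing the gauge shifts the limits of [E] and [L] from [1] and [0] to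
    [1 - |lambda|^2 - i omega] and [- lambda], and mixes [2 conj lambda Q] into the coefficient of
    [1 / r] of [E]. *)
Lemma solution_charge z0 s s' :
  has_charge (fun r => RInt (fun t => cur1 (polar_fields z0 F) s s' r t) 0 PI)
    (charge s s' (1 - (l1 * l1 + l2 * l2)) (- om) (- l1) (- l2)
      (- (2 * M) - 2 * l1 * Re Q - 2 * l2 * Im Q) (- 2 * l1 * Im Q + 2 * l2 * Re Q) (- Re Q) (- Im Q)).
Proof.
  set (ea := 1 - (l1 * l1 + l2 * l2)). set (ka := - (2 * M) - 2 * l1 * Re Q - 2 * l2 * Im Q).
  set (kb := - 2 * l1 * Im Q + 2 * l2 * Re Q).
  pose proof solution_good as gF.
  destruct HS as ((_ & _ & HN & _) & (DU & DO & DL) & _).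
  destruct (newtonian_L B L Q DL) as [Nc Nd]. pose proof (newtonian_Omega B _ J DO) as Nb.
  pose proof (newtonian_E B E L M _ _ HN Nc Nd DU) as Na.
  apply (newtonian_appr2 B z0) in Na, Nb, Nc, Nd.
  pose proof (appr2_lin 1 _ _ _ 1 _ _ _ Na (appr2_const 1)) as Na'.
  assert (P0 : forall (f : R * R -> R) r t, polar_fun z0 (j0 (comp_jet f)) r t = polar_fun z0 (fun x z => f (Rabs x, z)) r t).
  { intros f r t. unfold polar_fun. apply comp_jet_0. }
  assert (Ca : appr2 (polar_fun z0 (j0 (ja (comp_fields E L)))) 1 (- (2 * M))).
  { apply (appr2_ext _ _ _ _ _ _ Na').
    - intros r t. unfold comp_fields, ja. rewrite P0. unfold polar_fun. ring.
    - ring.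
    - ring. }
  assert (Cb : appr2 (polar_fun z0 (j0 (jb (comp_fields E L)))) 0 0).
  { apply (appr2_ext _ _ _ _ _ _ Nb); [|ring|ring].
    intros r t. symmetry. apply P0. }
  assert (Cc : appr2 (polar_fun z0 (j0 (jc (comp_fields E L)))) 0 (- Re Q)).
  { apply (appr2_ext _ _ _ _ _ _ Nc); [|ring|ring]. intros r t. symmetry. apply P0. }
  assert (Cd : appr2 (polar_fun z0 (j0 (jd (comp_fields E L)))) 0 (- Im Q)).
  { apply (appr2_ext _ _ _ _ _ _ Nd); [|ring|ring]. intros r t. symmetry. apply P0. }
  assert (Ga : appr2 (j0 (ja (polar_fields z0 F))) ea ka).
  { apply (appr2_ext _ _ _ _ _ _ (appr2_lin 1 _ _ _ 1 _ _ _
      (appr2_lin 1 _ _ _ (2 * l1) _ _ _ Ca Cc) (appr2_lin (2 * l2) _ _ _ 1 _ _ _ Cd (appr2_const (- (l1 * l1 + l2 * l2)))))).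
    - intros r t. simpl. unfold polar_fun. simpl. ring.
    - unfold ea. ring.
    - unfold ka. ring. }
  assert (Gb : appr2 (j0 (jb (polar_fields z0 F))) (- om) kb).
  { apply (appr2_ext _ _ _ _ _ _ (appr2_lin 1 _ _ _ 1 _ _ _
      (appr2_lin 1 _ _ _ (2 * l1) _ _ _ Cb Cd) (appr2_lin (- 2 * l2) _ _ _ 1 _ _ _ Cc (appr2_const (- om))))).
    - intros r t. simpl. unfold polar_fun. simpl. ring.
    - ring.
    - unfold kb. ring. }
  assert (Gc : appr2 (j0 (jc (polar_fields z0 F))) (- l1) (- Re Q)).
  { apply (appr2_ext _ _ _ _ _ _ (appr2_lin 1 _ _ _ 1 _ _ _ Cc (appr2_const (- l1)))).
    - intros r t. simpl. unfold polar_fun. simpl. ring.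
    - ring.
    - ring. }
  assert (Gd : appr2 (j0 (jd (polar_fields z0 F))) (- l2) (- Im Q)).
  { apply (appr2_ext _ _ _ _ _ _ (appr2_lin 1 _ _ _ 1 _ _ _ Cd (appr2_const (- l2)))).
    - intros r t. simpl. unfold polar_fun. simpl. ring.
    - ring.
    - ring. }
  destruct (exterior_far B) as (Rf & PRf & Hf). pose proof (Rabs_pos z0) as Pz.
  (* Beyond this radius every half circle about the shifted centre lies in the exterior. *)
  set (R0 := Rf + Rabs z0).
  assert (Hfar : forall r t, far R0 r t -> polar_dom z0 (ext2 B) r t).
  { intros r t Hr. unfold far, R0 in Hr. apply Hf; [apply Rabs_pos|].
    pose proof (radius_polar z0 r t ltac:(lra)) as HR. apply Rabs_le_between in HR. lra. }
  assert (HF : fields_on (far R0) (polar_fields z0 F)).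
  { destruct (polar_fields_on z0 _ _ (ext2_open B) (good_on _ _ gF)) as (A1 & A2 & A3 & A4).
    assert (S : forall j, jet_on (polar_dom z0 (ext2 B)) j -> jet_on (far R0) j).
    { intros j (J0 & J1 & J2). split; [|split]; (eapply grad_on_sub; [exact Hfar|]); assumption. }
    exact (conj (S _ A1) (conj (S _ A2) (conj (S _ A3) (S _ A4)))). }
  assert (HE : forall r t, R0 < r -> 0 < t < PI -> ernst_at polar_weights (polar_fields z0 F) r t).
  { intros r t Hr Ht. apply polar_ernst. apply (good_ernst _ _ gF).
    - apply (Hfar r t). exact Hr.
    - apply Rmult_lt_0_compat; [unfold R0 in Hr; lra|apply sin_gt_0; lra]. }
  assert (PR0 : 0 < R0) by (unfold R0; lra).
  assert (HX : ea + - l1 * - l1 + - l2 * - l2 = 1) by (unfold ea; ring).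
  destruct (admissible_components R0 (polar_fields z0 F) HF _ _ _ _ _ _ _ _ Ga Gb Gc Gd) as (Ma & Mb & Mc & Md).
  assert (K1 := admissible_const R0 (polar_fields z0 F) 1). assert (K0 := admissible_const R0 (polar_fields z0 F) 0).
  assert (Opp : forall j k l, admissible R0 (polar_fields z0 F) j k l ->
    admissible R0 (polar_fields z0 F) (jlin (-1) j 0 (jconst 0)) (- k) (- l)).
  { intros j k l Hj. replace (- k) with (-1 * k + 0 * 0) by ring. replace (- l) with (-1 * l + 0 * 0) by ring.
    apply admissible_lin; assumption. }
  assert (Adm : forall q, admissible R0 (polar_fields z0 F) (sre q (polar_fields z0 F))
      (selr q 1 ea (- om) (- l1) (- l2)) (selr q 0 ka kb (- Re Q) (- Im Q)) /\
    admissible R0 (polar_fields z0 F) (sim q (polar_fields z0 F))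
      (seli q ea (- om) (- l1) (- l2)) (seli q ka kb (- Re Q) (- Im Q))).
  { intros q. destruct q; split; simpl; try assumption; apply Opp; assumption. }
  (* The NUT parameter is gauge invariant, and it is zero before the transformation because the
     twist has no coefficient of [1 / r]. *)
  assert (NUT : kb + 2 * (- l1 * - Im Q - - l2 * - Re Q) = 0) by (unfold kb; ring).
  exact (far_flux R0 (polar_fields z0 F) PR0 HF HE ea (- om) (- l1) (- l2) ka kb (- Re Q) (- Im Q)
    Ga Gb Gc Gd HX _ _ _ _ _ _ _ _ _ _ _ _ NUT (proj1 (Adm s)) (proj2 (Adm s)) (proj1 (Adm s')) (proj2 (Adm s'))).
Qed.

End Solution.

Theorem proposition2 (B : boundary_curve) (W : electrovac_spacetime B)
  (d : cauchy_data B) (omega1 : R) (lambda1 : C) :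
  has_positive_mass_solution (cauchy_family d omega1 lambda1) ->
  forall (omega2 : R) (lambda2 : C),
    cauchy_family d omega2 lambda2 <> cauchy_family d omega1 lambda1 ->
    ~ has_positive_mass_solution (cauchy_family d omega2 lambda2).
Proof.
  intros (E1 & L1 & M1 & J1 & Q1 & S1 & P1) omega2 lambda2 Hne (E2 & L2 & M2 & J2 & Q2 & S2 & P2).
  apply Hne. clear Hne.
  destruct (curve_bounded B) as (Z & PZ & HZ).
  assert (HZ' : forall p, on_curve B p -> snd p <= Z).
  { intros p Hp. apply Rle_trans with (1 := Rle_abs _). apply HZ, Hp. }
  destruct (exterior_far B) as (Rf & PRf & Hf).
  (* One unit above the arc, as [curve_thin] requires. *)
  set (z0 := Z + 1).
  assert (EQ : forall s s', 
    charge s s' (1 - (Re lambda1 * Re lambda1 + Im lambda1 * Im lambda1)) (- omega1) (- Re lambda1) (- Im lambda1)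
      (- (2 * M1) - 2 * Re lambda1 * Re Q1 - 2 * Im lambda1 * Im Q1)
      (- 2 * Re lambda1 * Im Q1 + 2 * Im lambda1 * Re Q1) (- Re Q1) (- Im Q1) =
    charge s s' (1 - (Re lambda2 * Re lambda2 + Im lambda2 * Im lambda2)) (- omega2) (- Re lambda2) (- Im lambda2)
      (- (2 * M2) - 2 * Re lambda2 * Re Q2 - 2 * Im lambda2 * Im Q2)
      (- 2 * Re lambda2 * Im Q2 + 2 * Im lambda2 * Re Q2) (- Re Q2) (- Im Q2)).
  { intros s s'.
    apply (charge_unique _ _ _ _ (Rf + Rabs z0) (solution_charge B d _ _ _ _ _ _ _ S1 z0 s s')
      (solution_charge B d _ _ _ _ _ _ _ S2 z0 s s')).
    intros r Hr. pose proof (Rabs_pos z0).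
    apply (flux_half_circle B _ _ (solution_good B d _ _ _ _ _ _ _ S1) (solution_good B d _ _ _ _ _ _ _ S2)) with Z.
    - intros p Hp. exists (data_vals B d (exist _ p Hp)).
      destruct (solution_boundary B d _ _ _ _ _ _ _ S1 (exist _ p Hp)) as [A1 A2].
      destruct (solution_boundary B d _ _ _ _ _ _ _ S2 (exist _ p Hp)) as [A3 _]. auto.
    - unfold z0. lra.
    - exact HZ'.
    - lra.
    - intros t. apply Hf; [apply Rabs_pos|].
      pose proof (radius_polar z0 r t ltac:(lra)) as HR. apply Rabs_le_between in HR. lra. }
  (* Pairing [1] with the potentials gives the real and imaginary parts of [m] and [Q]; pairing [E]
     with [- i E] gives [Im (conj e m)], and with [L] and [- i L] the two parts of
     [conj e Q + 2 lambda conj m]. *)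
  pose proof (EQ SOne SE) as H1. pose proof (EQ SOne SiE) as H2. pose proof (EQ SOne SL) as H3.
  pose proof (EQ SOne SiL) as H4. pose proof (EQ SE SiE) as H5. pose proof (EQ SE SL) as H6.
  pose proof (EQ SE SiL) as H7. clear EQ. unfold charge, selr, seli in *.
  destruct (charges_determine_gauge (Re lambda1) (Im lambda1) omega1 M1 (Re Q1) (Im Q1)
    (Re lambda2) (Im lambda2) omega2 M2 (Re Q2) (Im Q2) P1 P2) as (K1 & K2 & K3); try lra.
  assert (lambda2 = lambda1).
  { destruct lambda1, lambda2. unfold Re, Im in K1, K2. simpl in K1, K2. rewrite K1, K2. reflexivity. }
  subst. reflexivity.
Qed.
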